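(* Under Assumptions 1, 3 and 5, there exist a stationary policy $\Pi^*\in\bar\Pi^C_{W,S}$ and an initial distribution $\pi_0^*$ such that the limit $\lim_{T\to\infty}E^{\Pi^*}_{\pi_0^*}\big[\frac1T\sum_{t=0}^{T-1}c(\pi_t,Q_t)\big]$ exists and $$\lim_{T\to\infty}E^{\Pi^*}_{\pi_0^*}\Big[\frac1T\sum_{t=0}^{T-1}c(\pi_t,Q_t)\Big]\le\liminf_{T\to\infty}E^{\Pi}_{\delta_{x_0}}\Big[\frac1T\sum_{t=0}^{T-1}c(\pi_t,Q_t)\Big]$$ for every $x_0\in\mathbb R^d$ and every $\Pi\in\bar\Pi^C_W$.
   Context: Assumption 1: the source is $x_{t+1}=f(x_t,w_t)$ with Borel $f$, $\{w_t\}$ i.i.d. and independent of $x_0\sim\pi_0$; for each $x$ the law of $f(x,w_0)$ has a density $\phi(\cdot|x)$ which is strictly positive everywhere, bounded by $C$ and $C_1$-Lipschitz, uniformly in $x$. Assumption 3: (i) $\|f(x,w)\|\le K(\|x\|+\|w\|)$ for some $K>0$; (ii) $\mathbb U=\mathbb R^d$ and $c_0(x,u)=\|x-u\|^2$; (iii) $\int\|z\|^2\nu_w(dz)<\infty$ for the law $\nu_w$ of $w_t$; (iv) $\pi_0$ has a density with finite second moment or is a point mass. Assumption 5: $\{x_t\}$ is positive Harris recurrent with unique invariant measure $\pi^*$, and for some $\epsilon>0$ and all $x_0\in\mathbb R^d$, $\lim_{t\to\infty}E_{\delta_{x_0}}\|x_t\|^{2+\epsilon}=\int\|x\|^{2+\epsilon}\pi^*(dx)<\infty$.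 $\mathcal Q_c$: Borel maps $Q:\mathbb R^d\to\{1,\dots,M\}$ with all cells convex. Cost $c(\pi,Q)=\sum_i\inf_{u\in\mathbb R^d}\int_{Q^{-1}(i)}\|x-u\|^2\pi(dx)$. $\bar\Pi^C_W$ (randomized Markov policies): sequences of stochastic kernels $\bar\eta_t$ from $\mathcal P(\mathbb R^d)$ to $\mathcal Q_c$; at time $t$ a quantizer $Q_t\sim\bar\eta_t(\cdot\mid\pi_t)$ is drawn using randomness $r_t$ shared by encoder and decoder ($\{r_t\}$ i.i.d. uniform on $[0,1]$, independent of $\{x_t\}$), $q_t=Q_t(x_t)$ is sent, and $\pi_t(\cdot)=P(x_t\in\cdot\mid q_{[0,t-1]},r_{[0,t-1]})$. $\bar\Pi^C_{W,S}$ is the subclass of stationary policies ($\bar\eta_t=\bar\eta$ for all $t$). Expectations are also over the randomization. *)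

(* Defs.v *)
From HB Require Import structures.
From mathcomp Require Import all_boot all_order all_algebra.
From mathcomp Require Import all_classical all_reals all_analysis.
From mathcomp Require Import giry.
Set Implicit Arguments. Unset Strict Implicit. Unset Printing Implicit Defensive.
Import Order.TTheory GRing.Theory Num.Theory.
Local Open Scope classical_set_scope.
Local Open Scope ring_scope.

(* Euclidean space R^n, represented by n.-tuple R (product = Borel     *)
(* sigma-algebra from the library).                                    *)
Section Euclid.
Context {R : realType} {n : nat}.

Definition sqdist (x y : n.-tuple R) : R :=
  \sum_(i < n) (tnth x i - tnth y i) ^+ 2.

Definition enorm (x : n.-tuple R) : R :=
  Num.sqrt (\sum_(i < n) (tnth x i) ^+ 2).

Definition tlerp (l : R) (a b : n.-tuple R) : n.-tuple R :=
  [tuple l * tnth a i + (1 - l) * tnth b i | i < n].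

Definition convex_set (S : set (n.-tuple R)) : Prop :=
  forall a b l, S a -> S b -> 0 <= l <= 1 -> S (tlerp l a b).
End Euclid.

(* Lebesgue integral on R^n of a nonnegative function, as the iterated *)
(* one-dimensional Lebesgue integral (Tonelli).                        *)
Fixpoint leb_int {R : realType} (n : nat) : (n.-tuple R -> \bar R) -> \bar R :=
  match n with
  | 0 => fun F => F [tuple]
  | n'.+1 => fun F =>
      (\int[@lebesgue_measure R]_(y in [set: R])
         @leb_int R n' (fun t => F (cons_tuple y t)))%E
  end.

Definition has_density {R : realType} (n : nat)
    (mu : set (n.-tuple R) -> \bar R) (rho : n.-tuple R -> R) : Prop :=
  measurable_fun [set: n.-tuple R] rho /\ (forall y, 0 <= rho y) /\
  forall A : set (n.-tuple R), measurable A ->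
    mu A = leb_int (fun y => (rho y * \1_A y)%:E).

Section Source.
Context {R : realType} {dim k : nat}.
Local Notation X := (dim.-tuple R).
Local Notation W := (k.-tuple R).
Variables (f : X -> W -> X) (nu : probability W R).

Definition trans (x : X) (A : set X) : \bar R := nu (f x @^-1` A).

(* E_{delta_x}[h(x_t)] for nonnegative h, via the Markov recursion *)
Fixpoint iter_exp (t : nat) (h : X -> \bar R) (x : X) : \bar R :=
  match t with
  | 0 => h x
  | t'.+1 => (\int[nu]_(w in [set: W]) iter_exp t' h (f x w))%E
  end.

(* P_{delta_x}(x_s in A for some 1 <= s <= m) *)
Fixpoint hit_prob (m : nat) (A : set X) (x : X) : \bar R :=
  match m with
  | 0 => 0%E
  | m'.+1 => (\int[nu]_(w in [set: W])
               (if `[< A (f x w) >] then 1 else hit_prob m' A (f x w)))%E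
  end.

Definition invariant (p : probability X R) : Prop :=
  forall A : set X, measurable A ->
    (\int[p]_(x in [set: X]) trans x A)%E = p A.

Definition assumption1 : Prop :=
  measurable_fun [set: (X * W)%type] (fun z => f z.1 z.2) /\
  exists (phi : X -> X -> R) (C C1 : R),
    (forall x, has_density (fun A => trans x A) (phi x)) /\
    (forall x y, 0 < phi x y /\ phi x y <= C) /\
    (forall x y y', `|phi x y - phi x y'| <= C1 * enorm [tuple tnth y i - tnth y' i | i < dim]).

Definition initial_ok (p0 : probability X R) : Prop :=
  (exists rho, has_density (fun A => p0 A) rho /\
     (\int[p0]_(x in [set: X]) (enorm x ^+ 2)%:E < +oo)%E)
  \/ (exists x0 : X, forall A, measurable A -> p0 A = \d_x0 A).

(* Assumption 3 (i) and (iii); (ii) is built into the cost [qcost] *)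
Definition assumption3 : Prop :=
  (exists K : R, 0 < K /\ forall x w, enorm (f x w) <= K * (enorm x + enorm w)) /\
  (\int[nu]_(z in [set: W]) (enorm z ^+ 2)%:E < +oo)%E.

Definition assumption5 : Prop :=
  (* Harris recurrence: psi-irreducible and P_x(tau_A < oo) = 1 *)
  (exists psi : {measure set X -> \bar R},
      sigma_finite [set: X] psi /\ (0 < psi [set: X])%E /\
      forall A : set X, measurable A -> (0 < psi A)%E ->
        forall x, (fun m => hit_prob m A x) @ \oo --> 1%E) /\
  exists pstar : probability X R,
    invariant pstar /\
    (forall p : probability X R, invariant p ->
       forall A, measurable A -> p A = pstar A) /\
    exists eps : R, 0 < eps /\
      (\int[pstar]_(x in [set: X]) (powR (enorm x) (2 + eps))%:E < +oo)%E /\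
      forall x0 : X,
        (fun t => iter_exp t (fun y => (powR (enorm y) (2 + eps))%:E) x0)
          @ \oo --> (\int[pstar]_(x in [set: X]) (powR (enorm x) (2 + eps))%:E)%E.
End Source.

Section Coding.
Context {R : realType} {dim k M : nat}.
Local Notation X := (dim.-tuple R).
Local Notation W := (k.-tuple R).
Local Notation BS := (giry X R).   (* (sub)probability measures on R^dim *)

Definition convex_quantizer (Q : X -> 'I_M) : Prop :=
  forall i : 'I_M, measurable (Q @^-1` [set i]) /\ convex_set (Q @^-1` [set i]).

Definition qcost (p : BS) (Q : X -> 'I_M) : \bar R :=
  (\sum_(i < M) ereal_inf
     [set (\int[p]_(x in Q @^-1` [set i]) (sqdist x u)%:E) | u in [set: X]])%E.

(* A randomized Markov policy: Q_t = g t pi_t r_t, r_t ~ U[0,1];       *)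
(* g t p (.) is the randomization of the kernel eta_t(. | p).          *)
Definition policy := nat -> BS -> R -> X -> 'I_M.

Definition admissible (g : policy) : Prop :=
  (forall t p u, convex_quantizer (g t p u)) /\
  (forall t (i : 'I_M),
     measurable [set z : ((BS * R) * X)%type | g t z.1.1 z.1.2 z.2 = i]).

Definition stationary (g : policy) : Prop := forall t, g t = g 0%N.

Section Realization.
Variables (f : X -> W -> X) (nu : probability W R).
Variables (mu0 : set X -> \bar R) (g : policy).
Variables (dO : measure_display) (O : measurableType dO) (P : probability O R).
Variables (x : nat -> O -> X) (w : nat -> O -> W) (r : nat -> O -> R)
          (pi : nat -> O -> BS).

Definition quant (t : nat) (o : O) : X -> 'I_M := g t (pi t o) (r t o).
Definition qsym (t : nat) (o : O) : 'I_M := quant t o (x t o).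

Definition info (t : nat) : set (set O) :=
  <<s [set E | exists2 s, (s < t)%N &
         ((exists i : 'I_M, E = [set o | qsym s o = i]) \/
          (exists2 B : set R, measurable B & E = r s @^-1` B))] >>.

Definition realization : Prop :=
  measurable_fun [set: O] (x 0%N) /\
      (forall t, measurable_fun [set: O] (w t)) /\
      (forall t, measurable_fun [set: O] (r t)) /\
      (forall t o, x t.+1 o = f (x t o) (w t o)) /\
      (* x_0 ~ mu0, w_t iid ~ nu, r_t iid ~ U[0,1], all mutually independent *)
      (forall (m : nat) (A : set X) (B : nat -> set W) (C : nat -> set R),
         measurable A -> (forall i, measurable (B i)) -> (forall i, measurable (C i)) ->
         P (x 0%N @^-1` A `&` \bigcap_(i in [set j | (j < m)%N]) (w i @^-1` B i)
                          `&` \bigcap_(i in [set j | (j < m)%N]) (r i @^-1` C i))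
         = (mu0 A * \prod_(i < m) nu (B i)
                  * \prod_(i < m) (@lebesgue_measure R) (C i `&` `[0%R, 1%R]))%E) /\
      (* pi_t(.) = P(x_t in . | q_[0,t-1], r_[0,t-1]) *)
      (forall t o, pi t o [set: X] = 1%E) /\
      (forall t (B : set BS), measurable B -> info t (pi t @^-1` B)) /\
      (forall t (A : set X) (G : set O), measurable A -> info t G ->
         P (G `&` x t @^-1` A) = (\int[P]_(o in G) pi t o A)%E).

Definition avg_cost (T : nat) : \bar R :=
  (\int[P]_(o in [set: O])
     ((T%:R^-1)%:E * \sum_(t < T) qcost (pi t o) (quant t o)))%E.
End Realization.
End Coding.

(* Main.v *)
(* Vanishing discount, with neither weak limits of beliefs nor an ergodic theorem for the filter.

   The positive Lipschitz densities give a minorization [trans x E >= s x * m E], where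
   [s = delta * 1_A] and [m] is a probability with a density. By Harris recurrence and the renewal
   equation, the expected number of regenerations before time [T] is asymptotic to [T / e] from every
   initial point and from [m], where [e] is the mean regeneration time.

   Beliefs are kept unnormalised, so that one step of the filter splits a belief [p] into the measures
   [p_i] carried by the cells of the quantizer. The optimal discounted cost [V] ([disc_value]) is then
   homogeneous and superadditive. Let [U p] ([disc_visits]) be the expected discounted number of
   regenerations. For a suitable [theta] the relative value [h = V - theta * U] ([rel_value]) is
   nonnegative, because each regeneration splits a multiple of [m] off the belief and [V] is
   superadditive; moreover [h m = theta / beta] and
   [h p + theta * p(s) = inf_Q (C(p, Q) + beta * sum_i h p_i)].
   The upper half of this identity, telescoped along the tree of observed symbols, bounds the average
   cost of every policy from below by [theta / e], for each discount factor [beta].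

   As [beta -> 1] the constants [theta] stay bounded, by the second moment of the invariant measure. The
   lower limit of [h] in total variation then satisfies the lower half with [beta = 1] and the
   supremum of the [theta]s: quantizers with convex cells are cut out by hyperplanes, hence
   subsequentially compact off a set that every measure with a density neglects. The minimising
   quantizers form a stationary policy with average cost at most [sup theta / e] from [m]. It has to be
   prescribed only on the countably many beliefs reachable from [m], so no measurable selection is
   needed.

   In a realization, conditionally on the shared randomization, the belief is a deterministic function
   of the observed symbols, so expected costs are integrals of sums over the tree. *)
Require Import Defs.
From HB Require Import structures.
From mathcomp Require Import all_boot all_order all_algebra.
From mathcomp Require Import all_classical all_reals all_analysis.
From mathcomp Require Import measurable_realfun giry.
Set Implicit Arguments. Unset Strict Implicit. Unset Printing Implicit Defensive.
From mathcomp Require Import ring lra zify.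
Import Order.TTheory GRing.Theory Num.Theory.
Local Open Scope classical_set_scope.
Local Open Scope ring_scope.
Import numFieldNormedType.Exports.

(** * Minorization of the transition kernel *)

(** No regularity or ergodicity of the belief process is at hand. All long-run information is
    therefore carried by the uncontrolled state chain, through its regenerations, whose expected
    number no policy can influence. This makes [theta] a price per regeneration: one regeneration
    per [e] units of time costs [theta / e] per unit of time. Splitting a belief is possible because
    quantization costs are infima over reconstruction points, hence superadditive in the
    unnormalised belief. The constants [theta] stay bounded because at the invariant law both the
    discounted cost and the discounted number of regenerations grow like [1 / (1 - beta)]. The order
    of limits matters. In the lower bound [beta] is fixed while [T] grows, so a residual of order
    [1 / (1 - beta)] disappears after division by [T]; only afterwards does [beta] tend to 1. In the
    upper bound the residual is nonnegative and is dropped, so the limiting relative value has to be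
    finite only along the tree issued from [m]. Its lower limit is joint in the discount factor and
    the belief, since near-optimal quantizers change with the discount factor and move the updated
    beliefs. *)

Section Integrals.
Local Open Scope ereal_scope.
Context {R : realType}.

(** For a nonnegative integrand the integral is a supremum over simple functions below it, so
    monotonicity requires no measurability. *)
Lemma ge0_le_integral_nonmeasurable d (T : measurableType d)
    (mu : {measure set T -> \bar R}) (D : set T) (f g : T -> \bar R) :
  (forall x, D x -> 0 <= f x) -> (forall x, D x -> f x <= g x) ->
  \int[mu]_(x in D) f x <= \int[mu]_(x in D) g x.
Proof.
move=> f0 fg.
have g0 x : D x -> 0 <= g x by move=> Dx; apply: le_trans (fg _ Dx); exact: f0.
rewrite !ge0_integralE//.
apply: le_ereal_sup => _ [h /= hf <-]; exists h => //= x.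
apply: le_trans (hf x) _; rewrite /patch; case: ifPn => //; rewrite inE.
exact: fg.
Qed.

(** The integral against [kap z] is the integral of [h] against the product of the Dirac mass at [z]
    with [kap z], a point of the space of measures that depends measurably on [z]. *)
Lemma measurable_int_param dZ (Z : measurableType dZ) dX (X : measurableType dX)
    (kap : Z -> giry X R) (h : (Z * X)%type -> \bar R) :
  measurable_fun [set: Z] kap -> measurable_fun [set: (Z * X)%type] h ->
  (forall z, 0 <= h z) ->
  measurable_fun [set: Z] (fun z => \int[kap z]_x h (z, x)).
Proof.
move=> mk mh h0.
have -> : (fun z => \int[kap z]_x h (z, x)) =
    (fun z => giry_int (giry_prod (giry_ret z, kap z)) h).
  apply/funext => z; rewrite giry_int_prod1// giry_int_ret//.
  exact: (measurable_fun_fubini_tonelli_F h).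
apply: (@measurableT_comp _ _ _ _ _ _ (fun mu => giry_int mu h)
   _ (fun z => giry_prod (giry_ret z, kap z))).
  exact: measurable_giry_int.
apply: (@measurableT_comp _ _ _ _ _ _ (@giry_prod _ _ Z X R)
   _ (fun z => (giry_ret z, kap z))); first exact: measurable_giry_prod.
apply: measurable_fun_pair => //; exact: measurable_giry_ret.
Qed.

Lemma int_eq_on d (T : measurableType d) (p q : {measure set T -> \bar R}) (f : T -> \bar R)
   (D : set T) :
  (forall A, measurable A -> p A = q A) ->
  \int[p]_(x in D) f x = \int[q]_(x in D) f x.
Proof. by move=> pq; apply: eq_measure_integral => A mA _; exact: pq. Qed.

End Integrals.

(** * The transition kernel and the unnormalised filter *)

Section Kernel.
Local Open Scope ereal_scope.
Context {R : realType} {dim k : nat}.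
Local Notation X := (dim.-tuple R).
Local Notation W := (k.-tuple R).
Local Notation BS := (giry X R).
Variables (f : X -> W -> X) (nu : probability W R).
Hypothesis mf : measurable_fun [set: (X * W)%type] (fun z => f z.1 z.2).

Definition markov_op (h : X -> \bar R) (x : X) : \bar R := \int[nu]_w h (f x w).

Lemma measurable_f1 x : measurable_fun [set: W] (f x).
Proof.
exact: (measurableT_comp mf (measurable_pair1 x)).
Qed.

Definition law (x : X) : BS := giry_map (measurable_f1 x) nu.

Lemma int_law x (h : X -> \bar R) : measurable_fun setT h -> (forall x, 0 <= h x) ->
  \int[law x]_y h y = markov_op h x.
Proof.
move=> mh h0.
exact: (giry_int_map (measurable_f1 x) nu).
Qed.

Lemma measurable_markov_op (h : X -> \bar R) : measurable_fun setT h -> (forall x, 0 <= h x) ->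
  measurable_fun setT (markov_op h).
Proof.
move=> mh h0.
apply: (@measurable_int_param _ _ _ _ _ (fun=> (nu : giry W R))
   (fun z => h (f z.1 z.2))) => //.
exact: measurableT_comp mh mf.
Qed.

Lemma measurable_law : measurable_fun setT law.
Proof.
apply: measurable_giry_codensity => // B mB.
have -> : law^~ B = markov_op (fun y => (\1_B y)%:E).
  apply/funext => x; rewrite -int_law//.
  - by rewrite integral_indic// setIT.
  - by apply/measurable_EFinP; exact: measurable_indic.
apply: measurable_markov_op => //.
by apply/measurable_EFinP; exact: measurable_indic.
Qed.

(** Mass starting outside [D] is lost, so this kernel restricts to [D] without normalising. *)
Definition kill (D : set X) (x : X) : BS := if x \in D then law x else mzero.

Lemma measurable_kill D : measurable D -> measurable_fun setT (kill D).
Proof.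
move=> mD; apply: measurable_fun_if => //.
- apply: (@measurable_fun_bool _ _ _ _ true).
  rewrite setTI (_ : _ @^-1` _ = D)//.
  by apply/seteqP; split => x /=; [exact: set_mem|exact: mem_set].
- exact: measurable_funTS measurable_law.
Qed.

(* The joint law of [x_t \in D] and [x_t.+1], for [x_t] with law [p]; [mzero] when [D] is not
   measurable. *)
Definition upd (p : BS) (D : set X) : BS :=
  if pselect (measurable D) is left mD then giry_bind p (measurable_kill mD) else mzero.

Lemma markov_op_ge0 h x : (forall x, 0 <= h x) -> 0 <= markov_op h x.
Proof. by move=> h0; exact: integral_ge0. Qed.

Lemma int_upd p D (h : X -> \bar R) : measurable D ->
  measurable_fun setT h -> (forall x, 0 <= h x) ->
  \int[upd p D]_y h y = \int[p]_(x in D) markov_op h x.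
Proof.
move=> mD mh h0; rewrite /upd; case: pselect => // mD'.
have := giry_int_bind p (measurable_kill mD') mh h0.
rewrite {1 2}/giry_int => ->.
rewrite [RHS]integral_mkcond.
apply: eq_integral => x _; rewrite /giry_int /kill /patch; case: ifP => xD.
  exact: int_law.
exact: integral_measure_zero.
Qed.

End Kernel.

(** * Iterated Lebesgue integrals: boxes and hyperplanes *)

Section Lebesgue.
Local Open Scope ereal_scope.
Context {R : realType}.

Definition dot n (a x : n.-tuple R) : R := (\sum_(i < n) tnth a i * tnth x i)%R.

Definition box n (r : R) : set (n.-tuple R) := [set y | forall i, (`|tnth y i| <= r)%R].

Lemma leb_int_ge0 n (F : n.-tuple R -> \bar R) : (forall y, 0 <= F y) -> 0 <= leb_int F.
Proof.
elim: n F => [|n IH] F F0 /=; first exact: F0.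
by apply: integral_ge0 => y _; exact: IH.
Qed.

Lemma leb_int_le n (F G : n.-tuple R -> \bar R) : (forall y, 0 <= F y) ->
  (forall y, F y <= G y) -> leb_int F <= leb_int G.
Proof.
elim: n F G => [|n IH] F G F0 FG /=; first exact: FG.
by apply: ge0_le_integral_nonmeasurable => [y _|y _]; [exact: leb_int_ge0|exact: IH].
Qed.

Lemma leb_int0 n (F : n.-tuple R -> \bar R) : (forall y, F y = 0) -> leb_int F = 0.
Proof.
elim: n F => [|n IH] F F0 /=; first exact: F0.
by apply: integral0_eq => y _; exact: IH.
Qed.

Lemma measurable_leb_int dZ (Z : measurableType dZ) n (F : (Z * n.-tuple R)%type -> \bar R) :
  measurable_fun setT F -> (forall z, 0 <= F z) ->
  measurable_fun setT (fun z => leb_int (fun t => F (z, t))).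
Proof.
elim: n dZ Z F => [|n IH] dZ Z F mF F0 /=.
  exact: (measurableT_comp mF (measurable_pair2 _)).
apply: (measurable_fun_fubini_tonelli_F (m2 := lebesgue_measure)
  (fun zy : Z * R => leb_int (fun t : n.-tuple R => F (zy.1, cons_tuple zy.2 t)))).
- apply: (IH _ _ (fun w : (Z * R) * n.-tuple R => F (w.1.1, cons_tuple w.1.2 w.2))) => //.
  apply: (measurableT_comp mF); apply: measurable_fun_pair.
    exact: measurableT_comp.
  apply: (measurable_cons (f := fun w : (Z * R) * n.-tuple R => w.1.2)
    (g := fun w : (Z * R) * n.-tuple R => w.2)); first exact: measurableT_comp.
  exact: measurable_snd.
- by move=> z /=; apply: leb_int_ge0.
Qed.

Lemma leb_intZ n (c : R) (F : n.-tuple R -> \bar R) : (0 <= c)%R ->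
  measurable_fun setT F -> (forall y, 0 <= F y) ->
  leb_int (fun y => c%:E * F y) = c%:E * leb_int F.
Proof.
move=> c0; elim: n F => [|n IH] F mF F0 //=.
have mc y : measurable_fun setT (fun t : n.-tuple R => F (cons_tuple y t)).
  apply: (measurableT_comp mF).
  exact: (measurable_cons (f := fun=> y) (g := fun t : n.-tuple R => t)).
under eq_integral do rewrite IH//.
rewrite ge0_integralZl_EFin//.
- by move=> y _; exact: leb_int_ge0.
- apply: (measurable_leb_int (F := fun z : R * n.-tuple R => F (cons_tuple z.1 z.2))) => //.
  apply: (measurableT_comp mF).
  apply: (measurable_cons (f := fun z : R * n.-tuple R => z.1)
    (g := fun z : R * n.-tuple R => z.2)); first exact: measurable_fst.
  exact: measurable_snd.
Qed.

Lemma leb_int_box n (c r : R) : (0 <= c)%R -> (0 <= r)%R ->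
  leb_int (fun y : n.-tuple R => (c * \1_(@box n r) y)%:E) = (c * (2 * r) ^+ n)%:E.
Proof.
move=> + r0; elim: n c => [|n IH] c c0 /=.
  by rewrite indicE mem_set ?mulr1 ?expr0// => -[].
pose J : set R := [set` `[(- r)%R, r]%R].
have E y t : (c * \1_(@box n.+1 r) (cons_tuple y t) =
    (c * \1_J y) * \1_(@box n r) t)%R.
  rewrite -mulrA; congr (_ * _)%R; rewrite !indicE -natrM mulnb; congr ((nat_of_bool _)%:R).
  apply/idP/andP => [|[]]; rewrite !inE /box/J/= in_itv/= => H.
    split; first by have := H ord0; rewrite tnth0 ler_norml.
    by move=> i; have := H (lift ord0 i); rewrite tnthS.
  by move=> H' i; case: (unliftP ord0 i) => [j ->|->]; rewrite ?tnthS ?tnth0// ler_norml.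
have cJ y : (0 <= c * \1_J y)%R by rewrite mulr_ge0.
under eq_integral => y _.
  under eq_fun do rewrite E.
  rewrite IH; last exact: cJ.
  rewrite -mulrA (mulrC (\1_J y)) mulrA EFinM.
  over.
have mJ' : measurable J by exact: measurable_itv.
have mJ : measurable_fun setT (fun y : R => (\1_J y)%:E : \bar R).
  by apply/measurable_EFinP; apply: measurable_indic; exact: measurable_itv.
have cr0 : (0 <= c * (2 * r) ^+ n)%R by rewrite mulr_ge0// exprn_ge0// mulr_ge0.
rewrite /= ge0_integralZl_EFin//.
rewrite integral_indic// setIT /J [X in _ * X]lebesgue_measure_itv/= lte_fin.
have [r1|] := ltrP (- r) r.
  by rewrite -EFinD -EFinM exprS; congr (_%:E); ring.
move=> rr; have -> : r = 0%R by lra.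
by rewrite mule0 exprS !mulr0 mul0r mulr0.
Qed.

(** Induction on the dimension. If a coefficient other than the first is nonzero, each slice is
    again carried by a hyperplane; otherwise the first coordinate is confined to the single value
    [- b / tnth a ord0]. *)
Lemma leb_int_hyperplane n (a : n.-tuple R) (b : R) (F : n.-tuple R -> \bar R) :
  (exists i, tnth a i != 0%R) -> (forall y, (dot a y + b != 0)%R -> F y = 0) ->
  leb_int F = 0.
Proof.
elim: n a b F => [|n IH] a b F [i ai] F0 /=; first by case: i ai.
have beE j : tnth (behead_tuple a) j = tnth a (lift ord0 j).
  by rewrite tnth_behead; congr (tnth a _); apply/val_inj; rewrite /= inordK// ltnS.
have dE y t : dot a (cons_tuple y t) = (tnth a ord0 * y + dot (behead_tuple a) t)%R.
  rewrite /dot big_ord_recl tnth0; congr (_ + _)%R; apply: eq_bigr => j _.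
  by rewrite tnthS beE.
case: (pselect (exists j, tnth (behead_tuple a) j != 0%R)) => [a'|a'].
  apply: integral0_eq => y _.
  apply: (IH (behead_tuple a) (tnth a ord0 * y + b)%R) => // t Ht.
  apply: F0; rewrite dE; move: Ht; rewrite addrA.
  by rewrite (addrC (dot _ _)).
have a'0 j : tnth (behead_tuple a) j = 0%R.
  by apply/eqP/negP => /negP h; apply: a'; exists j.
have a0 : tnth a ord0 != 0%R.
  case: (unliftP ord0 i) ai => [j ->|->]//.
  by have := a'0 j; rewrite beE => ->; rewrite eqxx.
pose g := fun y : R => leb_int (fun t => F (cons_tuple y t)).
rewrite (_ : (fun y : R => leb_int (fun t => F (cons_tuple y t))) =
   g \_ [set (- b / tnth a ord0)%R]).
  by rewrite -integral_mkcond integral_set1.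
apply/funext => y; rewrite /patch; case: ifPn => // /negP yn.
apply: leb_int0 => t; apply: F0; rewrite dE.
have -> : dot (behead_tuple a) t = 0%R.
  by rewrite /dot big1// => j _; rewrite a'0 mul0r.
rewrite addr0; apply/negP => /eqP h; apply: yn; rewrite inE/=.
apply: (mulfI a0); rewrite mulrCA divff// mulr1.
by apply/eqP; rewrite -subr_eq0 opprK h.
Qed.

End Lebesgue.

Section Minorization.
Local Open Scope ereal_scope.
Context {R : realType} {dim k : nat}.
Local Notation X := (dim.-tuple R).
Local Notation W := (k.-tuple R).
Local Notation BS := (giry X R).
Variables (f : X -> W -> X) (nu : probability W R).
Hypothesis A1 : assumption1 f nu.

(** This is what the compactness of quantizers uses of a density: limits of quantizers are
    controlled only off finitely many hyperplanes. *)
Definition hyperplane_null (p : set X -> \bar R) :=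
  forall (a : X) (b : R), (exists i, tnth a i != 0%R) ->
    p [set x | dot a x + b == 0]%R = 0.

Lemma measurable_dot (a : X) : measurable_fun setT (dot a).
Proof.
apply: measurable_sum => i; apply: measurable_funM => //; exact: measurable_tnth.
Qed.

Lemma measurable_hyperplane (a : X) (b : R) : measurable [set x | dot a x + b == 0]%R.
Proof.
rewrite (_ : [set x | _] = (fun x => dot a x + b)%R @^-1` [set 0%R]); last first.
  by apply/seteqP; split => x /= /eqP.
rewrite -(setTI (_ @^-1` _)); apply: measurable_funD => //; exact: measurable_dot.
Qed.

Lemma measurable_box (r : R) : measurable (@box R dim r).
Proof.
rewrite (_ : box r = \bigcap_(i in [set: 'I_dim]) [set y : X | `|tnth y i| <= r]%R).
  apply: fin_bigcap_measurable => // i _; rewrite -(setTI [set y : X | _]).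
  rewrite (_ : [set y : X | (_ <= r)%R] = (fun y => tnth y i) @^-1` [set` `[(- r)%R, r]%R]).
    exact: (measurable_tnth i measurableT).
  by apply/seteqP; split => x /=; rewrite in_itv/= ler_norml.
by apply/seteqP; split => x /= H i; [move=> _|]; exact: H.
Qed.

Lemma trans_measurable (E : set X) : measurable E -> measurable_fun setT (fun x => trans f nu x E).
Proof.
case: A1 => mf _ mE.
apply: (@measurableT_comp _ _ _ _ _ _ (fun p : BS => p E) _ (law nu mf)).
  exact: (measurable_giry_ev (R := R)).
exact: measurable_law.
Qed.

Lemma trans_hyperplane_null x : hyperplane_null (trans f nu x).
Proof.
case: A1 => mf [phi [C [C1 [hphi _]]]] a b ha.
have [_ [_ ->]] := hphi x; last exact: measurable_hyperplane.
apply: (leb_int_hyperplane (a := a) (b := b)) => // y hy.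
by rewrite indicE memNset ?mulr0//=; apply/negP.
Qed.

Lemma enorm_box (r : R) (y y' : X) : (0 <= r)%R -> box r y -> box r y' ->
  (enorm [tuple tnth y i - tnth y' i | i < dim] <= 2 * r * Num.sqrt dim%:R)%R.
Proof.
move=> r0 yr y'r; rewrite /enorm.
rewrite -(@ger0_norm _ (2 * r)%R) ?mulr_ge0// -sqrtr_sqr -sqrtrM ?sqr_ge0//.
rewrite ler_wsqrtr//.
apply: (@le_trans _ _ (\sum_(i < dim) (2 * r) ^+ 2)%R); last first.
  by rewrite sumr_const card_ord mulr_natr.
apply: ler_sum => i _; rewrite tnth_mktuple -real_normK ?num_real//.
rewrite lerXn2r// ?nnegrE ?mulr_ge0//.
apply: le_trans (ler_normB _ _) _.
by rewrite mulr_natl mulr2n lerD// ?yr ?y'r.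
Qed.

(** [A n] collects the states that send mass at least [e n] times the volume to the small box [D n].
    There the densities oscillate by at most [e n / 4], uniformly in the state, so from [A n] they
    are at least [e n / 4] throughout the box. Since [phi x] is positive at the origin, every state
    lies in all late [A n], and some [A n] has positive measure for both [psi] and [pst]. *)
Lemma minorization (psi : {measure set X -> \bar R}) (pst : probability X R) :
  0 < psi setT ->
  exists (A : set X) (delta : R) (m : probability X R),
    [/\ measurable A, (0 < delta <= 1)%R,
      (exists rho, has_density (fun E => m E) rho),
      (forall x E, A x -> measurable E -> delta%:E * m E <= trans f nu x E) &
      hyperplane_null m /\ 0 < psi A /\ 0 < pst A].
Proof.
move=> psi0; case: (A1) => mf [phi [C [C1 [hphi [hC hL]]]]].
pose kap := (`|C1| * (2 * Num.sqrt dim%:R) + 1)%R.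
have kap0 : (0 < kap)%R.
  by rewrite /kap ltr_wpDl// !mulr_ge0// sqrtr_ge0.
pose e n : R := (n.+1%:R^-1)%R.
have e0 n : (0 < e n)%R by rewrite /e invr_gt0.
(* With this radius the Lipschitz constant times the diameter of the box is at most [e n / 4]; the
   [+ 1] in [kap] avoids a division by zero. *)
pose r n := (e n / 4 / kap)%R.
have r0 n : (0 < r n)%R by rewrite /r !divr_gt0.
pose D n := @box R dim (r n).
have mD n : measurable (D n) by exact: measurable_box.
pose A n := [set x : X | (e n * (2 * r n) ^+ dim)%:E <= trans f nu x (D n)].
have mA n : measurable (A n).
  rewrite -(setTI (A n)); apply: emeasurable_fun_c_infty => //.
  exact: trans_measurable.
have osc n x y y' : D n y -> D n y' -> (`|phi x y - phi x y'| <= e n / 4)%R.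
  move=> Dy Dy'; apply: le_trans (hL x y y') _.
  have h := enorm_box (ltW (r0 n)) Dy Dy'.
  have en0 : (0 <= enorm [tuple tnth y i - tnth y' i | i < dim])%R by exact: sqrtr_ge0.
  apply: (@le_trans _ _ (`|C1| * (2 * r n * Num.sqrt dim%:R))%R).
    by apply: (le_trans (ler_wpM2r en0 (ler_norm C1))); exact: ler_wpM2l.
  rewrite (_ : (e n / 4)%R = (kap * r n)%R); last first.
    by rewrite /r mulrCA divff ?mulr1// gt_eqF.
  rewrite /kap.
  apply: (@le_trans _ _ (`|C1| * (2 * Num.sqrt dim%:R) * r n)%R).
    by rewrite le_eqVlt; apply/orP; left; apply/eqP; ring.
  by rewrite ler_wpM2r ?ltW// ltrDl.
have D0 n : D n [tuple 0%R | _ < dim].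
  by move=> i; rewrite tnth_mktuple normr0 ltW.
have mtr x E : measurable E -> trans f nu x E = leb_int (fun y => (phi x y * \1_E y)%:E).
  by move=> mE; have [_ [_ ->]] := hphi x.
have phige n x c : (0 <= c)%R -> (forall y, D n y -> c <= phi x y)%R ->
    (c * (2 * r n) ^+ dim)%:E <= trans f nu x (D n).
  move=> c0 cphi; rewrite mtr// -leb_int_box//; last exact: ltW.
  apply: leb_int_le => y; first by rewrite lee_fin mulr_ge0.
  rewrite lee_fin indicE; case: (boolP (y \in _)) => [|_]; last by rewrite !mulr0.
  by rewrite inE !mulr1; exact: cphi.
have phile n x c : (0 <= c)%R -> (forall y, D n y -> phi x y <= c)%R ->
    trans f nu x (D n) <= (c * (2 * r n) ^+ dim)%:E.
  move=> c0 cphi; rewrite mtr// -leb_int_box//; last exact: ltW.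
  apply: leb_int_le => y; first by rewrite lee_fin mulr_ge0//; case: (hC x y) => /ltW.
  rewrite lee_fin indicE; case: (boolP (y \in _)) => [|_]; last by rewrite !mulr0.
  by rewrite inE !mulr1; exact: cphi.
have rd n : (0 < (2 * r n) ^+ dim)%R by rewrite exprn_gt0// mulr_gt0.
have AphiD n x y : A n x -> D n y -> (e n / 4 <= phi x y)%R.
  move=> Ax Dy; rewrite leNgt; apply/negP => hlt.
  have e2 : (0 <= e n / 2)%R by rewrite divr_ge0// ltW.
  have := phile n x _ e2.
  have h y' : D n y' -> (phi x y' <= e n / 2)%R.
    move=> Dy'; have := osc n x y' y Dy' Dy; rewrite ler_norml => /andP[_].
    by move: hlt; move: (e0 n) => + + +; lra.
  move=> /(_ h); apply/negP; rewrite -ltNge.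
  apply: (lt_le_trans _ Ax); rewrite lte_fin ltr_pM2r//.
  by move: (e0 n) => ?; lra.
have Aev x : exists n, forall j, (n <= j)%N -> A j x.
  have [phi0 _] := hC x [tuple 0%R | _ < dim].
  have phi2 : (0 < phi x [tuple 0 | _ < dim] / 2)%R by rewrite divr_gt0.
  have [n _ hn] := near_infty_natSinv_lt (PosNum phi2); exists n => j nj.
  have := hn j nj => /= ej.
  apply: phige => [|y Dy]; first exact: ltW.
  have := osc j x y _ Dy (D0 j); rewrite ler_norml => /andP[+ _].
  by move: ej (e0 j); rewrite -/(e j); move: (e j) => q; lra.
(* The sets [A n] need not be monotone, so continuity from below is applied to the intersections of
   their tails. *)
pose B n := \bigcap_(j in [set j | (n <= j)%N]) A j.
have mB n : measurable (B n) by apply: bigcap_measurableType.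
have BT : \bigcup_n B n = setT.
  by apply/seteqP; split => // x _; have [n hn] := Aev x; exists n.
have Bnd : {homo B : n m / (n <= m)%N >-> (n <= m)%O}.
  move=> n m nm; apply/subsetPset => x Bx j /= mj; apply: Bx => /=.
  exact: leq_trans mj.
have evB (mu : {measure set X -> \bar R}) : 0 < mu setT ->
    exists n, forall j, (n <= j)%N -> 0 < mu (A j).
  move=> mu0; apply: contrapT => hn.
  have B0 n : mu (B n) = 0.
    apply/eqP; rewrite eq_le measure_ge0 andbT leNgt; apply/negP => Bn.
    apply: hn; exists n => j nj; apply: lt_le_trans Bn _.
    by apply: le_measure; rewrite ?inE// => x; apply.
  have : mu \o B @ \oo --> mu (\bigcup_n B n).
    by apply: nondecreasing_cvg_mu => //; rewrite BT.
  rewrite BT (_ : mu \o B = cst 0); last by apply/funext.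
  move=> /(cvg_lim (@ereal_hausdorff R)); rewrite lim_cst; last exact: ereal_hausdorff.
  by move=> E; move: mu0; rewrite -E ltxx.
have [n1 h1] := evB psi psi0.
have [n2 h2] := evB pst (@eq_ind_r _ _ (fun z => 0 < z) lte01 _ (probability_setT pst)).
pose n := maxn n1 n2.
have psiA : 0 < psi (A n) by apply: h1; exact: leq_maxl.
have pstA : 0 < pst (A n) by apply: h2; exact: leq_maxr.
have [xb xbA] : A n !=set0.
  apply/set0P/negP => /eqP A0; by move: psiA; rewrite A0 measure0 ltxx.
pose Z := law nu mf xb (D n).
have Z0 : 0 < Z.
  by apply: (lt_le_trans _ xbA); rewrite lte_fin mulr_gt0.
have Z1 : Z <= 1.
  by apply: (le_trans _ (@sprobability_setT _ _ _ (law nu mf xb)));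
    apply: le_measure; rewrite ?inE.
have Zf : Z \is a fin_num by rewrite ge0_fin_numE ?ltW//; apply: le_lt_trans Z1 _; rewrite ltry.
(* [m] is the law of the next state from one point [xb] of [A n], conditioned on [D n]. As
   [phi xb <= C], the bound [e n / 4 <= phi x] on the box gives [c * phi xb <= phi x] there. *)
pose m := mnormalize (mrestr (law nu mf xb) (mD n)) pst.
have mE E : m E = trans f nu xb (E `&` D n) * ((fine Z)^-1)%:E.
  rewrite /m/= /mnormalize/= /mrestr/= setTI -/Z.
  by rewrite gt_eqF//= lt_eqF// ltey_eq Zf.
have C0 : (0 < C)%R by case: (hC xb xb) => /lt_le_trans h /h.
pose c := (e n / 4 / C)%R.
have c0 : (0 < c)%R by rewrite /c !divr_gt0.
have mphi x : measurable_fun setT (phi x) by case: (hphi x).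
have minor x E : A n x -> measurable E ->
    c%:E * trans f nu xb (E `&` D n) <= trans f nu x E.
  move=> Ax mE'.
  have mED : measurable (E `&` D n) by exact: measurableI.
  rewrite (mtr x)// (mtr xb)// -leb_intZ; last 3 first.
  - exact: ltW.
  - apply/measurable_EFinP; apply: measurable_funM => //.
  - by move=> y; rewrite lee_fin mulr_ge0//; case: (hC xb y) => /ltW.
  apply: leb_int_le => y; rewrite -EFinM lee_fin.
    rewrite mulr_ge0 ?(ltW c0)// mulr_ge0//.
    by case: (hC xb y) => /ltW.
  rewrite !indicE in_setI; case: (boolP (y \in E)) => yE; last by rewrite !mulr0.
  case: (boolP (y \in D n)) => yD /=; last first.
    by rewrite !mulr0 mulr1; case: (hC x y) => /ltW.
  rewrite !mulr1; apply: le_trans (AphiD n x y Ax (set_mem yD)).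
  rewrite /c mulrAC ler_pdivrMr// ler_wpM2l// ?divr_ge0 ?(ltW (e0 n))//.
  by case: (hC xb y).
have cZ : c%:E * Z = (c * fine Z)%:E by rewrite [RHS]EFinM fineK.
have Zinv : (fine Z * (fine Z)^-1 = 1)%R by rewrite divff// gt_eqF// fine_gt0// Z0/= ltey_eq Zf.
exists (A n), (c * fine Z)%R, m; split => //.
- rewrite mulr_gt0 ?fine_gt0 ?Z0 ?ltey_eq ?Zf//= -lee_fin -cZ /Z.
  have := minor xb setT xbA measurableT; rewrite setTI => /le_trans; apply.
  exact: (@sprobability_setT _ _ _ (law nu mf xb)).
- exists (fun y => (fine Z)^-1 * (phi xb y * \1_(D n) y))%R; split; [|split].
  + apply: measurable_funM => //; apply: measurable_funM => //.
  + move=> y; rewrite mulr_ge0 ?invr_ge0 ?fine_ge0 ?(ltW Z0)// mulr_ge0//.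
    by case: (hC xb y) => /ltW.
  + move=> E mE'; rewrite [LHS](mE E) mtr; last exact: measurableI.
    rewrite muleC -leb_intZ ?invr_ge0 ?fine_ge0 ?(ltW Z0)//.
    * congr leb_int; apply/funext => y; rewrite -EFinM; congr (_%:E).
      by rewrite setIC indicI -!mulrA; congr (_ * (_ * _))%R.
    * apply/measurable_EFinP; apply: measurable_funM => //.
      by apply: measurable_indic; exact: measurableI.
    * by move=> y; rewrite lee_fin mulr_ge0//; case: (hC xb y) => /ltW.
- move=> x E Ax mE'; rewrite [X in _ * X](mE E).
  apply: le_trans (minor x E Ax mE').
  rewrite (muleC (trans _ _ _ _)) muleA -EFinM -mulrA Zinv mulr1//.
- split=> // a b ab; rewrite [LHS]mE.
  rewrite (_ : trans f nu xb _ = 0) ?mul0e//.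
  apply/eqP; rewrite eq_le measure_ge0 andbT.
  rewrite -(trans_hyperplane_null xb b ab).
  have mH := measurable_hyperplane a b.
  apply: (@le_measure _ _ _ (law nu mf xb)); rewrite ?inE//.
  exact: measurableI.
Qed.
End Minorization.

(** * Frequency of regenerations *)

Lemma renewal_double_sum (R : realType) (a r : nat -> R) T :
  \sum_(i < T) \sum_(t < i) a t * r (i.-1 - t)%N =
  \sum_(t < T) a t * \sum_(n < T.-1 - t) r n.
Proof.
elim: T => [|T IH]; first by rewrite !big_ord0.
rewrite big_ord_recr/= IH [RHS]big_ord_recr/= subnn big_ord0 mulr0 addr0 -big_split/=.
apply: eq_bigr => t _; rewrite -mulrDr; congr (_ * _).
case: T t {IH} => [[]//|T] t /=.
have tT : (t <= T)%N by rewrite -ltnS.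
by rewrite (subSn tT) big_ord_recr.
Qed.

(** * Elementary renewal estimates for real sequences *)

Section RealRenewal.
Context {R : realType}.
(** [a t] stands for the probability of a regeneration at time [t], [r n] for the probability that a
    cycle lasts longer than [n], and [q T] for that of no regeneration before [T]; [ren] decomposes
    by the last regeneration before [T]. *)
Variables (a r q : nat -> R) (e : R).
Hypothesis a0 : forall n, 0 <= a n.
Hypothesis r0 : forall n, 0 <= r n.
Hypothesis q0 : forall n, 0 <= q n.
Hypothesis re : series r @ \oo --> e.
Hypothesis ren : forall T, q T + \sum_(t < T) a t * r (T.-1 - t)%N = 1.

Let serE n : series r n = \sum_(i < n) r i.
Proof. by rewrite /series/= big_mkord. Qed.

Let nd : nondecreasing_seq (series r).
Proof. by apply: nondecreasing_series => i _ _; exact: r0. Qed.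

Let ser_le n : \sum_(i < n) r i <= e.
Proof.
rewrite -serE -(cvg_lim (@Rhausdorff R) re).
by apply: nondecreasing_cvgn_le nd _ _; apply/cvg_ex; exists e.
Qed.

Let sum1 T : \sum_(i < T) q i + \sum_(t < T) a t * \sum_(n < T.-1 - t) r n = T%:R.
Proof.
rewrite -renewal_double_sum -big_split/=.
under eq_bigr do rewrite ren.
by rewrite sumr_const card_ord.
Qed.

(** Summing [ren] gives [T <= \sum q + e * \sum a], and the Cesaro means of [q] vanish. *)
Lemma renewal_lower : q @ \oo --> 0 -> 0 < e ->
  forall eps : R, 0 < eps -> \forall T \near \oo,
    T%:R * (e^-1 - eps) <= \sum_(t < T) a t.
Proof.
move=> qc e0 eps eps0.
have H T : T%:R <= \sum_(i < T) q i + e * \sum_(t < T) a t.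
  rewrite -[leLHS]sum1 lerD2l mulr_sumr; apply: ler_sum => t _.
  by rewrite mulrC ler_wpM2r.
have := cesaro qc => /cvgrPdist_lt/(_ (eps * e)) []; first exact: mulr_gt0.
move=> n _ hn; exists n.+1 => // -[//|T] nT.
have := hn T nT; rewrite /arithmetic_mean/= /series/= big_mkord sub0r normrN.
rewrite normrM ger0_norm ?invr_ge0// ger0_norm ?sumr_ge0// => h.
have T0 : 0 < T.+1%:R :> R by [].
rewrite mulrC ltr_pdivrMr// in h.
have HT := H T.+1.
rewrite -(ler_pM2l e0).
rewrite (_ : e * _ = T.+1%:R - eps * e * T.+1%:R); last by field; rewrite gt_eqF.
by move: h HT; set S := \sum_(i < _) q i; set U := e * _; lra.
Qed.

(** In the identity summed up to [T + N + 1] only the terms with [t < T] and [n < N] are kept; for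
    large [N] the partial sum of [r] is almost [e]. *)
Lemma renewal_upper : 0 < e ->
  forall eps : R, 0 < eps -> \forall T \near \oo,
    \sum_(t < T) a t <= T%:R * (e^-1 + eps).
Proof.
move=> e0 eps eps0.
have H T N : (\sum_(t < T) a t) * (\sum_(n < N) r n) <= (T + N).+1%:R.
  rewrite -[leRHS]sum1 -[leLHS]add0r lerD//; first exact: sumr_ge0.
  rewrite mulr_suml /=.
  rewrite -(big_mkord xpredT (fun t => a t * \sum_(n < N) r n)).
  rewrite -(big_mkord xpredT (fun t => a t * \sum_(n < T + N - t) r n)).
  rewrite [leRHS](@big_cat_nat _ _ _ T)//=; last by rewrite leqW// leq_addr.
  rewrite -[leLHS]addr0 lerD//; last first.
    by rewrite sumr_ge0// => t _; rewrite mulr_ge0// sumr_ge0.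
  rewrite !big_mkord; apply: ler_sum => t _; rewrite ler_wpM2l//.
  rewrite -(big_mkord xpredT r) -(big_mkord xpredT r).
  rewrite [leRHS](@big_cat_nat _ _ _ N)//=; last first.
    by have := ltn_ord t; lia.
  by rewrite lerDl sumr_ge0.
have einv : 0 < e^-1 by rewrite invr_gt0.
(* [e1^-1] exceeds [e^-1] by [eps / 2]; the other [eps / 2] absorbs the [N + 1] extra time steps. *)
pose e1 := (e^-1 + eps / 2)^-1.
have e10 : 0 < e1 by rewrite invr_gt0 addr_gt0// divr_gt0.
have e1e : e1 < e.
  rewrite -[ltRHS]invrK ltf_pV2 ?posrE ?addr_gt0 ?divr_gt0//.
  by rewrite ltrDl divr_gt0.
have [N _ hN] := cvgr_gt e re e1 e1e.
have {}hN : e1 < \sum_(n < N) r n by rewrite -serE; exact: (hN N (leqnn N)).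
pose K := Num.truncn ((e1^-1 * N.+1%:R) / (eps / 2)).
exists K.+1 => // T /= KT.
have HT := H T N.
have S0 : 0 <= \sum_(t < T) a t by exact: sumr_ge0.
have {}HT : (\sum_(t < T) a t) * e1 <= (T + N).+1%:R.
  by apply: le_trans HT; rewrite ler_wpM2l// ltW.
rewrite -ler_pdivlMr// in HT; apply: le_trans HT _.
have e1E : e1^-1 = e^-1 + eps / 2 by rewrite invrK.
have hT : e1^-1 * N.+1%:R <= T%:R * (eps / 2).
  rewrite -ler_pdivrMr ?divr_gt0//.
  apply: ltW; apply: lt_le_trans (Num.Theory.truncnS_gt _) _.
  by rewrite ler_nat.
rewrite -addnS natrD mulrC mulrDr.
apply: (@le_trans _ _ (e1^-1 * T%:R + T%:R * (eps / 2))); first by rewrite lerD2l.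
by rewrite e1E; move: (T%:R) => t; lra.
Qed.

End RealRenewal.

Section MeasureDomination.
Local Open Scope ereal_scope.
Context {R : realType} d (T : measurableType d).
Import HBNNSimple.

Lemma ge0_le_integral_measure (p q : {measure set T -> \bar R}) (h : T -> \bar R) :
  (forall E, measurable E -> p E <= q E) -> (forall x, 0 <= h x) ->
  \int[p]_x h x <= \int[q]_x h x.
Proof.
move=> pq h0; rewrite !ge0_integralTE//.
apply: ge_ereal_sup => _ [g /= gh <-].
apply: (@le_trans _ _ (sintegral q g)); last by apply: ereal_sup_ubound; exists g.
rewrite !sintegralE; apply: lee_fsum => //= r _.
have [r0|r0] := leP 0%R r; first by rewrite lee_wpmul2l// ?lee_fin//; exact: pq.
by rewrite preimage_nnfun0// !measure0.
Qed.

End MeasureDomination.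

(** * The split chain and its renewal equation *)

Section Regeneration.
Local Open Scope ereal_scope.
Context {R : realType} {dim k : nat}.
Local Notation X := (dim.-tuple R).
Local Notation W := (k.-tuple R).
Local Notation BS := (giry X R).
Variables (f : X -> W -> X) (nu : probability W R).
Hypothesis mf : measurable_fun [set: (X * W)%type] (fun z => f z.1 z.2).

Lemma measurable_iter_exp t (h : X -> \bar R) : measurable_fun setT h ->
  (forall x, 0 <= h x) -> measurable_fun setT (iter_exp f nu t h).
Proof.
move=> mh h0; elim: t => [//|t IH].
apply: measurable_markov_op => // x; elim: t {IH} x => [//|t IH] x.
exact: integral_ge0.
Qed.

Lemma iter_exp_ge0 t (h : X -> \bar R) x : (forall x, 0 <= h x) -> 0 <= iter_exp f nu t h x.
Proof. by move=> h0; elim: t x => [//|t IH] x; exact: integral_ge0. Qed.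

Lemma measurable_comp_f (h : X -> \bar R) x : measurable_fun setT h ->
  measurable_fun setT (fun w => h (f x w)).
Proof. by move=> mh; apply: (measurableT_comp mh); exact: measurable_f1. Qed.

Lemma markov_op_le (h g : X -> \bar R) x : (forall x, 0 <= h x) -> (forall x, h x <= g x) ->
  markov_op f nu h x <= markov_op f nu g x.
Proof. by move=> h0 hg; apply: ge0_le_integral_nonmeasurable. Qed.

Lemma markov_op_cst (c : R) x : markov_op f nu (fun=> c%:E) x = c%:E.
Proof. by rewrite /markov_op integral_cst// [X in _ * X]probability_setT mule1. Qed.

Lemma invariant_markov_op (pst : probability X R) (h : X -> \bar R) :
  Defs.invariant f nu pst -> measurable_fun setT h -> (forall x, 0 <= h x) ->
  \int[pst]_x markov_op f nu h x = \int[pst]_x h x.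
Proof.
move=> inv mh h0.
have := giry_int_bind pst (measurable_law nu mf) mh h0; rewrite /giry_int => E.
transitivity (\int[pst]_x \int[law nu mf x]_y h y).
  by apply: eq_integral => x _; rewrite int_law.
rewrite -E; apply: int_eq_on => B mB.
rewrite -[RHS](inv _ mB) /giry_bind/= giry_int_map//.
exact: (measurable_giry_ev (R := R)).
Qed.

Lemma invariant_iter_exp (pst : probability X R) t (h : X -> \bar R) :
  Defs.invariant f nu pst -> measurable_fun setT h -> (forall x, 0 <= h x) ->
  \int[pst]_x iter_exp f nu t h x = \int[pst]_x h x.
Proof.
move=> inv mh h0; elim: t => [//|t IH].
rewrite -IH; apply: invariant_markov_op => //; first exact: measurable_iter_exp.
by move=> x; exact: iter_exp_ge0.
Qed.

Variables (A : set X) (delta : R) (m : probability X R).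
Hypothesis mA : measurable A.
Hypothesis delta01 : (0 < delta <= 1)%R.
Hypothesis minor : forall x E, A x -> measurable E -> delta%:E * m E <= trans f nu x E.

Definition smin (x : X) : \bar R := (delta * \1_A x)%:E.

Lemma measurable_smin : measurable_fun setT smin.
Proof. by apply/measurable_EFinP; apply: measurable_funM. Qed.

Lemma smin_ge0 x : 0 <= smin x.
Proof. by rewrite lee_fin mulr_ge0//; case/andP: delta01 => /ltW. Qed.

Lemma smin_le1 x : smin x <= 1.
Proof.
case/andP: delta01 => d0 d1; rewrite lee_fin indicE.
by case: (_ \in _); rewrite ?mulr1 ?mulr0.
Qed.

Lemma minor_int x (h : X -> \bar R) : measurable_fun setT h -> (forall x, 0 <= h x) ->
  smin x * \int[m]_y h y <= markov_op f nu h x.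
Proof.
move=> mh h0; rewrite /smin indicE; case: (boolP (x \in A)) => xA; last first.
  by rewrite mulr0 mul0e; exact: markov_op_ge0.
have d0 : (0 <= delta)%R by case/andP: delta01 => /ltW.
rewrite mulr1 -(int_law nu mf)//.
have := @ge0_integral_mscale _ _ R m setT measurableT (NngNum d0) h mh.
move=> /(_ (fun x _ => h0 x)) /= <-.
apply: (@ge0_le_integral_measure _ _ _ (mscale (NngNum d0) m) (law nu mf x)) => // E mE.
by rewrite /mscale/=; apply: minor => //; exact: set_mem.
Qed.

Lemma integral_smin (p : {measure set X -> \bar R}) : \int[p]_x smin x = delta%:E * p A.
Proof.
rewrite /smin; under eq_integral do rewrite EFinM.
rewrite ge0_integralZl_EFin//; last by case/andP: delta01 => /ltW.
  by rewrite integral_indic// setIT.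
by apply/measurable_EFinP; exact: measurable_indic.
Qed.

(* In the split chain a regeneration occurs at [x] with probability [smin x] and moves the chain to
   [m]; [survival n x] is the probability of no regeneration before time [n]. *)
Fixpoint survival (n : nat) (x : X) : \bar R :=
  if n is n'.+1 then markov_op f nu (survival n') x - smin x * \int[m]_y survival n' y else 1.

(** [survival n] is the n-th power of the residual kernel, the transition kernel minus its part
    [s * m], applied to 1. Minorization is exactly the positivity of that kernel. *)
Lemma survivalP n : [/\ measurable_fun setT (survival n), (forall x, 0 <= survival n x) & (forall x, survival n x <= 1)].
Proof.
elim: n => [|n [IH1 IH2 IH3]] /=; first by split => // x; exact: measurable_cst.
have m1 : \int[m]_y survival n y <= 1.
  rewrite -(probability_setT m) -[leRHS]mul1e -integral_cst//.
  by apply: ge0_le_integral_nonmeasurable.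
have mfin : \int[m]_y survival n y \is a fin_num.
  by rewrite ge0_fin_numE ?integral_ge0//; apply: le_lt_trans m1 _; rewrite ltry.
split.
- apply: emeasurable_funB; first exact: measurable_markov_op.
  apply: emeasurable_funM => //; exact: measurable_smin.
- move=> x; rewrite sube_ge0; first exact: minor_int.
  by rewrite fin_numM.
- move=> x; apply: (@le_trans _ _ (markov_op f nu (survival n) x)).
    by rewrite geeDl// oppe_le0 mule_ge0 ?smin_ge0// integral_ge0.
  by rewrite -[leRHS](markov_op_cst 1 x); exact: markov_op_le.
Qed.

Let mRn n : measurable_fun setT (survival n). Proof. by case: (survivalP n). Qed.
Let survival0 n x : 0 <= survival n x. Proof. by case: (survivalP n). Qed.
Let survival1 n x : survival n x <= 1. Proof. by case: (survivalP n). Qed.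
Lemma survival_fin n x : survival n x \is a fin_num.
Proof. by rewrite ge0_fin_numE//; apply: le_lt_trans (survival1 n x) _; rewrite ltry. Qed.

Lemma mRn_le1 n : \int[m]_y survival n y <= 1.
Proof.
rewrite -(probability_setT m) -[leRHS]mul1e -integral_cst//.
by apply: ge0_le_integral_nonmeasurable.
Qed.

Lemma mRn_fin n : \int[m]_y survival n y \is a fin_num.
Proof.
by rewrite ge0_fin_numE ?integral_ge0//; apply: le_lt_trans (mRn_le1 n) _; rewrite ltry.
Qed.

Lemma markov_op_survival n x : markov_op f nu (survival n) x = survival n.+1 x + smin x * \int[m]_y survival n y.
Proof. by rewrite /= subeK// fin_numM// mRn_fin. Qed.

(** Decomposition by the last regeneration before [T]: if it happens at time [t], the chain restarts
    from [m] and survives [T - 1 - t] more steps. The induction is on the first step, whose term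
    [t = 0] restores what [survival] subtracts. *)
Lemma survival_renewal T x :
  survival T x + \sum_(t < T) iter_exp f nu t smin x * \int[m]_y survival (T.-1 - t)%N y = 1.
Proof.
elim: T x => [|T IH] x; first by rewrite big_ord0 adde0.
rewrite big_ord_recl/= subn0.
rewrite addeA subeK ?fin_numM ?mRn_fin//.
rewrite -[RHS](markov_op_cst 1 x).
transitivity (markov_op f nu (fun x => survival T x +
  \sum_(t < T) iter_exp f nu t smin x * \int[m]_y survival (T.-1 - t)%N y) x); last first.
  by rewrite /markov_op; apply: eq_integral => w _; rewrite IH.
have ms t : measurable_fun setT (fun w => iter_exp f nu t smin (f x w)).
  apply: measurable_comp_f; apply: measurable_iter_exp; first exact: measurable_smin.
  exact: smin_ge0.
have s0 t y : 0 <= iter_exp f nu t smin y by apply: iter_exp_ge0; exact: smin_ge0.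
have i0 n : 0 <= \int[m]_y survival n y by exact: integral_ge0.
rewrite /markov_op ge0_integralD//; last 3 first.
- exact: measurable_comp_f.
- by move=> w _; apply: sume_ge0 => t _; rewrite mule_ge0.
- apply: emeasurable_sum => t; exact: emeasurable_funM.
congr (_ + _); rewrite ge0_integral_sum//; last 2 first.
- by move=> t; exact: emeasurable_funM.
- by move=> t w _; rewrite mule_ge0.
apply: eq_bigr => t _; rewrite ge0_integralZr//=.
congr (_ * _); apply: eq_integral => y _; congr (survival _ y).
by rewrite /bump/= add1n subnS -subn1 subnAC subn1.
Qed.

End Regeneration.

(** * Almost sure regeneration from every state *)

Section Ergodic.
Local Open Scope ereal_scope.
Context {R : realType} {dim k : nat}.
Local Notation X := (dim.-tuple R).
Local Notation W := (k.-tuple R).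
Variables (f : X -> W -> X) (nu : probability W R).
Hypothesis mf : measurable_fun [set: (X * W)%type] (fun z => f z.1 z.2).
Variables (A : set X) (delta : R) (m : probability X R).
Hypothesis mA : measurable A.
Hypothesis delta01 : (0 < delta <= 1)%R.
Hypothesis minor : forall x E, A x -> measurable E -> delta%:E * m E <= trans f nu x E.
Local Notation s := (smin A delta).
Local Notation survival := (survival f nu A delta m).

Let mRn n : measurable_fun setT (survival n).
Proof. by case: (survivalP mf mA delta01 minor n). Qed.
Let survival0 n x : 0 <= survival n x. Proof. by case: (survivalP mf mA delta01 minor n). Qed.
Let survival1 n x : survival n x <= 1. Proof. by case: (survivalP mf mA delta01 minor n). Qed.
Let Rfin n x : survival n x \is a fin_num. Proof. exact: (survival_fin mf mA delta01 minor). Qed.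
Let mRfin n : \int[m]_y survival n y \is a fin_num.
Proof. exact: (mRn_fin mf mA delta01 minor). Qed.
Let mRn0 n : 0 <= \int[m]_y survival n y. Proof. exact: integral_ge0. Qed.

(** The residual kernel is positive, hence monotone; it is applied to the difference [D] of two
    consecutive terms. *)
Lemma survival_decr n x : survival n.+1 x <= survival n x.
Proof.
elim: n x => [|n IH] x; first exact: survival1.
have E1 := markov_op_survival mf mA delta01 minor n.+1 x.
have E2 := markov_op_survival mf mA delta01 minor n x.
pose D y := survival n y - survival n.+1 y.
have D0 y : 0 <= D y by rewrite sube_ge0 ?Rfin//; exact: IH.
have mD : measurable_fun setT D by exact: emeasurable_funB.
have Dsum y : survival n y = survival n.+1 y + D y by rewrite /D addeC subeK.
have H1 : markov_op f nu (survival n) x = markov_op f nu (survival n.+1) x + markov_op f nu D x.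
  rewrite /markov_op -ge0_integralD//; last 2 first.
  - exact: measurable_comp_f.
  - exact: measurable_comp_f.
  by apply: eq_integral => w _; rewrite Dsum.
have H2 : \int[m]_y survival n y = \int[m]_y survival n.+1 y + \int[m]_y D y.
  rewrite -ge0_integralD//.
  by apply: eq_integral => w _; rewrite Dsum.
have H3 := minor_int mf delta01 minor x mD D0.
have i0 : 0 <= \int[m]_y D y by exact: integral_ge0.
have iD : \int[m]_y D y \is a fin_num.
  by have := mRfin n; rewrite H2 fin_numD => /andP[].
have pD : markov_op f nu D x \is a fin_num.
  have := Rfin n.+1 x; have : markov_op f nu (survival n) x \is a fin_num.
    by rewrite E2 fin_numD Rfin fin_numM.
  by rewrite H1 fin_numD => /andP[].
move: H1 H3; rewrite E1 E2 H2 [s x]/smin.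
move: (Rfin n.+1 x) (Rfin n.+2 x) (mRfin n.+1) iD pD i0 {E1 E2 H2}.
move: (survival n.+1 x) (survival n.+2 x) (\int[m]_y survival n.+1 y) (\int[m]_y D y) (markov_op f nu D x).
move=> [a| |] [b| |] [c| |] [d| |] [p| |] //= _ _ _ _ _ _.
rewrite -!EFinM -!EFinD -?EFinM -?EFinD !lee_fin => -[E H].
by move: E H; rewrite mulrDr; move: (delta * _ * c)%R (delta * _ * d)%R => u v; lra.
Qed.

Lemma hit_prob_measurable n : measurable_fun setT (hit_prob f nu n A).
Proof.
have h0 n' x : 0 <= hit_prob f nu n' A x.
  elim: n' x => [//|n' IH] x /=; apply: integral_ge0 => w _; case: ifP => _; [exact: lee01|exact: IH].
elim: n => [|n IH] /=; first exact: measurable_cst.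
apply: (measurable_markov_op nu mf (h := fun y => if `[< A y >] then 1 else hit_prob f nu n A y)).
  apply: measurable_fun_ifT => //.
  apply: (@measurable_fun_bool _ _ _ _ true); rewrite setTI.
  rewrite (_ : _ @^-1` _ = A)//.
  by apply/seteqP; split => x /=; [move/asboolP|move=> ?; apply/asboolP].
by move=> x; case: ifP => _; [exact: lee01|exact: h0].
Qed.

Lemma hit_prob_ge0 n x : 0 <= hit_prob f nu n A x.
Proof.
elim: n x => [//|n IH] x /=; apply: integral_ge0 => w _; case: ifP => _; [exact: lee01|exact: IH].
Qed.

Variable e : R.
Hypothesis ecvg : series (fun n => fine (\int[m]_y survival n y)) @ \oo --> e.

Lemma mRn_cvg0 : (fun n => \int[m]_y survival n y) @ \oo --> 0.
Proof.
have : (fun n => fine (\int[m]_y survival n y)) @ \oo --> 0%R.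
  by apply: cvg_series_cvg_0; apply/cvg_ex; exists e.
by move=> h; apply: cvg_EFin => //; near=> n; exact: mRfin.
Unshelve. all: by end_near. Qed.

(** The probability that no regeneration ever occurs. Its [m]-mean vanishes because the tails from
    [m] are summable, and this makes [z] harmonic for the full transition kernel. *)
Let z x := limn (fun n => survival n x).

Let survival_nincr x : nonincreasing_seq (fun n => survival n x).
Proof. by apply/nonincreasing_seqP => n; exact: survival_decr. Qed.

Let zcvg x : (fun n => survival n x) @ \oo --> z x.
Proof. exact: (ereal_nonincreasing_is_cvgn (survival_nincr x)). Qed.

Let zle n x : z x <= survival n x.
Proof.
apply: lime_le; first exact: ereal_nonincreasing_is_cvgn.
by near=> i; apply: survival_nincr; near: i; exists n.
Unshelve. all: by end_near. Qed.

Let z0 x : 0 <= z x.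
Proof. by apply: lime_ge; [exact: ereal_nonincreasing_is_cvgn|near=> n]. Unshelve. all: by end_near. Qed.

Let zfin x : z x \is a fin_num.
Proof. by rewrite ge0_fin_numE//; apply: le_lt_trans (zle 0 x) _; rewrite ltry. Qed.

Let mz : measurable_fun setT z.
Proof. by apply: (emeasurable_fun_cvg _ z mRn) => x _; exact: zcvg. Qed.

Let int1 d (T : measurableType d) (P : probability T R) : P.-integrable setT (EFin \o cst 1%R).
Proof. exact: finite_measure_integrable_cst. Qed.

Let mz0 : \int[m]_y z y = 0.
Proof.
have : (\int[m]_y survival n y)%E @[n --> \oo] --> \int[m]_y z y.
  apply: (@dominated_cvg _ _ _ m setT measurableT _ _ (cst 1)) => //; first exact: int1.
  by move=> n x _; rewrite gee0_abs.
move=> /cvg_unique; apply => //; exact: mRn_cvg0.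
Qed.

Let zPk x : z x = markov_op f nu z x.
Proof.
have h1 : markov_op f nu (survival n) x @[n --> \oo] --> markov_op f nu z x.
  apply: (@dominated_cvg _ _ _ nu setT measurableT _ _ (cst 1)) => //.
  - by move=> n; exact: measurable_comp_f.
  - exact: int1.
  by move=> n w _; rewrite gee0_abs.
have h2 : s x * \int[m]_y survival n y @[n --> \oo] --> s x * 0.
  by apply: cvgeZl => //; exact: mRn_cvg0.
have h3 : survival n.+1 x @[n --> \oo] --> markov_op f nu z x - s x * 0.
  by apply: (cvgeB _ h1 h2); rewrite mule0 fin_num_adde_defl ?oppe0.
move: h3; rewrite mule0 sube0 => h3.
have := @zcvg x; rewrite -cvg_shiftS => h4.
by rewrite -(cvg_lim (@ereal_hausdorff R) h4) (cvg_lim (@ereal_hausdorff R) h3).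
Qed.

Hypothesis hit : forall x, (fun n => hit_prob f nu n A x) @ \oo --> 1.

(** From [A] a mass [delta] is sent to [m], where [z] vanishes in the mean, which gains the factor
    [1 - delta] on [A]. As [A] is hit almost surely and [z] is harmonic, the gain spreads to all
    states. *)
Let z_contract (c : R) : (forall x, z x <= c%:E) -> forall x, z x <= (c * (1 - delta))%:E.
Proof.
move=> zc.
have c0 : (0 <= c)%R by rewrite -lee_fin (le_trans _ (zc point)).
have [d0 d1] := andP delta01.
have onA x : A x -> z x <= (c * (1 - delta))%:E.
  move=> Ax; pose h y := c%:E - z y.
  have h0 y : 0 <= h y by rewrite sube_ge0 ?zfin//; exact: zc.
  have mh : measurable_fun setT h by apply: emeasurable_funB.
  have hz y : c%:E = h y + z y by rewrite /h subeK.
  have E1 : markov_op f nu h x + z x = c%:E.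
    rewrite -[RHS](markov_op_cst f nu c x) {1}[z x]zPk /markov_op -ge0_integralD//; last 2 first.
    - exact: measurable_comp_f.
    - exact: measurable_comp_f.
    by apply: eq_integral => w _; rewrite -hz.
  have E2 : \int[m]_y h y = c%:E.
    rewrite -[LHS]adde0 -mz0 -ge0_integralD//.
    under eq_integral do rewrite -hz.
    by rewrite integral_cst// [X in _ * X]probability_setT mule1.
  have := minor_int mf delta01 minor x mh h0.
  rewrite E2 /smin indicE mem_set// mulr1.
  have : markov_op f nu h x \is a fin_num.
    have : c%:E \is a fin_num by []. rewrite -E1 fin_numD => /andP[//].
  move: E1 (zfin x); case: (markov_op f nu h x) => [p| |]//; case: (z x) => [q| |]//.
  rewrite -EFinD => -[E] _ _; rewrite -EFinM !lee_fin; move: E.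
  by rewrite mulrBr mulr1 (mulrC c); move: (delta * c)%R => u; lra.
(* Stopping at the first visit to [A] within [n] steps, in the form of an induction on [n]. *)
have H n x : z x + (delta * c)%:E * hit_prob f nu n A x <= c%:E.
  elim: n x => [|n IH] x /=; first by rewrite mule0 adde0.
  pose g y := if `[< A y >] then 1 else hit_prob f nu n A y.
  have g0 y : 0 <= g y by rewrite /g; case: ifP => _; [exact: lee01|exact: hit_prob_ge0].
  have mg : measurable_fun setT g.
    apply: measurable_fun_ifT => //; last exact: hit_prob_measurable.
    apply: (@measurable_fun_bool _ _ _ _ true); rewrite setTI.
    rewrite (_ : _ @^-1` _ = A)//.
    by apply/seteqP; split => y /=; [move/asboolP|move=> ?; apply/asboolP].
  have dc0 : (0 <= delta * c)%R by rewrite mulr_ge0// ltW.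
  rewrite zPk /markov_op -[X in _ + _ * X]/(\int[nu]_w g (f x w)).
  rewrite -ge0_integralZl_EFin//; last exact: measurable_comp_f.
  rewrite -ge0_integralD//; last 3 first.
  - exact: measurable_comp_f.
  - by move=> w _; rewrite mule_ge0.
  - by apply: measurable_funeM; exact: measurable_comp_f.
  rewrite -[leRHS](markov_op_cst f nu c x); apply: ge0_le_integral_nonmeasurable => w _.
    by rewrite adde_ge0// mule_ge0.
  rewrite /g; case: ifPn => [/asboolP Afw|_]; last exact: IH.
  rewrite mule1; apply: (@le_trans _ _ ((c * (1 - delta))%:E + (delta * c)%:E)).
    by rewrite leeD2r// onA.
  by rewrite -EFinD lee_fin; lra.
move=> x.
have : z x + (delta * c)%:E * hit_prob f nu n A x @[n --> \oo] --> z x + (delta * c)%:E * 1.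
  apply: cvgeD => //; first by rewrite mule1 fin_num_adde_defl.
    exact: cvg_cst.
  by apply: cvgeZl => //; exact: hit.
move=> hc; have : z x + (delta * c)%:E * 1 <= c%:E.
  rewrite -(cvg_lim _ hc)//; apply: lime_le; first by apply/cvg_ex; eexists; exact: hc.
  by near=> n; exact: H.
rewrite mule1; move: (zfin x); case: (z x) => [q| |]// _; rewrite -EFinD !lee_fin; lra.
Unshelve. all: by end_near. Qed.

Lemma survival_cvg0 x : (fun n => survival n x) @ \oo --> 0.
Proof.
have zb i : forall x, z x <= ((1 - delta) ^+ i)%:E.
  elim: i => [|i IH] y; first by rewrite expr0; exact: (zle 0).
  by rewrite exprSr; exact: z_contract.
suff <- : z x = 0 by exact: zcvg.
have [d0 d1] := andP delta01.
have : ((1 - delta) ^+ i)%:E @[i --> \oo] --> (0%:E : \bar R).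
  apply: cvg_EFin; first by near=> i.
  by apply: cvg_expr; rewrite ger0_norm ?subr_ge0// ltrBlDr ltrDl.
move=> hc; apply/eqP; rewrite eq_le z0 andbT.
rewrite -[leRHS](cvg_lim (@ereal_hausdorff R) hc)//; apply: lime_ge; first by apply/cvg_ex; eexists; exact: hc.
by near=> i; exact: zb.
Unshelve. all: by end_near. Qed.

End Ergodic.

(** * Mean regeneration time and regeneration frequency *)

Section Frequency.
Local Open Scope ereal_scope.
Context {R : realType} {dim k : nat}.
Local Notation X := (dim.-tuple R).
Local Notation W := (k.-tuple R).
Variables (f : X -> W -> X) (nu : probability W R).
Hypothesis mf : measurable_fun [set: (X * W)%type] (fun z => f z.1 z.2).
Variables (A : set X) (delta : R) (m : probability X R).
Hypothesis mA : measurable A.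
Hypothesis delta01 : (0 < delta <= 1)%R.
Hypothesis minor : forall x E, A x -> measurable E -> delta%:E * m E <= trans f nu x E.
Local Notation s := (smin A delta).
Local Notation survival := (survival f nu A delta m).

Let mRn n : measurable_fun setT (survival n).
Proof. by case: (survivalP mf mA delta01 minor n). Qed.
Let survival0 n x : 0 <= survival n x. Proof. by case: (survivalP mf mA delta01 minor n). Qed.
Let survival1 n x : survival n x <= 1. Proof. by case: (survivalP mf mA delta01 minor n). Qed.
Let mRfin n : \int[m]_y survival n y \is a fin_num.
Proof. exact: (mRn_fin mf mA delta01 minor). Qed.
Let mRn0 n : 0 <= \int[m]_y survival n y. Proof. exact: integral_ge0. Qed.
Let ms t : measurable_fun setT (iter_exp f nu t s).
Proof. exact: (measurable_iter_exp nu mf _ (measurable_smin delta mA) (smin_ge0 A delta01)). Qed.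
Let s0 t x : 0 <= iter_exp f nu t s x.
Proof. exact: (iter_exp_ge0 f nu t x (smin_ge0 A delta01)). Qed.

Lemma iter_smin_le1 t x : iter_exp f nu t s x <= 1.
Proof.
elim: t x => [|t IH] x; first exact: smin_le1.
by rewrite -[leRHS](markov_op_cst f nu 1 x); exact: markov_op_le.
Qed.

Lemma prob_int_le1 (p : probability X R) (h : X -> \bar R) :
  (forall x, 0 <= h x) -> (forall x, h x <= 1) -> \int[p]_x h x <= 1.
Proof.
move=> h0 h1; rewrite -(probability_setT p) -[leRHS]mul1e -integral_cst//.
exact: ge0_le_integral_nonmeasurable.
Qed.

Lemma prob_int_fin (p : probability X R) (h : X -> \bar R) :
  (forall x, 0 <= h x) -> (forall x, h x <= 1) -> \int[p]_x h x \is a fin_num.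
Proof.
move=> h0 h1; rewrite ge0_fin_numE ?integral_ge0//.
by apply: le_lt_trans (prob_int_le1 p h0 h1) _; rewrite ltry.
Qed.

Lemma renewal_int (p : probability X R) T :
  \int[p]_x survival T x +
    \sum_(t < T) \int[p]_x iter_exp f nu t s x * \int[m]_y survival (T.-1 - t)%N y = 1.
Proof.
transitivity (\int[p]_x (cst 1 x)); last first.
  by rewrite integral_cst// [X in _ * X]probability_setT mule1.
transitivity (\int[p]_x (survival T x +
   \sum_(t < T) iter_exp f nu t s x * \int[m]_y survival (T.-1 - t)%N y)); last first.
  by apply: eq_integral => x _; rewrite (survival_renewal mf mA delta01 minor).
rewrite ge0_integralD//; last 2 first.
- by move=> x _; apply: sume_ge0 => t _; rewrite mule_ge0.
- apply: emeasurable_sum => t; exact: emeasurable_funM.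
congr (_ + _); rewrite ge0_integral_sum//; last 2 first.
- by move=> t; exact: emeasurable_funM.
- by move=> t x _; rewrite mule_ge0.
by apply: eq_bigr => t _; rewrite ge0_integralZr.
Qed.

(** From the invariant law a regeneration has probability [delta * pst A] at every time, so the
    renewal identity bounds the partial sums of the tails by the inverse of this number. Positivity
    of [e] comes from the tail at 0, which is 1. *)
Lemma regeneration_time (pst : probability X R) : Defs.invariant f nu pst -> 0 < pst A ->
  exists2 e : R, (0 < e)%R &
    series (fun n => fine (\int[m]_y survival n y)) @ \oo --> e.
Proof.
move=> inv pA.
set u := fun n => fine _.
have u0 n : (0 <= u n)%R by rewrite /u fine_ge0.
have pAf : pst A \is a fin_num by exact: fin_num_measure.
have [d0 _] := andP delta01.
have pA' : (0 < delta * fine (pst A))%R by rewrite mulr_gt0// fine_gt0// pA/= ltey_eq pAf.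
have bnd T : (\sum_(i < T) u i <= (delta * fine (pst A))^-1)%R.
  have : \sum_(t < T) \int[pst]_x iter_exp f nu t s x * \int[m]_y survival (T.-1 - t)%N y <= 1.
    by rewrite -(renewal_int pst T) leeDr// integral_ge0.
  under eq_bigr do rewrite (invariant_iter_exp mf _ inv (measurable_smin delta mA)
    (smin_ge0 A delta01)) (integral_smin mA delta01).
  rewrite -ge0_sume_distrr; last by move=> t _.
  have -> : (\sum_(i < T) \int[m]_y survival (T.-1 - i)%N y = (\sum_(i < T) u i)%:E).
    rewrite -sumEFin (reindex_inj rev_ord_inj)/=; apply: eq_bigr => i _.
    rewrite /u fineK//; apply: eq_integral => y _; congr (survival _ y).
    by have := ltn_ord i; lia.
  have -> : delta%:E * pst A = (delta * fine (pst A))%:E by rewrite EFinM fineK.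
  rewrite -EFinM lee_fin.
  by rewrite -ler_pdivlMl// mulr1.
have nd : nondecreasing_seq (series u) by apply: nondecreasing_series => i _ _; exact: u0.
have cv : cvgn (series u).
  apply: nondecreasing_is_cvgn => //.
  exists (delta * fine (pst A))^-1%R => _ [T _ <-].
  by rewrite /series/= big_mkord; exact: bnd.
exists (limn (series u)) => //.
apply: (@lt_le_trans _ _ (series u 1%N)); last exact: nondecreasing_cvgn_le.
rewrite /series/= big_nat1 /u/=.
by rewrite integral_cst// [X in _ * X]probability_setT mule1.
Qed.

Variable e : R.
Hypothesis e0 : (0 < e)%R.
Hypothesis ecvg : series (fun n => fine (\int[m]_y survival n y)) @ \oo --> e.

Let a (p : probability X R) t := fine (\int[p]_x iter_exp f nu t s x).
Let q (p : probability X R) T := fine (\int[p]_x survival T x).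

Let renp (p : probability X R) T :
  (q p T + \sum_(t < T) a p t * fine (\int[m]_y survival (T.-1 - t)%N y) = 1)%R.
Proof.
apply: EFin_inj; rewrite EFinD -sumEFin -[RHS](renewal_int p T); congr (_ + _).
  by rewrite fineK// prob_int_fin.
apply: eq_bigr => t _; rewrite EFinM !fineK//.
by apply: prob_int_fin => // x; exact: iter_smin_le1.
Qed.

Let aE (p : probability X R) T :
  \sum_(t < T) \int[p]_x iter_exp f nu t s x = (\sum_(t < T) a p t)%:E.
Proof.
rewrite -sumEFin; apply: eq_bigr => t _; rewrite /a fineK//.
by apply: prob_int_fin => // x; exact: iter_smin_le1.
Qed.

Lemma frequency_upper eps : (0 < eps)%R -> \forall T \near \oo,
  \sum_(t < T) \int[m]_x iter_exp f nu t s x <= (T%:R * (e^-1 + eps))%:E.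
Proof.
move=> eps0.
have := renewal_upper (a := a m) (r := fun n => fine (\int[m]_y survival n y)) (q := q m) (e := e).
move=> H; have {}H := H _ _ _ ecvg (renp m) e0 eps eps0.
have : \forall T \near \oo, (\sum_(t < T) a m t <= T%:R * (e^-1 + eps))%R.
  apply: H => n; rewrite fine_ge0// integral_ge0//.
by move=> [N _ hN]; exists N => // T NT; rewrite aE lee_fin; exact: hN.
Qed.

Hypothesis hit : forall x, (fun n => hit_prob f nu n A x) @ \oo --> 1.

(** Almost sure regeneration and dominated convergence make [q p] vanish for every initial law. *)
Lemma frequency_lower (p : probability X R) eps : (0 < eps)%R -> \forall T \near \oo,
  (T%:R * (e^-1 - eps))%:E <= \sum_(t < T) \int[p]_x iter_exp f nu t s x.
Proof.
move=> eps0.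
have qc : q p @ \oo --> 0%R.
  have : (\int[p]_x survival n x)%E @[n --> \oo] --> \int[p]_x 0.
    apply: (@dominated_cvg _ _ _ p setT measurableT _ _ (cst 1)) => //.
    - by move=> x _; apply: (survival_cvg0 mf mA delta01 minor ecvg).
    - exact: finite_measure_integrable_cst.
    - by move=> n x _; rewrite gee0_abs.
  by rewrite integral0 => /fine_cvg.
have := renewal_lower (a := a p) (r := fun n => fine (\int[m]_y survival n y)) (q := q p) (e := e).
move=> H; have {}H := H _ _ _ ecvg (renp p) qc e0 eps eps0.
have : \forall T \near \oo, (T%:R * (e^-1 - eps) <= \sum_(t < T) a p t)%R.
  apply: H => n; rewrite fine_ge0// integral_ge0//.
by move=> [N _ hN]; exists N => // T NT; rewrite aE lee_fin; exact: hN.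
Qed.

End Frequency.

(** * Discounted control of unnormalised beliefs *)

Section Control.
Local Open Scope ereal_scope.
Context {R : realType} {dim k M : nat}.
Local Notation X := (dim.-tuple R).
Local Notation W := (k.-tuple R).
Local Notation BS := (giry X R).
Variables (f : X -> W -> X) (nu : probability W R).
Hypothesis mf : measurable_fun [set: (X * W)%type] (fun z => f z.1 z.2).

Definition cquant := {Q : X -> 'I_M | convex_quantizer Q}.
Definition cell (Q : X -> 'I_M) (i : 'I_M) : set X := Q @^-1` [set i].

Lemma measurable_cell (Q : cquant) i : measurable (cell (sval Q) i).
Proof. by case: (proj2_sig Q i). Qed.

Definition sqnorm (x : X) : \bar R := (enorm x ^+ 2)%:E.

Lemma sqnorm_ge0 x : 0 <= sqnorm x. Proof. by rewrite lee_fin sqr_ge0. Qed.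

Lemma enorm_sqr (x : X) : (enorm x ^+ 2 = \sum_(i < dim) tnth x i ^+ 2)%R.
Proof. by rewrite sqr_sqrtr// sumr_ge0// => i _; exact: sqr_ge0. Qed.

Lemma measurable_sqnorm : measurable_fun setT sqnorm.
Proof.
apply/measurable_EFinP; rewrite (_ : (fun x => _) = fun x : X => (\sum_(i < dim) tnth x i ^+ 2)%R).
  by apply: measurable_sum => i; apply: measurable_funX; exact: measurable_tnth.
by apply/funext => x; exact: enorm_sqr.
Qed.

Lemma sqdist_ge0 (x u : X) : (0 <= sqdist x u)%R.
Proof. by apply: sumr_ge0 => i _; exact: sqr_ge0. Qed.

Lemma measurable_sqdist (u : X) : measurable_fun setT (fun x => (sqdist x u)%:E : \bar R).
Proof.
apply/measurable_EFinP; apply: measurable_sum => i; apply: measurable_funX.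
by apply: measurable_funB => //; exact: measurable_tnth.
Qed.

Definition cost0 (p : {measure set X -> \bar R}) (D : set X) : \bar R :=
  ereal_inf [set (\int[p]_(x in D) (sqdist x u)%:E) | u in [set: X]].

Lemma qcostE (p : BS) (Q : X -> 'I_M) : qcost p Q = \sum_(i < M) cost0 p (cell Q i).
Proof. by []. Qed.

Lemma cost0_ge0 p D : 0 <= cost0 p D.
Proof.
apply: le_ereal_inf_tmp => _ [u _ <-]; apply: integral_ge0 => x _.
by rewrite lee_fin sqdist_ge0.
Qed.

Lemma qcost_ge0 (p : BS) (Q : X -> 'I_M) : 0 <= qcost p Q.
Proof. by rewrite qcostE; apply: sume_ge0 => i _; exact: cost0_ge0. Qed.

Lemma sum_cell (p : {measure set X -> \bar R}) (Q : cquant) (h : X -> \bar R) :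
  measurable_fun setT h -> (forall x, 0 <= h x) ->
  \sum_(i < M) \int[p]_(x in cell (sval Q) i) h x = \int[p]_x h x.
Proof.
move=> mh h0.
rewrite -(@ge0_integral_bigsetU _ _ _ p _ (cell (sval Q)) h (index_enum 'I_M) _)//=.
- congr (integral _ _ _); apply/seteqP; split => // x _.
  by rewrite -bigcup_seq/=; exists (sval Q x) => //=; rewrite mem_index_enum.
- by move=> i; exact: measurable_cell.
- exact: index_enum_uniq.
- by move=> i j _ _ [x []]; rewrite /cell/= => -> ->.
- exact: measurable_funTS.
Qed.

Definition updq (p : BS) (Q : X -> 'I_M) (i : 'I_M) : BS := upd nu mf p (cell Q i).

Lemma int_updq p (Q : cquant) i (h : X -> \bar R) :
  measurable_fun setT h -> (forall x, 0 <= h x) ->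
  \int[updq p (sval Q) i]_y h y = \int[p]_(x in cell (sval Q) i) markov_op f nu h x.
Proof. by move=> mh h0; apply: int_upd => //; exact: measurable_cell. Qed.

Lemma sum_updq p (Q : cquant) (h : X -> \bar R) :
  measurable_fun setT h -> (forall x, 0 <= h x) ->
  \sum_(i < M) \int[updq p (sval Q) i]_y h y = \int[p]_x markov_op f nu h x.
Proof.
move=> mh h0; under eq_bigr do rewrite int_updq//.
rewrite sum_cell//; first exact: measurable_markov_op.
by move=> x; exact: markov_op_ge0.
Qed.

(* On cells the law of the next state is linear in the prior, so this single relation yields
   congruence, homogeneity and superadditivity. *)
Definition is_mix (c1 c2 : R) (p p1 p2 : BS) :=
  forall E, measurable E -> p E = c1%:E * p1 E + c2%:E * p2 E.

Lemma int_mix c1 c2 (p p1 p2 : BS) D (h : X -> \bar R) : (0 <= c1)%R -> (0 <= c2)%R ->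
  is_mix c1 c2 p p1 p2 -> measurable D ->
  measurable_fun D h -> (forall x, D x -> 0 <= h x) ->
  \int[p]_(x in D) h x = c1%:E * \int[p1]_(x in D) h x + c2%:E * \int[p2]_(x in D) h x.
Proof.
move=> c10 c20 mix mD mh h0.
have := @ge0_integral_mscale _ _ R p1 D mD (NngNum c10) h mh h0 => /= <-.
have := @ge0_integral_mscale _ _ R p2 D mD (NngNum c20) h mh h0 => /= <-.
rewrite -ge0_integral_measure_add//.
apply: int_eq_on => E mE; rewrite [LHS](mix E mE) /measure_add/= /msum/=.
by rewrite !big_ord_recl big_ord0 /= adde0.
Qed.

Lemma is_mix_updq c1 c2 p p1 p2 (Q : cquant) i : (0 <= c1)%R -> (0 <= c2)%R ->
  is_mix c1 c2 p p1 p2 ->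
  is_mix c1 c2 (updq p (sval Q) i) (updq p1 (sval Q) i) (updq p2 (sval Q) i).
Proof.
move=> c10 c20 mix E mE.
have H q : updq q (sval Q) i E = \int[q]_(x in cell (sval Q) i) markov_op f nu (fun y => (\1_E y)%:E) x.
  rewrite -int_updq//; first by rewrite integral_indic// setIT.
  by apply/measurable_EFinP; exact: measurable_indic.
have mE' : measurable_fun setT (fun y : X => (\1_E y)%:E : \bar R).
  by apply/measurable_EFinP; exact: measurable_indic.
rewrite !H; apply: int_mix => //.
- exact: measurable_cell.
- by apply: measurable_funTS; apply: measurable_markov_op.
- by move=> x _; apply: markov_op_ge0.
Qed.

(** A reconstruction point for the mixture is admissible for each component, whose own infimum can
    only be lower. *)
Lemma cost0_mix c1 c2 p p1 p2 (Q : cquant) i : (0 <= c1)%R -> (0 <= c2)%R ->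
  is_mix c1 c2 p p1 p2 ->
  c1%:E * cost0 p1 (cell (sval Q) i) + c2%:E * cost0 p2 (cell (sval Q) i) <=
    cost0 p (cell (sval Q) i).
Proof.
move=> c10 c20 mix; apply: le_ereal_inf_tmp => _ [u _ <-].
rewrite (int_mix c10 c20 mix)//.
- apply: leeD; (apply: lee_wpmul2l; first by rewrite lee_fin);
    by apply: ereal_inf_lbound; exists u.
- exact: measurable_cell.
- by apply: measurable_funTS; exact: measurable_sqdist.
- by move=> x _; rewrite lee_fin sqdist_ge0.
Qed.

Lemma qcost_mix c1 c2 p p1 p2 (Q : cquant) : (0 <= c1)%R -> (0 <= c2)%R ->
  is_mix c1 c2 p p1 p2 ->
  c1%:E * qcost p1 (sval Q) + c2%:E * qcost p2 (sval Q) <= qcost p (sval Q).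
Proof.
move=> c10 c20 mix; rewrite !qcostE.
rewrite !ge0_sume_distrr; try by move=> i _; exact: cost0_ge0.
rewrite -big_split/=; apply: lee_sum => i _; exact: cost0_mix.
Qed.

Lemma cost0_le (p : {measure set X -> \bar R}) D :
  cost0 p D <= \int[p]_(x in D) sqnorm x.
Proof.
apply: ereal_inf_lbound; exists [tuple 0%R | _ < dim] => //.
apply: eq_integral => x _; rewrite /sqnorm enorm_sqr; congr (_%:E).
by apply: eq_bigr => i _; rewrite tnth_mktuple subr0.
Qed.

Lemma qcost_le (p : BS) (Q : cquant) : qcost p (sval Q) <= \int[p]_x sqnorm x.
Proof.
rewrite -(sum_cell p Q)//; last exact: sqnorm_ge0; last exact: measurable_sqnorm.
by rewrite qcostE; apply: lee_sum => i _; exact: cost0_le.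
Qed.

Section Discounted.
Variable beta : R.
Hypothesis beta01 : (0 <= beta < 1)%R.
Let b0 : (0 <= beta)%R. Proof. by case/andP: beta01. Qed.

(* Discounted strategies are quantizers indexed by the symbols still to be observed, so the infimum
   over them involves no measurability. *)
Definition tree := seq 'I_M -> cquant.
Definition subtree (g : tree) (i : 'I_M) : tree := fun h => g (i :: h).

Fixpoint cost_upto (n : nat) (p : BS) (g : tree) : \bar R :=
  if n is n'.+1 then
    qcost p (sval (g [::])) +
    beta%:E * \sum_(i < M) cost_upto n' (updq p (sval (g [::])) i) (subtree g i)
  else 0.

Lemma cost_upto_ge0 n p g : 0 <= cost_upto n p g.
Proof.
elim: n p g => [//|n IH] p g /=; rewrite adde_ge0 ?qcost_ge0// mule_ge0 ?lee_fin//.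
by apply: sume_ge0 => i _; exact: IH.
Qed.

Lemma cost_upto_nd p g : nondecreasing_seq (fun n => cost_upto n p g).
Proof.
apply/nondecreasing_seqP => n; elim: n p g => [|n IH] p g; first exact: cost_upto_ge0.
rewrite /= -!/(cost_upto _ _ _); apply: leeD => //; apply: lee_wpmul2l; first by rewrite lee_fin.
by apply: lee_sum => i _; exact: IH.
Qed.

Definition cost_total p g := limn (fun n => cost_upto n p g).

Lemma cost_upto_cvg p g : (fun n => cost_upto n p g) @ \oo --> cost_total p g.
Proof. exact: (ereal_nondecreasing_is_cvgn (@cost_upto_nd p g)). Qed.

Lemma cost_upto_le n p g : cost_upto n p g <= cost_total p g.
Proof.
apply: lime_ge; first exact: (ereal_nondecreasing_is_cvgn (@cost_upto_nd p g)).
by near=> i; apply: cost_upto_nd; near: i; exists n.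
Unshelve. all: by end_near. Qed.

Lemma cost_total_ge0 p g : 0 <= cost_total p g.
Proof. exact: le_trans (cost_upto_ge0 0 p g) (cost_upto_le 0 p g). Qed.

Lemma cost_total_le p g (c : \bar R) : (forall n, cost_upto n p g <= c) -> cost_total p g <= c.
Proof.
move=> H; apply: lime_le; first exact: (ereal_nondecreasing_is_cvgn (@cost_upto_nd p g)).
by near=> i; exact: H.
Unshelve. all: by end_near. Qed.

Lemma cost_totalS p g : cost_total p g = qcost p (sval (g [::])) +
    beta%:E * \sum_(i < M) cost_total (updq p (sval (g [::])) i) (subtree g i).
Proof.
have h1 : (fun n => cost_upto n.+1 p g) @ \oo --> cost_total p g.
  by rewrite (cvg_shiftS (fun n => cost_upto n p g)); exact: cost_upto_cvg.
have h2 : (fun n => cost_upto n.+1 p g) @ \oo --> qcost p (sval (g [::])) +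
    beta%:E * \sum_(i < M) cost_total (updq p (sval (g [::])) i) (subtree g i).
  apply: cvgeD.
  - by rewrite ge0_adde_def// inE ?qcost_ge0// mule_ge0 ?lee_fin// sume_ge0// => i _; exact: cost_total_ge0.
  - exact: cvg_cst.
  - apply: cvgeZl => //; apply: cvg_nnesum => i _; first by near=> n; exact: cost_upto_ge0.
    exact: cost_upto_cvg.
by rewrite -(cvg_lim (@ereal_hausdorff R) h1) (cvg_lim (@ereal_hausdorff R) h2).
Unshelve. all: by end_near. Qed.

Lemma cost_upto_mix n c1 c2 p p1 p2 g : (0 <= c1)%R -> (0 <= c2)%R -> is_mix c1 c2 p p1 p2 ->
  c1%:E * cost_upto n p1 g + c2%:E * cost_upto n p2 g <= cost_upto n p g.
Proof.
move=> c10 c20; elim: n p p1 p2 g => [|n IH] p p1 p2 g mix /=.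
  by rewrite !mule0 adde0.
have S0 q : 0 <= \sum_(i < M) cost_upto n (updq q (sval (g [::])) i) (subtree g i).
  by apply: sume_ge0 => i _; exact: cost_upto_ge0.
rewrite !ge0_muleDr ?qcost_ge0 ?mule_ge0 ?lee_fin//.
rewrite addeACA; apply: leeD; first exact: qcost_mix.
rewrite ![_%:E * (beta%:E * _)]muleCA -ge0_muleDr ?mule_ge0 ?lee_fin//.
apply: lee_wpmul2l; rewrite ?lee_fin//.
rewrite !ge0_sume_distrr; try by move=> i _; exact: cost_upto_ge0.
rewrite -big_split/=; apply: lee_sum => i _; apply: IH.
exact: is_mix_updq.
Qed.

Definition disc_value p := ereal_inf [set cost_total p g | g in [set: tree]].

Lemma disc_value_ge0 p : 0 <= disc_value p.
Proof. by apply: le_ereal_inf_tmp => _ [g _ <-]; exact: cost_total_ge0. Qed.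

Lemma disc_value_le_cost p g : disc_value p <= cost_total p g.
Proof. by apply: ereal_inf_lbound; exists g. Qed.

Lemma disc_value_mix c1 c2 p p1 p2 : (0 <= c1)%R -> (0 <= c2)%R -> is_mix c1 c2 p p1 p2 ->
  c1%:E * disc_value p1 + c2%:E * disc_value p2 <= disc_value p.
Proof.
move=> c10 c20 mix; apply: le_ereal_inf_tmp => _ [g _ <-].
apply: (@le_trans _ _ (c1%:E * cost_total p1 g + c2%:E * cost_total p2 g)).
  by apply: leeD; (apply: lee_wpmul2l; first by rewrite lee_fin); exact: disc_value_le_cost.
have h : (fun n => c1%:E * cost_upto n p1 g + c2%:E * cost_upto n p2 g) @ \oo -->
    c1%:E * cost_total p1 g + c2%:E * cost_total p2 g.
  apply: cvgeD; [|by apply: cvgeZl => //; exact: cost_upto_cvg..].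
  by rewrite ge0_adde_def// inE mule_ge0 ?lee_fin// cost_total_ge0.
rewrite -(cvg_lim (@ereal_hausdorff R) h); apply: lime_le.
  by apply/cvg_ex; eexists; exact: h.
near=> n; apply: le_trans (cost_upto_le n p g); exact: cost_upto_mix.
Unshelve. all: by end_near. Qed.

Lemma disc_value_lower p (l : \bar R) :
  (forall Q : cquant, l <= qcost p (sval Q) + beta%:E * \sum_(i < M) disc_value (updq p (sval Q) i)) ->
  l <= disc_value p.
Proof.
move=> H; apply: le_ereal_inf_tmp => _ [g _ <-]; apply: le_trans (H (g [::])) _.
rewrite cost_totalS; apply: leeD => //; apply: lee_wpmul2l; rewrite ?lee_fin//.
by apply: lee_sum => i _; exact: disc_value_le_cost.
Qed.

(** Near-optimal strategies after each symbol are glued into one tree; each loses at most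
    [eps / M.+1], so all together lose at most [eps]. *)
Lemma disc_value_upper p (Q : cquant) :
  disc_value p <= qcost p (sval Q) + beta%:E * \sum_(i < M) disc_value (updq p (sval Q) i).
Proof.
apply/lee_addgt0Pr => eps eps0.
pose d := (eps / M.+1%:R)%R.
have d0 : (0 < d)%R by rewrite divr_gt0.
have near_opt i : {g | cost_total (updq p (sval Q) i) g <= disc_value (updq p (sval Q) i) + d%:E}.
  apply: cid; have := disc_value_ge0 (updq p (sval Q) i).
  case E: (disc_value (updq p (sval Q) i)) => [v| |]// _; last first.
    by exists (fun=> Q); rewrite leey.
  have vf : disc_value (updq p (sval Q) i) \is a fin_num by rewrite E.
  have [_ [g _ <-] /ltW h] := lb_ereal_inf_adherent (S := [set cost_total (updq p (sval Q) i) g | g in setT])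
     d0 vf.
  by exists g; rewrite -E.
pose g : tree := fun h => if h is i :: h' then sval (near_opt i) h' else Q.
apply: le_trans (disc_value_le_cost p g) _; rewrite cost_totalS /= -addeA; apply: leeD => //.
have SV0 : 0 <= \sum_(i < M) disc_value (updq p (sval Q) i) by apply: sume_ge0 => i _; exact: disc_value_ge0.
apply: (@le_trans _ _ (beta%:E * (\sum_(i < M) disc_value (updq p (sval Q) i) + eps%:E))).
  apply: lee_wpmul2l; first by rewrite lee_fin.
  apply: (@le_trans _ _ (\sum_(i < M) (disc_value (updq p (sval Q) i) + d%:E))).
    by apply: lee_sum => i _; exact: (svalP (near_opt i)).
  rewrite big_split/=; apply: leeD => //.
  rewrite sumEFin sumr_const card_ord lee_fin -[leLHS]mulr_natl /d mulrA ler_pdivrMr//.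
  by rewrite mulrC ler_wpM2l ?(ltW eps0)// ler_nat.
rewrite ge0_muleDr//; last by rewrite lee_fin ltW.
apply: leeD => //; rewrite -EFinM lee_fin -[leRHS]mul1r ler_wpM2r// ltW//.
by case/andP: beta01.
Qed.

(** Reconstructing every cell by the origin costs at most the second moment, and the parts of the
    belief carried by the cells add up to the unconditioned law. *)
Lemma cost_upto_le_sqnorm n p g :
  cost_upto n p g <= \sum_(t < n) (beta ^+ t)%:E * \int[p]_x iter_exp f nu t sqnorm x.
Proof.
have ms t : measurable_fun setT (iter_exp f nu t sqnorm).
  by apply: measurable_iter_exp => //; [exact: measurable_sqnorm|exact: sqnorm_ge0].
have s0 t x : 0 <= iter_exp f nu t sqnorm x by apply: iter_exp_ge0; exact: sqnorm_ge0.
elim: n p g => [|n IH] p g; first by rewrite big_ord0.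
rewrite big_ord_recl expr0 mul1e; apply: leeD; first exact: qcost_le.
rewrite [leRHS](eq_bigr (fun t : 'I_n => beta%:E * ((beta ^+ t)%:E *
    \int[p]_x iter_exp f nu t.+1 sqnorm x))); last first.
  by move=> t _; rewrite lift0 exprS EFinM -muleA.
have P0 t : 0 <= (beta ^+ t)%:E * \int[p]_x iter_exp f nu t.+1 sqnorm x.
  apply: mule_ge0; first by rewrite lee_fin exprn_ge0.
  by apply: integral_ge0 => x _; exact: s0.
rewrite -ge0_sume_distrr; last first.
  by move=> t _; exact: P0.
apply: lee_wpmul2l; rewrite ?lee_fin//.
apply: (@le_trans _ _ (\sum_(i < M) \sum_(t < n) (beta ^+ t)%:E *
    \int[updq p (sval (g [::])) i]_x iter_exp f nu t sqnorm x)).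
  by apply: lee_sum => i _; exact: IH.
rewrite exchange_big/=; apply: lee_sum => t _.
rewrite -ge0_sume_distrr; last by move=> i _; exact: integral_ge0.
by rewrite sum_updq.
Qed.

Lemma disc_value_le_sqnorm (p : BS) (B : R) (Q : cquant) :
  (forall t, \int[p]_x iter_exp f nu t sqnorm x <= B%:E) ->
  disc_value p <= (B / (1 - beta))%:E.
Proof.
move=> HB; case/andP: beta01 => _ b1.
have B0 : (0 <= B)%R.
  rewrite -lee_fin; apply: le_trans (HB 0%N); apply: integral_ge0 => x _.
  exact: sqnorm_ge0.
apply: le_trans (disc_value_le_cost p (fun=> Q)) _; apply: cost_total_le => n.
apply: le_trans (cost_upto_le_sqnorm _ _ _) _.
apply: (@le_trans _ _ (\sum_(t < n) (beta ^+ t * B)%:E)).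
  by apply: lee_sum => t _; rewrite EFinM lee_wpmul2l// lee_fin exprn_ge0.
rewrite sumEFin lee_fin -mulr_suml mulrC ler_wpM2l//.
have b1' : (0 < 1 - beta)%R by rewrite subr_gt0.
rewrite -[leRHS]mul1r ler_pdivlMr// mulrC -opprB mulNr -subrX1 opprB.
by rewrite gerBl exprn_ge0.
Qed.

End Discounted.
End Control.

(** * Splitting a multiple of a measure off a belief *)

Section MeasureDifference.
Local Open Scope ereal_scope.
Context {R : realType} d (T : measurableType d).
Variables (p q : giry T R) (c : R).
Hypothesis qp : forall E, measurable E -> c%:E * q E <= p E.

Let cq_fin E : measurable E -> c%:E * q E \is a fin_num.
Proof. by move=> mE; rewrite fin_numM// fin_num_measure. Qed.

(** Domination is only assumed on measurable sets; the default 0 keeps [r] nonnegative on the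
    others, as a measure is required to be. *)
Let r (E : set T) : \bar R := if pselect (measurable E) then p E - c%:E * q E else 0.

Let rE E : measurable E -> r E = p E - c%:E * q E.
Proof. by rewrite /r; case: pselect. Qed.

Let r0 : r set0 = 0. Proof. by rewrite rE// !measure0 mule0 sube0. Qed.

Let r_ge0 E : 0 <= r E.
Proof.
rewrite /r; case: pselect => // mE; rewrite sube_ge0; first exact: qp.
by rewrite cq_fin.
Qed.

Let r_sigma_additive : semi_sigma_additive r.
Proof.
move=> F mF tF mUF; rewrite rE//.
rewrite (_ : (fun n => _) =
    (fun n => \sum_(0 <= i < n) p (F i) - c%:E * \sum_(0 <= i < n) q (F i))).
  apply: cvgeB.
  - by rewrite fin_num_adde_defl// fin_numN cq_fin.
  - exact: measure_semi_sigma_additive.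
  - by apply: cvgeZl => //; exact: measure_semi_sigma_additive.
apply/funext => n; elim: n => [|n IH]; first by rewrite !big_geq// mule0 sube0.
rewrite !big_nat_recr//= IH rE// ge0_muleDr ?sume_ge0//.
rewrite oppeD; first by rewrite addeACA.
by rewrite fin_num_adde_defl// cq_fin.
Qed.

HB.instance Definition _ := isMeasure.Build _ _ _ r r0 r_ge0 r_sigma_additive.

Let r_setT (c0 : (0 <= c)%R) : r [set: T] <= 1.
Proof.
rewrite rE//; apply: le_trans (@sprobability_setT _ _ _ p).
by rewrite geeDl// oppe_le0 mule_ge0.
Qed.

Lemma measure_difference : (0 <= c)%R ->
  exists r' : giry T R, forall E, measurable E -> p E = c%:E * q E + 1%:E * r' E.
Proof.
move=> c0.
pose r' := Measure_isSubProbability.Build _ _ _ r (r_setT c0).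
exists (HB.pack_for (giry T R) r r') => E mE.
rewrite mul1e [X in _ = _ + X]rE// addeC subeK//.
exact: cq_fin.
Qed.

End MeasureDifference.

(** * Discounted regenerations and relative values *)

Section Resolvent.
Local Open Scope ereal_scope.
Context {R : realType} {dim k M : nat}.
Local Notation X := (dim.-tuple R).
Local Notation W := (k.-tuple R).
Local Notation BS := (giry X R).
Variables (f : X -> W -> X) (nu : probability W R).
Hypothesis mf : measurable_fun [set: (X * W)%type] (fun z => f z.1 z.2).
Variables (A : set X) (delta : R) (m : probability X R).
Hypothesis mA : measurable A.
Hypothesis delta01 : (0 < delta <= 1)%R.
Hypothesis minor : forall x E, A x -> measurable E -> delta%:E * m E <= trans f nu x E.
Local Notation s := (smin A delta).
Variable beta : R.
Hypothesis beta01 : (0 < beta < 1)%R.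
Let b0 : (0 <= beta)%R. Proof. by case/andP: beta01 => /ltW. Qed.
Let b1 : (0 < 1 - beta)%R. Proof. by case/andP: beta01; rewrite subr_gt0. Qed.
Let beta01' : (0 <= beta < 1)%R. Proof. by rewrite b0; case/andP: beta01. Qed.

Let s0 x : 0 <= s x. Proof. exact: smin_ge0. Qed.
Let ms : measurable_fun setT s. Proof. exact: measurable_smin. Qed.

(** The partial sums of the resolvent series of [s], whose terms are [beta ^+ t] times
    [iter_exp f nu t s]. *)
Fixpoint Rsn n x : \bar R := if n is n'.+1 then s x + beta%:E * markov_op f nu (Rsn n') x else 0.

Lemma RsnP n : [/\ measurable_fun setT (Rsn n), (forall x, 0 <= Rsn n x),
  (forall x, Rsn n x <= Rsn n.+1 x) & forall x, Rsn n x <= (1 / (1 - beta))%:E].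
Proof.
elim: n => [|n [IH1 IH2 IH3 IH4]].
  split => //=.
    by move=> x; rewrite adde_ge0// mule_ge0 ?lee_fin// markov_op_ge0.
  by move=> x; rewrite lee_fin divr_ge0// ltW.
split.
- apply: emeasurable_funD => //; apply: measurable_funeM; exact: measurable_markov_op.
- by move=> x; rewrite /= adde_ge0// mule_ge0 ?lee_fin// markov_op_ge0.
- move=> x; apply: leeD => //; apply: lee_wpmul2l; first by rewrite lee_fin.
  exact: markov_op_le.
- move=> x; apply: (@le_trans _ _ (1 + beta%:E * (1 / (1 - beta))%:E)).
    apply: leeD; first exact: smin_le1.
    apply: lee_wpmul2l; first by rewrite lee_fin.
    by rewrite -[leRHS](markov_op_cst f nu _ x); exact: markov_op_le.
  rewrite -EFinM -EFinD lee_fin le_eqVlt; apply/orP; left; apply/eqP.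
  by field; rewrite gt_eqF.
Qed.

Definition resolvent x := limn (fun n => Rsn n x).

Let Rsn_nd x : nondecreasing_seq (fun n => Rsn n x).
Proof. by apply/nondecreasing_seqP => n; case: (RsnP n). Qed.

Let resolvent_cvg x : (fun n => Rsn n x) @ \oo --> resolvent x.
Proof. exact: (ereal_nondecreasing_is_cvgn (@Rsn_nd x)). Qed.

Lemma measurable_resolvent : measurable_fun setT resolvent.
Proof.
apply: (emeasurable_fun_cvg Rsn) => [n|x _]; first by case: (RsnP n).
exact: resolvent_cvg.
Qed.

Lemma resolvent_ge0 x : 0 <= resolvent x.
Proof.
apply: lime_ge; first exact: (ereal_nondecreasing_is_cvgn (@Rsn_nd x)).
by near=> n; case: (RsnP n).
Unshelve. all: by end_near. Qed.

Lemma resolvent_le x : resolvent x <= (1 / (1 - beta))%:E.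
Proof.
apply: lime_le; first exact: (ereal_nondecreasing_is_cvgn (@Rsn_nd x)).
by near=> n; case: (RsnP n).
Unshelve. all: by end_near. Qed.

Lemma resolventE x : resolvent x = s x + beta%:E * markov_op f nu resolvent x.
Proof.
have h1 : (fun n => Rsn n.+1 x) @ \oo --> resolvent x.
  by rewrite (cvg_shiftS (fun n => Rsn n x)); exact: resolvent_cvg.
have h2 : (fun n => Rsn n.+1 x) @ \oo --> s x + beta%:E * markov_op f nu resolvent x.
  apply: cvgeD.
  - by rewrite ge0_adde_def// inE ?s0// mule_ge0 ?lee_fin// markov_op_ge0// => y; exact: resolvent_ge0.
  - exact: cvg_cst.
  - apply: cvgeZl => //.
    apply: cvg_monotone_convergence => //.
    + by move=> n; apply: (measurable_comp_f mf) => //; case: (RsnP n).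
    + by move=> n w _; case: (RsnP n).
by rewrite -(cvg_lim (@ereal_hausdorff R) h1) (cvg_lim (@ereal_hausdorff R) h2).
Qed.

Definition disc_visits (p : BS) := \int[p]_x resolvent x.

Lemma sub_int_le (p : BS) (h : X -> \bar R) (c : R) : (0 <= c)%R ->
  (forall x, 0 <= h x) -> (forall x, h x <= c%:E) -> \int[p]_x h x <= c%:E * p setT.
Proof.
move=> c0 h0 h1; rewrite -integral_cst//.
exact: ge0_le_integral_nonmeasurable.
Qed.

Lemma sub_int_fin (p : BS) (h : X -> \bar R) (c : R) : (0 <= c)%R ->
  (forall x, 0 <= h x) -> (forall x, h x <= c%:E) -> \int[p]_x h x \is a fin_num.
Proof.
move=> c0 h0 h1; rewrite ge0_fin_numE ?integral_ge0//.
apply: le_lt_trans (sub_int_le p c0 h0 h1) _.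
by rewrite ltey_eq fin_numM// fin_num_measure.
Qed.

Lemma disc_visits_ge0 p : 0 <= disc_visits p. Proof. by apply: integral_ge0 => x _; exact: resolvent_ge0. Qed.

Let c1 : (0 <= 1 / (1 - beta))%R. Proof. by rewrite divr_ge0// ltW. Qed.

Lemma disc_visits_fin p : disc_visits p \is a fin_num.
Proof. exact: (sub_int_fin p c1 resolvent_ge0 resolvent_le). Qed.

Lemma disc_visits_le p : disc_visits p <= (1 / (1 - beta))%:E * p setT.
Proof. exact: (sub_int_le p c1 resolvent_ge0 resolvent_le). Qed.

Lemma disc_visitsE p : disc_visits p = \int[p]_x s x + beta%:E * \int[p]_x markov_op f nu resolvent x.
Proof.
have mPR : measurable_fun setT (markov_op f nu resolvent).
  by apply: measurable_markov_op => //; [exact: measurable_resolvent|exact: resolvent_ge0].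
have PR0 x : 0 <= markov_op f nu resolvent x by apply: markov_op_ge0; exact: resolvent_ge0.
rewrite -ge0_integralZl_EFin// -ge0_integralD//; last 2 first.
- by move=> x _; rewrite mule_ge0.
- exact: measurable_funeM.
by apply: eq_integral => x _; exact: resolventE.
Qed.

Lemma disc_visits_mix c c' p p1 p2 : (0 <= c)%R -> (0 <= c')%R -> is_mix c c' p p1 p2 ->
  disc_visits p = c%:E * disc_visits p1 + c'%:E * disc_visits p2.
Proof.
move=> c0 c0' mix; apply: (int_mix c0 c0' mix) => //; first exact: measurable_resolvent.
by move=> x _; exact: resolvent_ge0.
Qed.

Local Notation disc_value := (@disc_value R dim k M f nu mf beta).
Local Notation cquant := (@cquant R dim M).

Variable Bm : R.
Hypothesis HBm : forall t, \int[m]_x iter_exp f nu t sqnorm x <= Bm%:E.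
Variable Q0 : cquant.

Let mB : BS := m.

Lemma Vm_fin : disc_value mB \is a fin_num.
Proof.
rewrite ge0_fin_numE; last exact: disc_value_ge0.
by apply: le_lt_trans (disc_value_le_sqnorm mf beta01' Q0 HBm) _; rewrite ltry.
Qed.

(* The value for which [rel_value m = theta / beta], so that the relative values at [m] stay bounded
   as [beta] tends to 1. *)
Definition theta : R := (beta * fine (disc_value mB) / (1 + beta * fine (disc_visits mB)))%R.

Let den : (0 < 1 + beta * fine (disc_visits mB))%R.
Proof. by rewrite ltr_pwDl// mulr_ge0// fine_ge0// disc_visits_ge0. Qed.

Lemma theta_ge0 : (0 <= theta)%R.
Proof. by rewrite divr_ge0 ?(ltW den)// mulr_ge0// fine_ge0// disc_value_ge0. Qed.

(** The form in which the choice of [theta] is used: the discounted value of a restart from [m] pays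
    [theta] for the regeneration itself and for each later one, discounted. *)
Lemma thetaE : (beta * fine (disc_value mB) = theta + beta * theta * fine (disc_visits mB))%R.
Proof. by rewrite /theta; field; rewrite gt_eqF. Qed.

(* The part [(fine ps) * m] split off by a regeneration is handled by the choice of [theta], the rest by
   the induction hypothesis; superadditivity of [disc_value] recombines them. *)
Lemma theta_step (c : R) (p : BS) (Q : cquant) (i : 'I_M) : (0 <= c)%R ->
  (forall q : BS, theta%:E * disc_visits q <= disc_value q + c%:E * q setT) ->
  theta%:E * \int[p]_(x in cell (sval Q) i) s x + (beta * theta)%:E * disc_visits (updq nu mf p (sval Q) i)
    <= beta%:E * disc_value (updq nu mf p (sval Q) i) + (beta * c)%:E * updq nu mf p (sval Q) i setT.
Proof.
move=> c0 IH; set u := updq nu mf p (sval Q) i.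
pose D := cell (sval Q) i.
have mD : measurable D by exact: measurable_cell.
set ps := \int[p]_(x in D) s x.
have ps0 : 0 <= ps by apply: integral_ge0 => x _.
have psle : ps <= 1.
  apply: (@le_trans _ _ (\int[p]_x s x)); first by apply: ge0_subset_integral.
  apply: le_trans (sub_int_le p (c := 1) _ s0 _) _ => //; first by move=> x; exact: smin_le1.
  by rewrite mul1e; exact: sprobability_setT.
have psf : ps \is a fin_num by rewrite ge0_fin_numE//; apply: le_lt_trans psle _; rewrite ltry.
have psE : (fine ps)%:E = ps by rewrite fineK.
have psR0 : (0 <= fine ps)%R by exact: fine_ge0.
have qu E : measurable E -> (fine ps)%:E * mB E <= u E.
  move=> mE; rewrite psE.
  have mE' : measurable_fun setT (fun y : X => (\1_E y)%:E : \bar R).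
    by apply/measurable_EFinP; exact: measurable_indic.
  have -> : u E = \int[p]_(x in D) markov_op f nu (fun y => (\1_E y)%:E) x.
    rewrite -int_updq//; first by rewrite integral_indic// setIT.
  have -> : ps * mB E = \int[p]_(x in D) (s x * mB E).
    by rewrite ge0_integralZr//; exact: measurable_funTS.
  apply: ge0_le_integral_nonmeasurable => x _; first by rewrite mule_ge0.
  have := minor_int mf delta01 minor x mE' => /(_ _).
  rewrite integral_indic// setIT; apply => y.
  by rewrite lee_fin.
have [xi mix] := measure_difference qu psR0.
have o0 : (0 <= 1 :> R)%R by [].
have Vu := @disc_value_mix R dim k M f nu mf beta beta01' _ _ _ _ _ psR0 o0 mix.
have Uu := disc_visits_mix psR0 o0 mix.
have IHx := IH xi.
have xile : xi setT <= u setT.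
  by rewrite mix// mul1e leeDr// mule_ge0 ?lee_fin.
rewrite mul1e -/disc_value in Vu; rewrite mul1e in Uu.
have Vm := Vm_fin; have Um := disc_visits_fin mB; have Ux := disc_visits_fin xi.
have th0 := theta_ge0; have thE := thetaE.
have bpos : (0 < beta)%R by case/andP: beta01.
have xf : xi setT \is a fin_num by exact: fin_num_measure.
have uf : u setT \is a fin_num by exact: fin_num_measure.
have Vm0 := @disc_value_ge0 R dim k M f nu mf beta beta01' mB.
have Vx0 := @disc_value_ge0 R dim k M f nu mf beta beta01' xi.
have Vu0 := @disc_value_ge0 R dim k M f nu mf beta beta01' u.
have uE : (fine (u setT))%:E = u setT by rewrite fineK.
have xE : (fine (xi setT))%:E = xi setT by rewrite fineK.
have VmE : (fine (disc_value mB))%:E = disc_value mB by rewrite fineK.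
have UmE : (fine (disc_visits mB))%:E = disc_visits mB by rewrite fineK.
have UxE : (fine (disc_visits xi))%:E = disc_visits xi by rewrite fineK.
move: Vu Uu IHx xile Vx0 Vu0; rewrite -psE -uE -xE -VmE -UmE -UxE.
move: (fine ps) (fine (u setT)) (fine (xi setT)) (fine (disc_value mB)) (fine (disc_visits mB)) (fine (disc_visits xi)) thE psR0
  => a uT xT vm um ux thE a0 /=.
case: (disc_value u) => [vu| |]; last by [].
- case: (disc_value xi) => [vx| |]; [|by rewrite -EFinM|by []].
  rewrite -!EFinM -!EFinD => + -> + + _ _; rewrite -!EFinM -!EFinD !lee_fin => h1 h2 h3.
  have h1' := ler_wpM2l b0 h1; have h2' := ler_wpM2l b0 h2.
  have h3' := ler_wpM2l (mulr_ge0 b0 c0) h3.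
  have h4 : (a * (beta * vm) = a * (theta + beta * theta * um))%R by rewrite thE.
  by move: h1' h2' h3' h4; rewrite !mulrDr; lra.
- move=> _ -> _ _ _ _; rewrite gt0_muley ?lte_fin// -!EFinM addye//.
  by rewrite leey.
Qed.

Lemma sum_int_smin_cell (p : BS) (Q : cquant) :
  \sum_(i < M) \int[p]_(x in cell (sval Q) i) s x = \int[p]_x s x.
Proof. exact: sum_cell. Qed.

Lemma sum_disc_visits_updq p (Q : cquant) :
  \sum_(i < M) disc_visits (updq nu mf p (sval Q) i) = \int[p]_x markov_op f nu resolvent x.
Proof. by apply: sum_updq; [exact: measurable_resolvent|exact: resolvent_ge0]. Qed.

Lemma sum_mass_updq p (Q : cquant) : \sum_(i < M) updq nu mf p (sval Q) i setT = p setT.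
Proof.
have H (q : BS) : q setT = \int[q]_x (cst 1 x) by rewrite integral_cst// mul1e.
under eq_bigr do rewrite H.
rewrite sum_updq//.
by rewrite H; apply: eq_integral => x _; exact: markov_op_cst.
Qed.

Let PRs_fin (p : BS) : \int[p]_x markov_op f nu resolvent x \is a fin_num.
Proof.
apply: (sub_int_fin p c1) => x; first by apply: markov_op_ge0; exact: resolvent_ge0.
by rewrite -[leRHS](markov_op_cst f nu _ x); apply: markov_op_le; [exact: resolvent_ge0|exact: resolvent_le].
Qed.

Let V0 p : 0 <= disc_value p. Proof. exact: disc_value_ge0. Qed.

(** The case [n = 0] holds because [disc_visits] is at most the mass divided by [1 - beta]; each use
    of [theta_step], summed over the cells, gains a factor [beta] in the error. *)
Lemma theta_disc_visits_le_approx n (p : BS) :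
  theta%:E * disc_visits p <= disc_value p + (beta ^+ n * (theta / (1 - beta)))%:E * p setT.
Proof.
have kap0 : (0 <= theta / (1 - beta))%R by rewrite divr_ge0 ?theta_ge0// ltW.
elim: n p => [|n IH] p.
  rewrite expr0 mul1r; apply: (@le_trans _ _ ((theta / (1 - beta))%:E * p setT)).
    rewrite [X in _ <= X * _]EFinM -muleA; apply: lee_wpmul2l; first by rewrite lee_fin theta_ge0.
    by have := disc_visits_le p; rewrite div1r.
  by rewrite leeDr.
rewrite exprS -mulrA; set c := (beta ^+ n * _)%R in IH *.
have c0 : (0 <= c)%R by rewrite mulr_ge0// exprn_ge0.
rewrite -leeBlDr; last by rewrite fin_numM// fin_num_measure.
apply: (@disc_value_lower R dim k M f nu mf beta beta01') => Q; rewrite leeBlDr; last by rewrite fin_numM// fin_num_measure.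
apply: (@le_trans _ _ (beta%:E * \sum_(i < M) disc_value (updq nu mf p (sval Q) i)
    + (beta * c)%:E * p setT)); last first.
  by rewrite leeD2r// leeDr// qcost_ge0.
have S0 : 0 <= \int[p]_x s x by exact: integral_ge0.
have P0 : 0 <= \int[p]_x markov_op f nu resolvent x.
  by apply: integral_ge0 => x _; apply: markov_op_ge0; exact: resolvent_ge0.
rewrite disc_visitsE ge0_muleDr ?mule_ge0// muleA -EFinM (mulrC theta).
rewrite -(sum_int_smin_cell p Q) -(sum_disc_visits_updq p Q) -(sum_mass_updq p Q).
rewrite !ge0_sume_distrr; try by move=> i _; rewrite ?disc_visits_ge0 ?V0 ?measure_ge0 ?integral_ge0.
rewrite -!big_split/=; apply: lee_sum => i _.
exact: theta_step.
Qed.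

Lemma theta_disc_visits_le (p : BS) : theta%:E * disc_visits p <= disc_value p.
Proof.
have [b0' b1'] := andP beta01.
have pf : p setT \is a fin_num by exact: fin_num_measure.
have h : (fun n => disc_value p + (beta ^+ n * (theta / (1 - beta)))%:E * p setT) @ \oo -->
    disc_value p + 0%:E * p setT.
  apply: cvgeD.
  - by rewrite mul0e ge0_adde_def// inE.
  - exact: cvg_cst.
  - apply: cvgeZr => //; apply: cvg_EFin; first by near=> n.
    rewrite /comp/= -[0%R](mul0r (theta / (1 - beta))%R).
    by apply: cvgM; [apply: cvg_expr; rewrite ger0_norm|exact: cvg_cst].
rewrite -[disc_value p]adde0 -(mul0e (p setT)) -(cvg_lim (@ereal_hausdorff R) h).
apply: lime_ge; first by apply/cvg_ex; eexists; exact: h.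
by near=> n; exact: theta_disc_visits_le_approx.
Unshelve. all: by end_near. Qed.

Definition rel_value p := disc_value p - theta%:E * disc_visits p.

Let tU_fin p : theta%:E * disc_visits p \is a fin_num.
Proof. by rewrite fin_numM// disc_visits_fin. Qed.

Lemma rel_value_ge0 p : 0 <= rel_value p.
Proof. by rewrite sube_ge0 ?tU_fin//; exact: theta_disc_visits_le. Qed.

Lemma rel_valueE p : disc_value p = rel_value p + theta%:E * disc_visits p.
Proof. by rewrite /rel_value subeK// tU_fin. Qed.

Lemma rel_value_le p : rel_value p <= disc_value p.
Proof.
rewrite [leRHS]rel_valueE leeDl// mule_ge0 ?lee_fin ?theta_ge0//; exact: disc_visits_ge0.
Qed.

(** [disc_visits] is linear in the belief, so its contribution after one step does not depend on the
    quantizer. Cancelling it turns the dynamic programming inequalities for [disc_value] into those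
    for [rel_value]. *)
Let sum_V_updq p (Q : cquant) : beta%:E * \sum_(i < M) disc_value (updq nu mf p (sval Q) i) =
  beta%:E * \sum_(i < M) rel_value (updq nu mf p (sval Q) i) +
  theta%:E * (beta%:E * \int[p]_x markov_op f nu resolvent x).
Proof.
rewrite -(sum_disc_visits_updq p Q) [X in _ = _ + X]muleCA -ge0_muleDr; last 2 first.
- by apply: sume_ge0 => i _; exact: rel_value_ge0.
- by rewrite mule_ge0 ?lee_fin ?theta_ge0// sume_ge0// => i _; exact: disc_visits_ge0.
congr (_ * _); rewrite ge0_sume_distrr; last by move=> i _; exact: disc_visits_ge0.
by rewrite -big_split/=; apply: eq_bigr => i _; exact: rel_valueE.
Qed.

Let V_split p : disc_value p = rel_value p + theta%:E * \int[p]_x s x +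
  theta%:E * (beta%:E * \int[p]_x markov_op f nu resolvent x).
Proof.
rewrite [LHS]rel_valueE disc_visitsE -[RHS]addeA -ge0_muleDr//; first by apply: integral_ge0 => x _.
by rewrite mule_ge0 ?lee_fin// integral_ge0// => x _; apply: markov_op_ge0; exact: resolvent_ge0.
Qed.

Let cut_fin (p : BS) : theta%:E * (beta%:E * \int[p]_x markov_op f nu resolvent x) \is a fin_num.
Proof. by rewrite !fin_numM. Qed.

Lemma rel_value_upper (p : BS) (Q : cquant) : rel_value p + theta%:E * \int[p]_x s x <=
  qcost p (sval Q) + beta%:E * \sum_(i < M) rel_value (updq nu mf p (sval Q) i).
Proof.
have := disc_value_upper nu mf beta01' p Q; rewrite sum_V_updq V_split addeA leeD2rE//.
Qed.

Lemma rel_value_lower (p : BS) (eps : R) : (0 < eps)%R -> exists Q : cquant,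
  qcost p (sval Q) + beta%:E * \sum_(i < M) rel_value (updq nu mf p (sval Q) i) <=
    rel_value p + theta%:E * \int[p]_x s x + eps%:E.
Proof.
move=> eps0; have [Vfin|] := boolP (disc_value p \is a fin_num); last first.
  (* Where [disc_value] is infinite so is [rel_value], and any quantizer will do. *)
  move=> Vinf; exists Q0; have Vy : disc_value p = +oo.
    by apply/eqP; rewrite -leye_eq leNgt; apply: contra Vinf => h; rewrite ge0_fin_numE.
  have -> : rel_value p = +oo by rewrite /rel_value Vy -(fineK (tU_fin p)).
  have i0 : 0 <= theta%:E * \int[p]_x s x.
    by rewrite mule_ge0 ?lee_fin ?theta_ge0// integral_ge0.
  rewrite addye; last by rewrite gt_eqF// (lt_le_trans _ i0).
  by rewrite addye// leey.
apply: contrapT => hn; suff : disc_value p + eps%:E <= disc_value p.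
  by move: Vfin; case: (disc_value p) => // v _; rewrite -EFinD lee_fin; lra.
apply: (@disc_value_lower R dim k M f nu mf beta beta01') => Q; rewrite sum_V_updq addeA V_split [leLHS]addeAC leeD2rE//.
by apply/ltW; rewrite ltNge; apply/negP => h; apply: hn; exists Q.
Qed.

(** With second coefficient 0, superadditivity of [disc_value] becomes one-sided homogeneity, while
    [disc_visits] is exactly homogeneous. *)
Lemma rel_value_scale (c : R) p q : (0 <= c)%R -> is_mix c 0 p q q -> c%:E * rel_value q <= rel_value p.
Proof.
move=> c0 mix; have z0 : (0 <= 0 :> R)%R by [].
have HV := @disc_value_mix R dim k M f nu mf beta beta01' _ _ _ _ _ c0 z0 mix.
have HU := disc_visits_mix c0 z0 mix.
rewrite !mul0e !adde0 in HV HU; move: HV; rewrite rel_valueE [disc_value p]rel_valueE HU.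
rewrite ge0_muleDr ?rel_value_ge0 ?mule_ge0 ?lee_fin ?theta_ge0 ?disc_visits_ge0//.
by rewrite muleCA leeD2rE// fin_numM// fin_numM// disc_visits_fin.
Qed.

Lemma rel_value_m : rel_value mB = (theta / beta)%:E.
Proof.
have [bp _] := andP beta01.
rewrite /rel_value -(fineK Vm_fin) -(fineK (disc_visits_fin mB)) -EFinM -EFinB; congr (_%:E).
have bn : (beta != 0)%R by rewrite gt_eqF.
by apply: (mulfI bn); rewrite mulrBr thetaE; field.
Qed.

(** At the invariant law [disc_visits] equals [delta * pst A / (1 - beta)] and [disc_value] is at
    most [B / (1 - beta)]; the common factor cancels and leaves a bound independent of [beta]. *)
Lemma theta_le (pst : probability X R) (B : R) : Defs.invariant f nu pst ->
  0 < pst A -> \int[pst]_x sqnorm x <= B%:E ->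
  (theta * (delta * fine (pst A)) <= B)%R.
Proof.
move=> inv pA HB.
have pAf : pst A \is a fin_num by exact: fin_num_measure.
have bn : (1 - beta != 0)%R by rewrite gt_eqF.
have HU : disc_visits (pst : BS) = (delta * fine (pst A) / (1 - beta))%:E.
  have := disc_visitsE (pst : BS); rewrite invariant_markov_op//; [|exact: measurable_resolvent|exact: resolvent_ge0].
  rewrite integral_smin// -/(disc_visits (pst : BS)) -(fineK (disc_visits_fin (pst : BS))).
  have -> : delta%:E * pst A = (delta * fine (pst A))%:E by rewrite EFinM fineK.
  rewrite -!EFinM -EFinD => -[E]; congr (_%:E).
  by rewrite -[LHS](mulfK bn) mulrBr mulr1 {1}E; congr (_ / _)%R; ring.
have := theta_disc_visits_le (pst : BS); rewrite HU.
have ms2 := measurable_sqnorm; have s20 := sqnorm_ge0.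
have HV : disc_value (pst : BS) <= (B / (1 - beta))%:E.
  apply: (disc_value_le_sqnorm mf beta01' Q0) => t.
  by rewrite invariant_iter_exp.
move=> /le_trans /(_ HV); rewrite -EFinM lee_fin [leLHS]mulrA ler_pM2r ?invr_gt0//.
Qed.

End Resolvent.

(** * Compactness of quantizers with convex cells *)

Section Separation.
Context {R : realType}.

Lemma dot_tlerp n (a x y : n.-tuple R) l :
  dot a (tlerp l x y) = l * dot a x + (1 - l) * dot a y.
Proof.
rewrite /dot !mulr_sumr -big_split/=; apply: eq_bigr => i _.
by rewrite tnth_mktuple; ring.
Qed.

Lemma dot_cons n (t : R) (a : n.-tuple R) (x : n.+1.-tuple R) :
  dot (cons_tuple t a) x = t * thead x + dot a (behead_tuple x).
Proof.
rewrite /dot big_ord_recl tnth0; congr (_ + _); apply: eq_bigr => i _.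
rewrite tnthS; congr (_ * _).
by rewrite tnth_behead; congr (tnth x _); apply/val_inj; rewrite /= inordK// ltnS.
Qed.

Lemma tuple_etaE n (x : n.+1.-tuple R) : cons_tuple (thead x) (behead_tuple x) = x.
Proof. by rewrite [RHS]tuple_eta; apply/val_inj. Qed.

Lemma tlerp_cons n l (s t : R) (x y : n.-tuple R) :
  tlerp l (cons_tuple s x) (cons_tuple t y) = cons_tuple (l * s + (1 - l) * t) (tlerp l x y).
Proof.
apply: eq_from_tnth => i; rewrite tnth_mktuple.
by case: (unliftP ord0 i) => [j ->|->]; rewrite ?tnthS ?tnth0// tnth_mktuple.
Qed.

(** Induction on the dimension, by order arguments only. If the first coordinate takes both signs on
    [C], the induction hypothesis yields a functional [a'] on the slice where it vanishes, and only
    the coefficient of the first coordinate remains to be chosen. *)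
Lemma support_functional n (C : set (n.-tuple R)) : Defs.convex_set C -> C !=set0 ->
  ~ C [tuple 0 | _ < n] ->
  exists2 a : n.-tuple R, (exists i, tnth a i != 0) & forall c, C c -> 0 <= dot a c.
Proof.
elim: n C => [|n IH] C cC [c0 Cc0] C0.
  by case: C0; rewrite (_ : [tuple _ | _ < _] = c0)//; apply: eq_from_tnth => -[].
pose z : n.-tuple R := [tuple 0 | _ < n].
have dotz x : dot z x = 0.
  by rewrite /dot big1// => i _; rewrite tnth_mktuple mul0r.
have [h|/existsNP[p /not_implyP[Cp /negP]]] := pselect (forall c, C c -> thead c <= 0).
  exists (cons_tuple (-1) z) => [|c Cc]; first by exists ord0; rewrite tnth0 oppr_eq0 oner_neq0.
  by rewrite dot_cons dotz addr0 mulN1r oppr_ge0; exact: h.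
rewrite -ltNge => up.
have [h|/existsNP[q /not_implyP[Cq /negP]]] := pselect (forall c, C c -> 0 <= thead c).
  exists (cons_tuple 1 z) => [|c Cc]; first by exists ord0; rewrite tnth0 oner_neq0.
  by rewrite dot_cons dotz addr0 mul1r; exact: h.
rewrite -ltNge => uq.
pose C' : set (n.-tuple R) := [set t | C (cons_tuple 0 t)].
have cC' : Defs.convex_set C'.
  move=> x y l Cx Cy l01; have := cC _ _ _ Cx Cy l01.
  by rewrite tlerp_cons !mulr0 addr0.
(* A segment joining the two sides meets the slice; this makes the slice nonempty and relates points
   of opposite sides. *)
have cross x y : C x -> C y -> 0 < thead x -> thead y < 0 ->
    let l := - thead y / (thead x - thead y) in
    C' (tlerp l (behead_tuple x) (behead_tuple y)).
  move=> Cx Cy x0 y0 l.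
  have d0 : 0 < thead x - thead y by lra.
  have l01 : 0 <= l <= 1.
    apply/andP; split; first by apply: divr_ge0; lra.
    by rewrite /l ler_pdivrMr// mul1r; lra.
  have := cC _ _ _ Cx Cy l01.
  rewrite -(tuple_etaE x) -(tuple_etaE y) tlerp_cons !tuple_etaE.
  rewrite (_ : l * thead x + (1 - l) * thead y = 0)//.
  by rewrite /l; field; rewrite gt_eqF.
have C'n : C' !=set0 by eexists; apply: (cross p q).
have C'0 : ~ C' [tuple 0 | _ < n].
  move=> h; apply: C0; move: h; rewrite /C'/=; congr C.
  apply: eq_from_tnth => i; rewrite tnth_mktuple.
  by case: (unliftP ord0 i) => [j ->|->]; rewrite ?tnthS ?tnth0// tnth_mktuple.
have [a' a'n a'pos] := IH C' cC' C'n C'0.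
(* [g x] is the coefficient for which the extended functional vanishes at [x]: a lower bound for the
   admissible ones if [thead x > 0], an upper bound if [thead x < 0]. The supremum of the lower
   bounds is taken. *)
pose g (x : n.+1.-tuple R) := - dot a' (behead_tuple x) / thead x.
pose S : set R := [set g x | x in [set x | C x /\ 0 < thead x]].
have Sub y : C y -> thead y < 0 -> ubound S (g y).
  move=> Cy y0 _ [x [Cx x0] <-]; rewrite /g.
  have := a'pos _ (cross _ _ Cx Cy x0 y0); rewrite dot_tlerp.
  set A := dot _ _; set B := dot _ _ => h.
  have d0 : 0 < thead x - thead y by lra.
  have : 0 <= (thead x - thead y) * (- thead y / (thead x - thead y) * A +
     (1 - - thead y / (thead x - thead y)) * B) by rewrite mulr_ge0// ltW.
  rewrite (_ : _ * (_ + _) = - thead y * A + thead x * B); last by field; rewrite gt_eqF.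
  move=> h2; rewrite ler_pdivrMr// mulrAC ler_ndivlMr// -subr_ge0.
  by rewrite (_ : _ - _ = - thead y * A + thead x * B)//; ring.
have Sn : S !=set0 by exists (g p); exists p.
have Sh : has_sup S by split=> //; exists (g q); exact: Sub.
exists (cons_tuple (sup S) a') => [|c Cc].
  by case: a'n => i ai; exists (lift ord0 i); rewrite tnthS.
rewrite dot_cons; have [c0'|c0'|c0'] := ltgtP (thead c) 0.
- have : sup S <= g c by apply: ge_sup => //; exact: Sub.
  by rewrite /g ler_ndivlMr//; lra.
- have : g c <= sup S by apply: ub_le_sup; [case: Sh|exists c].
  by rewrite /g ler_pdivrMr//; lra.
- rewrite c0' mulr0 add0r; apply: a'pos; rewrite /C'/= -c0' tuple_etaE//.
Qed.

(** A supporting functional of the difference set. The normalisation involves all coefficients, [b]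
    included: it survives limits and also covers an empty set, which is separated by a constant. *)
Lemma separation n (A B : set (n.-tuple R)) : Defs.convex_set A -> Defs.convex_set B ->
  A `&` B = set0 ->
  exists (a : n.-tuple R) (b : R),
    [/\ (forall i, `|tnth a i| <= 1), `|b| <= 1, 1 <= \sum_(i < n) `|tnth a i| + `|b|,
      forall x, A x -> 0 <= dot a x + b & forall y, B y -> dot a y + b <= 0].
Proof.
move=> cA cB AB.
pose z : n.-tuple R := [tuple 0 | _ < n].
have dotz x : dot z x = 0.
  by rewrite /dot big1// => i _; rewrite tnth_mktuple mul0r.
have sumz : \sum_(i < n) `|tnth z i| = 0.
  by rewrite big1// => i _; rewrite tnth_mktuple normr0.
have [A0|/set0P[x0 Ax0]] := eqVneq A set0.
  exists z, (-1); rewrite sumz normrN1 add0r; split=> //.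
  - by move=> i; rewrite tnth_mktuple normr0.
  - by rewrite A0.
  - by move=> y _; rewrite dotz add0r lerN10.
have [B0|/set0P[y0 By0]] := eqVneq B set0.
  exists z, 1; rewrite sumz normr1 add0r; split=> //.
  - by move=> i; rewrite tnth_mktuple normr0.
  - by move=> y _; rewrite dotz add0r ler01.
  - by rewrite B0.
pose dif (x y : n.-tuple R) : n.-tuple R := [tuple tnth x i - tnth y i | i < n].
have dot_dif a x y : dot a (dif x y) = dot a x - dot a y.
  rewrite /dot -sumrB; apply: eq_bigr => i _; by rewrite tnth_mktuple mulrBr.
pose C : set (n.-tuple R) := [set c | exists x y, [/\ A x, B y & c = dif x y]].
have cC : Defs.convex_set C.
  move=> _ _ l [x [y [Ax By ->]]] [x' [y' [Ax' By' ->]]] l01.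
  exists (tlerp l x x'), (tlerp l y y'); split; [exact: cA|exact: cB|].
  by apply: eq_from_tnth => i; rewrite !tnth_mktuple; ring.
have Cn : C !=set0 by exists (dif x0 y0), x0, y0.
have C0 : ~ C z.
  move=> [x [y [Ax By E]]]; have xy : x = y.
    apply: eq_from_tnth => i; have := congr1 (fun t => tnth t i) E.
    by rewrite !tnth_mktuple => /esym/eqP; rewrite subr_eq0 => /eqP.
  by have : set0 x by rewrite -AB; split => //; rewrite xy.
have [a [i0 ai0] apos] := support_functional cC Cn C0.
have hab x y : A x -> B y -> dot a y <= dot a x.
  by move=> Ax By; rewrite -subr_ge0 -dot_dif; apply: apos; exists x, y.
pose S : set R := [set dot a y | y in B].
have Sn : S !=set0 by exists (dot a y0), y0.
have Sh : has_sup S by split=> //; exists (dot a x0) => _ [y By <-]; exact: hab.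
pose b := - sup S.
pose N := \sum_(i < n) `|tnth a i| + `|b|.
have N0 : 0 < N.
  rewrite /N (bigD1 i0)//= -addrA ltr_pwDl ?normr_gt0// addr_ge0//.
  by rewrite sumr_ge0.
exists [tuple tnth a i / N | i < n], (b / N).
have dotN x : dot [tuple tnth a i / N | i < n] x + b / N = (dot a x + b) / N.
  rewrite mulrDl; congr (_ + _); rewrite /dot mulr_suml; apply: eq_bigr => i _.
  by rewrite tnth_mktuple mulrAC.
have NE : `|N| = N by rewrite gtr0_norm.
split.
- move=> i; rewrite tnth_mktuple normf_div NE ler_pdivrMr// mul1r.
  rewrite /N (bigD1 i)//= -addrA lerDl addr_ge0// sumr_ge0//.
- by rewrite normf_div NE ler_pdivrMr// mul1r lerDr sumr_ge0.
- under eq_bigr do rewrite tnth_mktuple normf_div NE.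
  by rewrite normf_div NE -mulr_suml -mulrDl divff// gt_eqF.
- move=> x Ax; rewrite dotN divr_ge0 ?(ltW N0)// subr_ge0.
  by apply: ge_sup => // _ [y By <-]; exact: hab.
- move=> y By; rewrite dotN pmulr_lle0 ?invr_gt0// subr_le0.
  by apply: ub_le_sup; [case: Sh|exists y].
Qed.

Lemma bolzano_weierstrass_family (I : finType) (v : nat -> I -> R) :
  (forall n i, `|v n i| <= 1) ->
  exists2 phi : nat -> nat, {homo phi : n m / (n < m)%N} &
    forall i, cvgn (fun n => v (phi n) i).
Proof.
move=> v1.
suff H (l : seq I) : exists2 phi : nat -> nat, {homo phi : n m / (n < m)%N} &
    forall i, i \in l -> cvgn (fun n => v (phi n) i).
  have [phi h1 h2] := H (enum I); exists phi => // i; apply: h2.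
  by rewrite mem_enum.
elim: l => [|i l [phi h1 h2]]; first by exists id.
have bf : bounded_fun (fun n => v (phi n) i).
  by exists 1; split => // y y1 n _ /=; exact: le_trans (v1 _ _) (ltW y1).
have [psi hpsi cpsi] := bolzano_weierstrass bf.
have hpsi' : {homo psi : n m / (n < m)%N}.
  move=> n m nm; rewrite ltnNge; apply/negP => mn.
  by have := hpsi m n; rewrite !leEnat mn => /esym; rewrite leqNgt nm.
exists (phi \o psi) => [n m nm /=|j]; first by apply: h1; exact: hpsi'.
rewrite inE => /orP[/eqP ->//|jl].
have := h2 j jl => /cvg_ex[a ha]; apply/cvg_ex; exists a.
have : (fun n => v (phi n) j) \o psi @ \oo --> a.
  apply: (cvg_comp _ _ _ ha).
  move=> P [N _ hN]; exists N => // n /= Nn; apply: hN => /=.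
  apply: leq_trans Nn _; elim: n => [//|n IHn].
  by apply: leq_ltn_trans IHn _; exact: hpsi'.
by [].
Qed.

Lemma fin_eventually (I : finType) (P : I -> nat -> Prop) :
  (forall i, exists N, forall n, (N <= n)%N -> P i n) ->
  exists N, forall n, (N <= n)%N -> forall i, P i n.
Proof.
move=> h; have [N hN] := choice h; exists (\max_i N i)%N => n Nn i.
by apply: hN; apply: leq_trans Nn; exact: leq_bigmax.
Qed.

End Separation.

Section QuantizerCompactness.
Context {R : realType} {dim M : nat}.
Local Notation X := (dim.-tuple R).

(** Indices with zero normal are excluded: their affine form is constant and its zero set is no
    hyperplane. *)
Definition hyperplanes (I : finType) (a : I -> X) (b : I -> R) : set X :=
  [set x | exists i, (exists k, tnth (a i) k != 0) /\ dot (a i) x + b i = 0].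

Lemma hyperplanes_null (I : finType) (a : I -> X) (b : I -> R) :
  measurable (hyperplanes a b) /\
  forall p : {measure set X -> \bar R}, hyperplane_null p -> p (hyperplanes a b) = 0%E.
Proof.
pose H i := if pselect (exists k, tnth (a i) k != 0) then [set x | dot (a i) x + b i == 0] else set0.
have mH i : measurable (H i).
  rewrite /H; case: pselect => ai; [exact: (measurable_hyperplane (a i) (b i))|exact: measurable0].
have -> : hyperplanes a b = \big[setU/set0]_(i : I) H i.
  rewrite -bigcup_seq; apply/seteqP; split => [x [i [ai xi]]|x [i _]].
    by exists i => //=; [rewrite mem_index_enum|rewrite /H; case: pselect => // ai'; apply/eqP].
  by rewrite /H; case: pselect => // ai /eqP xi; exists i.
apply: (big_ind (fun S => measurable S /\ forall p : {measure set X -> \bar R},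
    hyperplane_null p -> p S = 0%E)) => [|S T [mS pS] [mT pT]|i _].
- by split=> // p _; exact: measure0.
- split; first exact: measurableU.
  move=> p hp; apply/eqP; rewrite eq_le measure_ge0 andbT.
  by apply: (le_trans (measureU2 _ mS mT)); rewrite [X in (X + _)%E]pS// [X in (_ + X)%E]pT// adde0.
- split=> // p hp; rewrite /H; case: pselect => ai; last exact: measure0.
  exact: hp.
Qed.

Lemma cvg_dot (a : nat -> X) (b : nat -> R) (la : X) (lb : R) (x : X) :
  (forall k, (fun n => tnth (a n) k) @ \oo --> tnth la k) -> b @ \oo --> lb ->
  (fun n => dot (a n) x + b n) @ \oo --> dot la x + lb.
Proof.
move=> ha hb; apply: cvgD => //; apply: cvg_big => //; first by apply: add_continuous.
move=> k _; apply: cvgM; [exact: ha|exact: cvg_cst].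
Qed.

Lemma cvg_eventually_gt0 (u : nat -> R) (l : R) : u @ \oo --> l -> 0 < l ->
  exists N, forall n, (N <= n)%N -> 0 < u n.
Proof.
by move=> ul l0; have [N _ hN] := cvgr_gt l ul 0 l0; exists N.
Qed.

Lemma cvg_eventually_lt0 (u : nat -> R) (l : R) : u @ \oo --> l -> l < 0 ->
  exists N, forall n, (N <= n)%N -> u n < 0.
Proof.
by move=> ul l0; have [N _ hN] := cvgr_lt l ul 0 l0; exists N.
Qed.

(* Normalised separators of each pair of cells converge along a subsequence. Points on a limiting
   hyperplane are sorted by a generic direction, which keeps the limiting cells convex. *)
Lemma cquant_compact (p0 : probability X R) (Q : nat -> @cquant R dim M) :
  hyperplane_null p0 ->
  exists phi : nat -> nat, exists Qoo : @cquant R dim M, exists Z : set X,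
  [/\ {homo phi : n m / (n < m)%N}, measurable Z,
     (forall p : {measure set X -> \bar R}, hyperplane_null p -> p Z = 0%E) &
     forall x, ~ Z x -> exists N, forall n, (N <= n)%N -> sval (Q (phi n)) x = sval Qoo x].
Proof.
move=> hp0.
pose P : finType := ('I_M * 'I_M)%type.
(* Only pairs with [ij.1 < ij.2] carry information; the others receive the constant form 1, so that
   the normalisation holds for the whole family. *)
have sepQ n (ij : P) : exists t : X * R,
    [/\ (forall k, `|tnth t.1 k| <= 1), `|t.2| <= 1, 1 <= \sum_(k < dim) `|tnth t.1 k| + `|t.2| &
      (ij.1 < ij.2)%N -> (forall x, sval (Q n) x = ij.1 -> 0 <= dot t.1 x + t.2) /\
        (forall x, sval (Q n) x = ij.2 -> dot t.1 x + t.2 <= 0)].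
  case: ij => i j /=.
  have [mi ci] := proj2_sig (Q n) i; have [mj cj] := proj2_sig (Q n) j.
  have [ij|ij] := boolP (i < j)%N; last first.
    exists ([tuple 0 | _ < dim], 1) => /=; split => //.
    - by move=> k; rewrite tnth_mktuple normr0.
    - by rewrite normr1.
    - by rewrite normr1 lerDr sumr_ge0.
  have dij : cell (sval (Q n)) i `&` cell (sval (Q n)) j = set0.
    apply/seteqP; split => // x []; rewrite /cell/= => -> E.
    by move: ij; rewrite E ltnn.
  have [a [b [h1 h2 h3 h4 h5]]] := separation ci cj dij.
  by exists (a, b); split.
have [th hth] := choice (fun nij : nat * P => sepQ nij.1 nij.2).
pose v n (w : P * option 'I_dim) : R :=
  if w.2 is Some k then tnth (th (n, w.1)).1 k else (th (n, w.1)).2.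
have v1 n w : `|v n w| <= 1.
  by case: w => ij [k|]; rewrite /v/=; case: (hth (n, ij)).
have [phi hphi cphi] := bolzano_weierstrass_family v1.
have phi_ge n : (n <= phi n)%N.
  by elim: n => [//|n IHn]; apply: leq_ltn_trans IHn _; exact: hphi.
pose La (ij : P) : X := [tuple limn (fun n => v (phi n) (ij, Some k)) | k < dim].
pose Lb (ij : P) : R := limn (fun n => v (phi n) (ij, None)).
have cvgL ij x : (fun n => dot (th (phi n, ij)).1 x + (th (phi n, ij)).2) @ \oo -->
    dot (La ij) x + Lb ij.
  apply: cvg_dot; last exact: cphi.
  by move=> k; rewrite tnth_mktuple; exact: cphi.
(* The normalisation passes to the limit, so a limiting form with zero normal is a nonzero
   constant. *)
have nz ij : 1 <= \sum_(k < dim) `|tnth (La ij) k| + `|Lb ij|.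
  have h : (fun n => \sum_(k < dim) `|tnth (th (phi n, ij)).1 k| + `|(th (phi n, ij)).2|) @ \oo -->
     \sum_(k < dim) `|tnth (La ij) k| + `|Lb ij|.
    apply: cvgD; last by apply: cvg_norm; exact: cphi.
    apply: cvg_big => //; first by apply: add_continuous.
    by move=> k _; apply: cvg_norm; rewrite tnth_mktuple; exact: cphi.
  rewrite -(cvg_lim (@Rhausdorff R) h); apply: limr_ge; first by apply/cvg_ex; eexists; exact: h.
  by near=> n; case: (hth (phi n, ij)).
pose l ij x := dot (La ij) x + Lb ij.
have [vv hvv] : exists vv : X, forall ij, (exists k, tnth (La ij) k != 0) -> dot (La ij) vv != 0.
  have [mH pH] := hyperplanes_null La (fun=> 0).
  apply: contrapT => hn; have HT : hyperplanes La (fun=> 0) = setT.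
    apply/seteqP; split => // x _; apply: contrapT => hx; apply: hn; exists x => ij hij.
    by apply/negP => /eqP e; apply: hx; exists ij; split => //; rewrite e addr0.
  have E := pH p0 hp0; rewrite HT in E.
  have /eqP : (1 = 0 :> \bar R)%E := etrans (esym (probability_setT p0)) E.
  by rewrite onee_eq0.
have Ldeg ij : ~ (exists k, tnth (La ij) k != 0) -> forall x, l ij x != 0.
  move=> hz x; have La0 k : tnth (La ij) k = 0.
    by apply/eqP/negP => /negP h; apply: hz; exists k.
  have s1 : \sum_(k < dim) `|tnth (La ij) k| = 0.
    by apply: big1 => k _; rewrite La0 normr0.
  have s2 : dot (La ij) x = 0 by apply: big1 => k _; rewrite La0 mul0r.
  by have := nz ij; rewrite /l s1 s2 !add0r -normr_gt0; apply: lt_le_trans.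
(* The sign of the limiting form, a tie being broken as if [x] were moved slightly along [vv]. *)
pose pos ij x := (0 < l ij x) || ((l ij x == 0) && (0 < dot (La ij) vv)).
(* [i] wins at [x] when [x] lies on the side of [i] in every comparison; the limiting quantizer
   sends [x] to its winner. *)
pose win x (i : 'I_M) := [forall j : 'I_M, ((i < j)%N ==> pos (i, j) x) && ((j < i)%N ==> ~~ pos (j, i) x)].
have win_uniq x i j : win x i -> win x j -> i = j.
  move=> /forallP wi /forallP wj; apply/val_inj/eqP.
  have [ij|ij|//] := ltngtP i j.
    have /andP[/implyP/(_ ij) h _] := wi j; have /andP[_ /implyP/(_ ij)] := wj i.
    by rewrite h.
  have /andP[_ /implyP/(_ ij) h] := wi j; have /andP[/implyP/(_ ij)] := wj i.
  by rewrite (negbTE h).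
have l_dir ij x t : l ij [tuple tnth x k + t * tnth vv k | k < dim] = l ij x + t * dot (La ij) vv.
  rewrite /l addrAC; congr (_ + _); rewrite /dot mulr_sumr -big_split/=.
  by apply: eq_bigr => k _; rewrite tnth_mktuple; ring.
have win_lim x : (forall ij : P, l ij x != 0) -> exists N, forall n, (N <= n)%N ->
    win x (sval (Q (phi n)) x).
  move=> lx.
  have [N hN] : exists N, forall n, (N <= n)%N -> forall ij : P,
     (0 < l ij x -> 0 < dot (th (phi n, ij)).1 x + (th (phi n, ij)).2) /\
     (l ij x < 0 -> dot (th (phi n, ij)).1 x + (th (phi n, ij)).2 < 0).
    apply: fin_eventually => ij; have [h|h|h] := ltgtP (l ij x) 0.
    - by have [N hN] := cvg_eventually_lt0 (@cvgL ij x) h; exists N => n /hN.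
    - by have [N hN] := cvg_eventually_gt0 (@cvgL ij x) h; exists N => n /hN.
    - by have := lx ij; rewrite h eqxx.
  exists N => n /hN {}hN; apply/forallP => j; set i := sval _ _.
  apply/andP; split; apply/implyP => ij.
    have [_ _ _ /(_ ij) [h _]] := hth (phi n, (i, j)).
    have [_ hneg] := hN (i, j).
    rewrite /pos; have [h0|h0|h0] := ltgtP (l (i, j) x) 0 => //=.
      by have := hneg h0; rewrite ltNge h.
    by have := lx (i, j); rewrite h0 eqxx.
  have [_ _ _ /(_ ij) [_ h]] := hth (phi n, (j, i)).
  have [hpos _] := hN (j, i).
  rewrite /pos (negbTE (lx (j, i))) orbF -leNgt leNgt; apply/negP => /hpos.
  by rewrite ltNge h.
(* At a point [x'] moved slightly along [vv] no form vanishes and all signs are those of [pos] at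
   [x]. The symbols actually assigned to [x'] eventually win there, hence also at [x]. *)
have win_ex x : exists i, win x i.
  have [N hN] : exists N, forall n, (N <= n)%N -> forall ij : P,
     if pos ij x then 0 < l ij x + n.+1%:R^-1 * dot (La ij) vv
     else l ij x + n.+1%:R^-1 * dot (La ij) vv < 0.
    apply: fin_eventually => ij.
    have hc : (fun n => l ij x + n.+1%:R^-1 * dot (La ij) vv) @ \oo --> l ij x.
      rewrite -[X in _ --> X]addr0 -(mul0r (dot (La ij) vv)).
      apply: cvgD; first exact: cvg_cst.
      by apply: cvgM; [exact: cvg_harmonic|exact: cvg_cst].
    rewrite /pos; have [h|h|h] := ltgtP (l ij x) 0 => /=.
    - exact: cvg_eventually_lt0 hc h.
    - exact: cvg_eventually_gt0 hc h.
    - exists 0%N => n _; rewrite h add0r.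
      have hij : exists k, tnth (La ij) k != 0.
        by apply: contrapT => hz; have := Ldeg _ hz x; rewrite h eqxx.
      have := hvv _ hij; rewrite neq_lt => /orP[hd|hd].
        by rewrite ltNge (ltW hd) /= pmulr_rlt0// invr_gt0.
      by rewrite hd mulr_gt0// invr_gt0.
  pose x' := [tuple tnth x k + N.+1%:R^-1 * tnth vv k | k < dim].
  have sgn ij : (0 < l ij x') = pos ij x /\ l ij x' != 0.
    have := hN N (leqnn N) ij; rewrite l_dir; case: (pos ij x) => h.
      by rewrite h gt_eqF.
    by rewrite lt_eqF// ltNge ltW.
  have [N' hN'] := win_lim x' (fun ij => (sgn ij).2).
  exists (sval (Q (phi N')) x'); have := hN' N' (leqnn _).
  move=> /forallP h; apply/forallP => j; have := h j.
  have pE ij : pos ij x' = pos ij x.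
    by have [<- h2] := sgn ij; rewrite /pos (negbTE h2) orbF.
  by rewrite !pE.
have [Qf hQf] := choice win_ex.
have QfE i x : (Qf x = i) <-> win x i.
  split => [<-//|wi]; exact: win_uniq (hQf x) wi.
have ml ij : measurable_fun setT (l ij).
  by apply: measurable_funD => //; exact: measurable_dot.
have mpos ij : measurable [set x | pos ij x].
  rewrite (_ : [set x | pos ij x] = (l ij @^-1` [set y | 0 < y]) `|`
     (l ij @^-1` [set 0] `&` [set _ | 0 < dot (La ij) vv])); last first.
    apply/seteqP; split => x /=; rewrite /pos.
      by move=> /orP[|/andP[/eqP]]; [left|right].
    by move=> [->//|[-> ->]]; rewrite eqxx orbT.
  apply: measurableU.
    rewrite -(setTI (_ @^-1` _)); apply: ml => //.
    by rewrite -set_itvoy; exact: measurable_itv.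
  apply: measurableI; first by rewrite -(setTI (_ @^-1` _)); exact: ml.
  by case: (0 < _); [rewrite (_ : [set _ | _] = setT)|rewrite (_ : [set _ | _] = set0)];
    rewrite //; apply/seteqP; split.
have cpos ij x y t : 0 <= t <= 1 -> pos ij x = pos ij y -> pos ij (tlerp t x y) = pos ij x.
  move=> /andP[t0 t1]; have lE : l ij (tlerp t x y) = t * l ij x + (1 - t) * l ij y.
    by rewrite /l dot_tlerp; ring.
  rewrite /pos lE; have [->|tn0] := eqVneq t 0; first by rewrite mul0r add0r subr0 mul1r.
  have tp : 0 < t by rewrite lt_neqAle eq_sym tn0.
  have [->|tn1] := eqVneq t 1; first by rewrite subrr mul0r addr0 mul1r.
  have tq : 0 < 1 - t by rewrite subr_gt0 lt_neqAle tn1.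
  case: (0 < dot _ _); rewrite ?andbT ?andbF ?orbF.
  - have E (c : R) : (0 < c) || (c == 0) = (0 <= c) by rewrite orbC eq_sym -le_eqVlt.
    rewrite !E; have [h|h] := leP 0 (l ij x) => /esym.
      by move=> h'; rewrite addr_ge0// mulr_ge0// ltW.
    move=> /negbT; rewrite -ltNge => h'; apply/negbTE; rewrite -ltNge.
    by rewrite -[ltRHS]addr0 ltrD// pmulr_rlt0.
  - have [h|h] := ltP 0 (l ij x) => /esym.
      by move=> h'; rewrite addr_gt0// mulr_gt0.
    move=> /negbT; rewrite -leNgt => h'; apply/negbTE; rewrite -leNgt.
    by rewrite -[leRHS]addr0 lerD// pmulr_rle0.
have cQf : convex_quantizer Qf.
  move=> i; split.
    rewrite (_ : Qf @^-1` [set i] = \bigcap_(j in [set: 'I_M])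
      ([set x | (i < j)%N ==> pos (i, j) x] `&` [set x | (j < i)%N ==> ~~ pos (j, i) x])).
      apply: fin_bigcap_measurable => // j _; apply: measurableI.
        case: (i < j)%N => /=; first exact: mpos.
        by rewrite (_ : [set _ | _] = setT)//; apply/seteqP; split.
      case: (j < i)%N => /=; last by rewrite (_ : [set _ | _] = setT)//; apply/seteqP; split.
      rewrite (_ : [set x | _] = ~` [set x | pos (j, i) x]); first exact: measurableC.
      by apply/seteqP; split => x /= /negP.
    apply/seteqP; split => x /=.
      by move=> /QfE /forallP h j _; have /andP[] := h j.
    move=> h; apply/QfE/forallP => j; have [h1 h2] := h j I.
    by apply/andP; split.
  move=> x y t /= /QfE/forallP hx /QfE/forallP hy t01; apply/QfE/forallP => j.
  have /andP[/implyP hx1 /implyP hx2] := hx j; have /andP[/implyP hy1 /implyP hy2] := hy j.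
  apply/andP; split; apply/implyP => ij.
    by rewrite cpos// hx1// hy1.
  by rewrite cpos// ?(negbTE (hx2 ij)) ?(negbTE (hy2 ij)).
have [mZ pZ] := hyperplanes_null La Lb.
exists phi, (exist _ Qf cQf), (hyperplanes La Lb); split => // x nZ.
have lx ij : l ij x != 0.
  have [hij|] := pselect (exists k, tnth (La ij) k != 0); last by move=> /Ldeg.
  by apply/negP => /eqP h; apply: nZ; exists ij.
have [N hN] := win_lim x lx; exists N => n /hN /= wn.
by apply/esym/QfE.
Unshelve. all: by end_near. Qed.

End QuantizerCompactness.

(** * The optimality inequality in the limit of vanishing discount *)

Section Truncation.
Local Open Scope ereal_scope.
Context {R : realType} {dim : nat}.
Local Notation X := (dim.-tuple R).
Local Notation BS := (giry X R).

Definition tsq (r : R) (u x : X) : \bar R := (Num.min (sqdist x u) r)%:E.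

Lemma measurable_tsq r u : measurable_fun setT (tsq r u).
Proof.
apply/measurable_EFinP; apply: measurable_minr => //.
by apply/measurable_EFinP; exact: measurable_sqdist.
Qed.

Lemma tsq_ge0 r u x : (0 <= r)%R -> 0 <= tsq r u x.
Proof. by move=> r0; rewrite lee_fin le_min r0 sqdist_ge0. Qed.

Lemma tsq_le r u x : tsq r u x <= r%:E.
Proof. by rewrite lee_fin ge_min lexx orbT. Qed.

Lemma tsq_le_sqdist r u x : tsq r u x <= (sqdist x u)%:E.
Proof. by rewrite lee_fin ge_min lexx. Qed.

(* Minimising centres of the truncated costs stay bounded as soon as the cell has positive mass,
   so a limit point and Fatou's lemma exchange the infimum over centres with the truncation. *)
Lemma cost0_truncation (p : BS) (D : set X) (K eps : R) : measurable D -> (0 < eps)%R ->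
  exists2 r : R, (0 <= r)%R & forall u : X,
    mine (cost0 p D) K%:E <= \int[p]_(x in D) tsq r u x + eps%:E.
Proof.
move=> mD eps0.
have int0 r u : (0 <= r)%R -> 0 <= \int[p]_(x in D) tsq r u x.
  by move=> r0; apply: integral_ge0 => x _; exact: tsq_ge0.
have [K0|K0] := ltP K 0%R.
  exists 0%R => // u; apply: (@le_trans _ _ 0).
    by rewrite ge_min lee_fin (ltW K0) orbT.
  by rewrite adde_ge0// ?lee_fin ?(ltW eps0)// int0.
apply: contrapT => hn.
have /choice[u hu] : forall j : nat, exists u : X,
    \int[p]_(x in D) tsq j%:R u x + eps%:E < mine (cost0 p D) K%:E.
  move=> j; apply: contrapT => hj; apply: hn; exists j%:R => // u.
  by rewrite leNgt; apply/negP => h; apply: hj; exists u.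
have pD0 : p D != 0.
  apply/negP => /eqP pD; have := hu 0%N; apply/negP; rewrite -leNgt.
  apply: (@le_trans _ _ 0); last by rewrite adde_ge0// ?lee_fin ?(ltW eps0)// int0.
  rewrite ge_min; apply/orP; left.
  apply: le_trans (cost0_le _ _) _; rewrite null_set_integral//.
  by apply: measurable_funTS; exact: measurable_sqnorm.
have bcvg : (fun n => p (D `&` @box R dim n%:R)) @ \oo --> p D.
  have -> : p D = p (\bigcup_n (D `&` @box R dim n%:R)).
    congr (p _); apply/seteqP; split => [x Dx|x [n _ []]//].
    exists (Num.truncn (\sum_(i < dim) `|tnth x i|)).+1 => //; split => // i.
    apply: le_trans (ltW (Num.Theory.truncnS_gt _)).
    by rewrite (bigD1 i)//= lerDl sumr_ge0.
  apply: nondecreasing_cvg_mu.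
  - by move=> n; apply: measurableI => //; exact: measurable_box.
  - by apply: bigcupT_measurable => n; apply: measurableI => //; exact: measurable_box.
  - move=> n m nm; apply/subsetPset => x [Dx bx]; split => // i.
    by apply: le_trans (bx i) _; rewrite ler_nat.
have [n0 pn0] : exists n : nat, 0 < p (D `&` @box R dim n%:R).
  apply: contrapT => hb; have h0 n : p (D `&` @box R dim n%:R) = 0.
    apply/eqP; rewrite eq_le measure_ge0 andbT leNgt; apply/negP => h.
    by apply: hb; exists n.
  move: bcvg; rewrite (_ : (fun n => _) = cst 0); last by apply/funext.
  move=> /(cvg_lim (@ereal_hausdorff R)); rewrite lim_cst; last exact: ereal_hausdorff.
  by move=> E; move: pD0; rewrite -E eqxx.
pose Bx := D `&` @box R dim n0%:R.
have mBx : measurable Bx by apply: measurableI => //; exact: measurable_box.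
have pBf : p Bx \is a fin_num by exact: fin_num_measure.
pose eta := fine (p Bx).
have eta0 : (0 < eta)%R by rewrite fine_gt0// pn0 ltey_eq pBf.
(* Chosen so that [K < eta * a]: since [1 <= a], a centre farther than [a] in some coordinate from a
   box of mass [eta] would cost more than [K]. *)
pose a := (K / eta + 1)%R.
have a1 : (1 <= a)%R by rewrite /a lerDr divr_ge0// ltW.
have aK : (K < eta * a)%R by rewrite /a mulrDr mulrCA divff ?gt_eqF// mulr1 ltrDl mulr1.
pose j0 := (Num.truncn a).+1.
pose B := (n0%:R + a)%R.
have B0 : (0 < B)%R by rewrite /B ltr_wpDl// (lt_le_trans _ a1).
have ub j i : (j0 <= j)%N -> (`|tnth (u j) i| <= B)%R.
  move=> jj; rewrite leNgt; apply/negP => hB.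
  have aj : (a <= j%:R)%R.
    by apply: le_trans (ltW (Num.Theory.truncnS_gt _)) _; rewrite ler_nat.
  have tb x : Bx x -> a%:E <= tsq j%:R (u j) x.
    move=> [_ bx]; rewrite lee_fin le_min aj andbT.
    apply: (@le_trans _ _ ((tnth x i - tnth (u j) i) ^+ 2)%R); last first.
      by rewrite /sqdist (bigD1 i)//= lerDl sumr_ge0// => l _; exact: sqr_ge0.
    have h : (a <= `|tnth x i - tnth (u j) i|)%R.
      rewrite distrC; apply: le_trans (lerB_dist _ _); move: (bx i) hB.
      by rewrite /B; lra.
    rewrite -real_normK ?num_real//; apply: (le_trans h).
    by rewrite expr2 ler_peMr// (le_trans a1 h).
  have : K%:E < \int[p]_(x in D) tsq j%:R (u j) x.
    apply: (@lt_le_trans _ _ (\int[p]_(x in Bx) a%:E)).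
      have -> : \int[p]_(x in Bx) a%:E = (a * eta)%:E.
        by rewrite integral_cst// [RHS]EFinM fineK.
      by rewrite lte_fin mulrC.
    apply: (@le_trans _ _ (\int[p]_(x in Bx) tsq j%:R (u j) x)).
      apply: ge0_le_integral_nonmeasurable => // x _; rewrite lee_fin; lra.
    apply: ge0_subset_integral => //.
    - by apply: measurable_funTS; exact: measurable_tsq.
    - by move=> x _; exact: tsq_ge0.
    - by move=> x [].
  apply/negP; rewrite -leNgt.
  apply: (@le_trans _ _ (\int[p]_(x in D) tsq j%:R (u j) x + eps%:E)).
    by rewrite leeDl// lee_fin ltW.
  by apply: (le_trans (ltW (hu j))); rewrite ge_min lexx orbT.
pose v n (i : 'I_dim) := (tnth (u (n + j0)%N) i / B)%R.
have v1 n i : (`|v n i| <= 1)%R.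
  by rewrite /v normrM normfV (gtr0_norm B0) ler_pdivrMr// mul1r ub// leq_addl.
have [phi hphi cphi] := bolzano_weierstrass_family v1.
have phi_ge n : (n <= phi n)%N.
  by elim: n => [//|n IHn]; apply: leq_ltn_trans IHn _; exact: hphi.
pose uu : X := [tuple (limn (fun n => v (phi n) i) * B)%R | i < dim].
pose w n := u (phi n + j0)%N.
pose rr n : R := (phi n + j0)%:R%R.
have wc i : (fun n => tnth (w n) i) @ \oo --> tnth uu i.
  rewrite tnth_mktuple.
  rewrite (_ : (fun n => _) = (fun n => v (phi n) i * B)%R); last first.
    by apply/funext => n; rewrite /v divfK// gt_eqF.
  by apply: cvgM; [exact: cphi|exact: cvg_cst].
have sc x : (fun n => sqdist x (w n)) @ \oo --> sqdist x uu.
  apply: cvg_big => //; first by apply: add_continuous.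
  move=> i _; rewrite (_ : (fun n => _) = (fun n =>
    (tnth x i - tnth (w n) i) * (tnth x i - tnth (w n) i))%R); last first.
    by apply/funext => n; rewrite expr2.
  by rewrite expr2; apply: cvgM; (apply: cvgB; [exact: cvg_cst|exact: wc]).
have tc x : (fun n => tsq (rr n) (w n) x) @ \oo --> (sqdist x uu)%:E.
  have h1 : (fun n => (sqdist x (w n))%:E) @ \oo --> (sqdist x uu)%:E.
    by apply: cvg_EFin; [near=> n|exact: sc].
  have s1 : (sqdist x uu < sqdist x uu + 1)%R by rewrite ltrDl.
  have [N _ hN] := cvgr_lt _ (@sc x) _ s1.
  apply: cvg_trans h1; apply: near_eq_cvg.
  exists (maxn N (Num.truncn (sqdist x uu + 1)%R).+1) => // n /=; rewrite geq_max => /andP[Nn tn].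
  rewrite /tsq min_l//; apply: ltW; apply: lt_le_trans (hN n Nn) _.
  apply: le_trans (ltW (Num.Theory.truncnS_gt _)) _; rewrite ler_nat.
  apply: leq_trans tn _; apply: leq_trans (phi_ge n) _; exact: leq_addr.
have rr0 n : (0 <= rr n)%R by rewrite /rr.
have F := @fatou _ _ _ p D mD (fun n => tsq (rr n) (w n)).
have {F} : \int[p]_(x in D) limn_einf (fun n => tsq (rr n) (w n) x) <=
    limn_einf (fun n => \int[p]_(x in D) tsq (rr n) (w n) x).
  apply: F => [n|n x _]; first by apply: measurable_funTS; exact: measurable_tsq.
  exact: tsq_ge0.
under eq_integral do rewrite (cvg_limn_einf_sup (tc _)).1.
move=> F.
have cf : mine (cost0 p D) K%:E \is a fin_num.
  rewrite ge0_fin_numE; last by rewrite le_min cost0_ge0 lee_fin.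
  by rewrite gt_min ltry orbT.
have : mine (cost0 p D) K%:E <= mine (cost0 p D) K%:E - eps%:E.
  apply: (@le_trans _ _ (cost0 p D)); first by rewrite ge_min lexx.
  apply: (@le_trans _ _ (\int[p]_(x in D) (sqdist x uu)%:E)).
    by apply: ereal_inf_lbound; exists uu.
  apply: le_trans F _; rewrite limn_einf_lim; apply: lime_le.
    exact: is_cvg_einfs.
  near=> n; apply: (@le_trans _ _ (\int[p]_(x in D) tsq (rr n) (w n) x)).
    by apply: ereal_inf_lbound; exists n => /=.
  by rewrite leeBrDr//; exact: ltW (hu _).
move: cf; case: (mine _ _) => // z _; rewrite -EFinB lee_fin; lra.
Unshelve. all: by end_near. Qed.

End Truncation.

(** * Joint lower limits of costs and relative values *)

Section OptimalityInequality.
Local Open Scope ereal_scope.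
Context {R : realType} {dim k M : nat}.
Local Notation X := (dim.-tuple R).
Local Notation W := (k.-tuple R).
Local Notation BS := (giry X R).
Local Notation cquant := (@cquant R dim M).
Variables (f : X -> W -> X) (nu : probability W R).
Hypothesis mf : measurable_fun [set: (X * W)%type] (fun z => f z.1 z.2).
Local Notation updq := (updq nu mf).

Definition unit_fun (psi : X -> \bar R) :=
  measurable_fun setT psi /\ forall x, 0 <= psi x <= 1.

(** Closeness in total variation, tested by functions with values in [[0, 1]], a class stable under
    [markov_op] and under restriction to cells. The two masses may differ. *)
Definition tv_close (p q : BS) (eps : R) := forall psi, unit_fun psi ->
  \int[p]_x psi x <= \int[q]_x psi x + eps%:E /\
  \int[q]_x psi x <= \int[p]_x psi x + eps%:E.

Definition disagree (Q Q' : X -> 'I_M) : set X := [set x | Q x <> Q' x].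

Lemma measurable_disagree (Q Q' : cquant) : measurable (disagree (sval Q) (sval Q')).
Proof.
rewrite (_ : disagree _ _ = \bigcup_(i in [set: 'I_M])
    (cell (sval Q) i `&` ~` cell (sval Q') i)).
  apply: fin_bigcup_measurable => // i _; apply: measurableI; first exact: measurable_cell.
  by apply: measurableC; exact: measurable_cell.
apply/seteqP; split => x /=; first by move=> h; exists (sval Q x) => //; split => //= /esym.
by move=> [i _ [h1 h2]] h; apply: h2; rewrite /cell/= -h.
Qed.

Lemma unit_patch (Q : cquant) i psi : unit_fun psi -> unit_fun (psi \_ (cell (sval Q) i)).
Proof.
move=> [mpsi h]; split => [|x]; last by rewrite /patch; case: ifP => _; [exact: h|rewrite lexx lee01].
apply/(measurable_restrictT _ (measurable_cell Q i)); exact: measurable_funTS.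
Qed.

(** Exchanging the quantizers costs at most the mass of the points where they disagree, and this
    mass is measured under the limit law [q] alone. *)
Lemma tv_close_cell (p q : BS) eps eta (Q Q' : cquant) i psi : tv_close p q eps ->
  q (disagree (sval Q) (sval Q')) <= eta%:E -> unit_fun psi ->
  \int[p]_(x in cell (sval Q) i) psi x <=
    \int[q]_(x in cell (sval Q') i) psi x + (eps + eta)%:E /\
  \int[q]_(x in cell (sval Q') i) psi x <=
    \int[p]_(x in cell (sval Q) i) psi x + (eps + eta)%:E.
Proof.
move=> pq qD upsi.
have swap (Q1 Q2 : cquant) : q (disagree (sval Q1) (sval Q2)) <= eta%:E ->
    \int[q]_(x in cell (sval Q1) i) psi x <= \int[q]_(x in cell (sval Q2) i) psi x + eta%:E.
  move=> qD12; rewrite integral_mkcond [X in _ <= X + _]integral_mkcond.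
  have [m1 h1] := unit_patch Q1 i upsi; have [m2 h2] := unit_patch Q2 i upsi.
  have mD := measurable_disagree Q1 Q2.
  have mI : measurable_fun setT (fun x : X => (\1_(disagree (sval Q1) (sval Q2)) x)%:E : \bar R).
    by apply/measurable_EFinP; exact: measurable_indic.
  apply: (@le_trans _ _ (\int[q]_x ((psi \_ (cell (sval Q2) i)) x +
      (\1_(disagree (sval Q1) (sval Q2)) x)%:E))); last first.
    rewrite ge0_integralD//; last by move=> x _; have /andP[] := h2 x.
    by rewrite integral_indic// setIT leeD2l.
  apply: ge0_le_integral_nonmeasurable => x _; first by have /andP[] := h1 x.
  have /andP[p0 p1] := upsi.2 x.
  rewrite /patch indicE; case: (pselect (sval Q1 x = sval Q2 x)) => E.
    have -> : (x \in cell (sval Q1) i) = (x \in cell (sval Q2) i).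
      by apply/idP/idP; rewrite !inE /cell/= E.
    by rewrite leeDl// lee_fin.
  rewrite (mem_set (E : disagree _ _ x)).
  apply: (@le_trans _ _ 1); first by case: ifP.
  by rewrite leeDr//; case: ifP.
have sym : disagree (sval Q') (sval Q) = disagree (sval Q) (sval Q').
  by apply/seteqP; split => x /=; rewrite /disagree/= => h h'; apply: h.
split.
  apply: (@le_trans _ _ (\int[q]_(x in cell (sval Q) i) psi x + eps%:E)).
    rewrite integral_mkcond [X in _ <= X + _]integral_mkcond.
    exact: (pq _ (unit_patch Q i upsi)).1.
  rewrite (_ : (eps + eta)%:E = eta%:E + eps%:E); last by rewrite -EFinD addrC.
  by rewrite addeA leeD2r// swap.
apply: (@le_trans _ _ (\int[q]_(x in cell (sval Q) i) psi x + eta%:E)).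
  by apply: swap; rewrite sym.
rewrite EFinD addeA leeD2r// integral_mkcond [X in _ <= X + _]integral_mkcond.
exact: (pq _ (unit_patch Q i upsi)).2.
Qed.

Lemma unit_markov_op psi : unit_fun psi -> unit_fun (markov_op f nu psi).
Proof.
move=> [mpsi h]; have h0 x : 0 <= psi x by case/andP: (h x).
split; first exact: measurable_markov_op.
move=> x; rewrite markov_op_ge0//= -[leRHS](markov_op_cst f nu 1 x); apply: markov_op_le => // y.
by case/andP: (h y).
Qed.

Lemma tv_close_updq (p q : BS) eps eta (Q Q' : cquant) i : tv_close p q eps ->
  q (disagree (sval Q) (sval Q')) <= eta%:E ->
  tv_close (updq p (sval Q) i) (updq q (sval Q') i) (eps + eta).
Proof.
move=> pq qD psi upsi.
have h0 x : 0 <= psi x by case/andP: (upsi.2 x).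
rewrite !int_updq//; try exact: upsi.1.
exact: tv_close_cell pq qD (unit_markov_op upsi).
Qed.

Lemma disagree_cvg0 (q : BS) (Q : nat -> cquant) (Q' : cquant) (Z : set X) :
  measurable Z -> q Z = 0 ->
  (forall x, ~ Z x -> exists N, forall n, (N <= n)%N -> sval (Q n) x = sval Q' x) ->
  forall eps : R, (0 < eps)%R -> exists N, forall n, (N <= n)%N ->
    q (disagree (sval (Q n)) (sval Q')) <= eps%:E.
Proof.
move=> mZ qZ hQ eps eps0.
pose D n := disagree (sval (Q n)) (sval Q').
have mD n : measurable (D n) by exact: measurable_disagree.
have mZ' : measurable (~` Z) by exact: measurableC.
have hc : (\int[q]_(x in ~` Z) (\1_(D n) x)%:E)%E @[n --> \oo] --> \int[q]_(x in ~` Z) (cst 0 x).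
  apply: (@dominated_cvg _ _ _ q (~` Z) mZ' _ _ (cst 1)) => //.
  - by move=> n; apply/measurable_EFinP; exact: measurable_indic.
  - move=> x nZ; have [N hN] := hQ x nZ.
    apply: cvg_near_cst; exists N => // n Nn /=.
    by rewrite indicE memNset//= /D /disagree/= => h; apply: h; exact: hN.
  - exact: finite_measure_integrable_cst.
  - by move=> n x _; rewrite gee0_abs ?lee_fin// indicE; case: (_ \in _).
rewrite integral0 in hc.
have hD n : q (D n) = \int[q]_(x in ~` Z) (\1_(D n) x)%:E.
  rewrite integral_indic//; apply/eqP; rewrite eq_le; apply/andP; split; last first.
    by apply: le_measure; rewrite ?inE//; exact: measurableI.
  rewrite -[leRHS]adde0 -qZ.
  apply: (@le_trans _ _ (q ((D n `&` ~` Z) `|` Z))); last first.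
    by apply: measureU2 => //; exact: measurableI.
  apply: le_measure; rewrite ?inE//; first by apply: measurableU => //; exact: measurableI.
  by move=> x Dx; have [Zx|nZx] := pselect (Z x); [right|left].
have hfin : (fun n => fine (q (D n))) @ \oo --> 0%R.
  by apply: fine_cvg; rewrite (_ : (fun n => q (D n)) = fun n => \int[q]_(x in ~` Z) (\1_(D n) x)%:E)//;
    apply/funext.
have [N _ hN] := cvgr_lt _ hfin eps eps0.
exists N => n /hN /= h; have qf : q (D n) \is a fin_num by exact: fin_num_measure.
by rewrite -(fineK qf) lee_fin ltW.
Qed.

(* [le_liminf a l] states [l <= liminf a] in a form stable under finite sums of nonnegative terms. *)
Definition le_liminf (a : nat -> \bar R) (l : \bar R) := forall K eps : R,
  (0 <= K)%R -> (0 < eps)%R ->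
  exists N, forall n, (N <= n)%N -> mine l K%:E <= a n + eps%:E.

Lemma mine_add (l l' : \bar R) (K : R) : (0 <= K)%R -> 0 <= l -> 0 <= l' ->
  mine (l + l') K%:E <= mine l K%:E + mine l' K%:E.
Proof.
move=> K0 l0 l0'.
have [h|h] := leP l K%:E; have [h'|h'] := leP l' K%:E.
- by rewrite ge_min lexx.
- by rewrite ge_min; apply/orP; right; rewrite leeDr.
- by rewrite ge_min; apply/orP; right; rewrite leeDl.
- by rewrite ge_min; apply/orP; right; rewrite leeDl// lee_fin.
Qed.

Lemma le_liminf_add (a b : nat -> \bar R) (l l' : \bar R) : 0 <= l -> 0 <= l' ->
  le_liminf a l -> le_liminf b l' -> le_liminf (fun n => a n + b n) (l + l').
Proof.
move=> l0 l0' ha hb K eps K0 eps0; have e2 : (0 < eps / 2)%R by rewrite divr_gt0.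
have [N1 h1] := ha K _ K0 e2; have [N2 h2] := hb K _ K0 e2.
exists (maxn N1 N2) => n; rewrite geq_max => /andP[n1 n2].
apply: le_trans (mine_add K0 l0 l0') _.
rewrite (_ : eps%:E = (eps / 2)%:E + (eps / 2)%:E); last first.
  by rewrite -EFinD; congr (_%:E); lra.
by rewrite addeACA; apply: leeD; [exact: h1|exact: h2].
Qed.

Lemma le_liminf_sum (a : 'I_M -> nat -> \bar R) (l : 'I_M -> \bar R) : (forall i, 0 <= l i) ->
  (forall i, le_liminf (a i) (l i)) -> le_liminf (fun n => \sum_(i < M) a i n) (\sum_(i < M) l i).
Proof.
move=> l0 h.
suff gen (r : seq 'I_M) : le_liminf (fun n => \sum_(i <- r) a i n) (\sum_(i <- r) l i) by exact: gen.
elim: r => [|i r IH].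
  move=> K eps K0 eps0; exists 0%N => n _; rewrite !big_nil add0e.
  by rewrite ge_min lee_fin (ltW eps0).
rewrite (_ : (fun n => _) = (fun n => a i n + \sum_(j <- r) a j n)); last first.
  by apply/funext => n; rewrite big_cons.
by rewrite big_cons; apply: le_liminf_add => //; apply: sume_ge0.
Qed.

Lemma le_liminf_le (a : nat -> \bar R) (l : \bar R) (L : R) (b : nat -> R) : (0 <= L)%R -> le_liminf a l ->
  (forall n, a n <= (L + b n)%:E) -> b @ \oo --> 0%R -> l <= L%:E.
Proof.
move=> L0 la ab b0.
suff : forall e, (0 < e)%R -> mine l (L + 1)%:E <= (L + e)%:E.
  move=> h; have : mine l (L + 1)%:E <= L%:E.
    by apply/lee_addgt0Pr => e e0; rewrite -EFinD; exact: h.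
  by rewrite ge_min => /orP[//|]; rewrite lee_fin gerDl ler10.
move=> e e0; have e2 : (0 < e / 2)%R by rewrite divr_gt0.
have L1 : (0 <= L + 1)%R by lra.
have [N1 h1] := la (L + 1)%R _ L1 e2.
have [N2 _ h2] := cvgr_lt _ b0 _ e2.
have := h1 _ (leq_maxl N1 N2); have := h2 _ (leq_maxr N1 N2); set n := maxn _ _.
move=> /= bn /le_trans; apply; apply: (@le_trans _ _ ((L + b n)%:E + (e / 2)%:E)).
  by apply: leeD.
by rewrite -EFinD lee_fin; lra.
Qed.

Variables (beta : nat -> R) (h : nat -> BS -> \bar R) (theta : R) (s : X -> \bar R).
Hypothesis beta01 : forall n, (0 < beta n < 1)%R.
Hypothesis beta1 : beta @ \oo --> (1%R : R).
Hypothesis theta0 : (0 <= theta)%R.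
Hypothesis us : unit_fun s.
Hypothesis h0 : forall n p, 0 <= h n p.
Hypothesis h_scale : forall n (c : R) p q, (0 <= c)%R -> is_mix c 0 p q q -> c%:E * h n q <= h n p.
Hypothesis h_lower : forall n (p : BS) (eps : R), (0 < eps)%R -> exists Q : cquant,
  qcost p (sval Q) + (beta n)%:E * \sum_(i < M) h n (updq p (sval Q) i) <=
    h n p + theta%:E * \int[p]_x s x + eps%:E.

(** The infimum runs over late discount factors and close beliefs at once, with tolerance and index
    tied to the same [N]. Lower semicontinuity of the limit in total variation thus holds by
    construction. *)
Definition hinf (N : nat) (p : BS) : \bar R :=
  ereal_inf [set h n.1 n.2 | n in [set n : nat * BS | (N <= n.1)%N /\ tv_close n.2 p (N.+1%:R^-1)]].

Definition limit_value (p : BS) : \bar R := ereal_sup (range (hinf ^~ p)).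

Lemma tv_close_refl (p : BS) eps : (0 <= eps)%R -> tv_close p p eps.
Proof. by move=> e0 psi _; split; rewrite leeDl. Qed.

Lemma tv_close_le (p q : BS) e e' : (e <= e')%R -> tv_close p q e -> tv_close p q e'.
Proof.
move=> ee pq psi /pq[h1 h2]; split.
  by apply: (le_trans h1); rewrite leeD2l// lee_fin.
by apply: (le_trans h2); rewrite leeD2l// lee_fin.
Qed.

Lemma limit_value_ge0 p : 0 <= limit_value p.
Proof.
apply: (@le_trans _ _ (hinf 0 p)); last by apply: ereal_sup_ubound; exists 0%N.
by apply: le_ereal_inf_tmp => _ [n _ <-]; exact: h0.
Qed.

Lemma limit_value_le p (c : \bar R) : (forall N, exists n q, [/\ (N <= n)%N,
   tv_close q p (N.+1%:R^-1) & h n q <= c]) -> limit_value p <= c.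
Proof.
move=> hc; apply: ge_ereal_sup => _ [N _ <-].
have [n [q [Nn nq hq]]] := hc N.
by apply: ge_ereal_inf; exists (h n q) => //; exists (n, q).
Qed.

Lemma limit_value_attained (p : BS) : limit_value p < +oo -> forall N, exists n q, [/\ (N <= n)%N,
  tv_close q p (N.+1%:R^-1) & h n q <= limit_value p + (N.+1%:R^-1)%:E].
Proof.
move=> Hfin N.
have hN : hinf N p <= limit_value p by apply: ereal_sup_ubound; exists N.
have hf : hinf N p \is a fin_num.
  rewrite ge0_fin_numE; first exact: le_lt_trans Hfin.
  by apply: le_ereal_inf_tmp => _ [n _ <-]; exact: h0.
have e0 : (0 < N.+1%:R^-1 :> R)%R by rewrite invr_gt0.
have [_ [[n q] /= [Nn nq] <-] hlt] := lb_ereal_inf_adherent e0 hf.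
exists n, q; split => //; apply: (le_trans (ltW hlt)).
exact: leeD.
Qed.

Lemma le_liminf_limit_value (p : BS) (n_ : nat -> nat) (q_ : nat -> BS) :
  (forall N, exists K, forall j, (K <= j)%N -> (N <= n_ j)%N) ->
  (forall eps, (0 < eps)%R -> exists K, forall j, (K <= j)%N -> tv_close (q_ j) p eps) ->
  le_liminf (fun j => (beta (n_ j))%:E * h (n_ j) (q_ j)) (limit_value p).
Proof.
move=> hn hq K eps K0 eps0.
have [N hN] : exists N, mine (limit_value p) K%:E <= hinf N p + (eps / 2)%:E.
  have [HK|HK] := leP (limit_value p) K%:E.
    have Hf : limit_value p \is a fin_num.
      by rewrite ge0_fin_numE ?limit_value_ge0//; apply: le_lt_trans HK _; rewrite ltry.
    have e2 : (0 < eps / 2)%R by rewrite divr_gt0.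
    have [_ [N _ <-] hlt] := ub_ereal_sup_adherent e2 Hf.
    by exists N; rewrite -leeBlDr// ltW.
  have [_ [N _ <-] hlt] := ereal_sup_gt HK.
  by exists N; apply: (le_trans (ltW hlt)); rewrite leeDl// lee_fin divr_ge0// ltW.
have [K1 hK1] := hn N.
have N0 : (0 < N.+1%:R^-1 :> R)%R by rewrite invr_gt0.
have [K2 hK2] := hq _ N0.
(* [beta] times a quantity at least [min(limit_value, K)] loses at most [(1 - beta) K] *)
have [K3 hK3] : exists K3, forall n, (K3 <= n)%N -> ((1 - beta n) * K <= eps / 2)%R.
  have hb : (fun n => (1 - beta n) * K)%R @ \oo --> ((1 - 1) * K)%R.
    by apply: cvgM; [apply: cvgB => //; exact: cvg_cst|exact: cvg_cst].
  rewrite subrr mul0r in hb.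
  have e2 : (0 < eps / 2)%R by rewrite divr_gt0.
  have [K3 _ hK3] := cvgr_lt _ hb _ e2.
  by exists K3 => n /hK3 /ltW.
have [K4 hK4] := hn K3.
exists (maxn (maxn K1 K2) K4) => j; rewrite !geq_max => /andP[/andP[j1 j2] j4].
have hinfle : hinf N p <= h (n_ j) (q_ j).
  by apply: ereal_inf_lbound; exists (n_ j, q_ j) => //=; split; [exact: hK1|exact: hK2].
have [b0 b1] := andP (beta01 (n_ j)).
have bK := hK3 _ (hK4 _ j4).
have : mine (limit_value p) K%:E <= h (n_ j) (q_ j) + (eps / 2)%:E.
  by apply: (le_trans hN); rewrite leeD2r.
have : 0 <= mine (limit_value p) K%:E by rewrite le_min limit_value_ge0 lee_fin.
have : mine (limit_value p) K%:E <= K%:E by rewrite ge_min lexx orbT.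
case: (mine _ _) => [x| |]//; case: (h _ _) => [y| |]//.
  rewrite -EFinM -!EFinD !lee_fin => xK x0 xy.
  have := ler_wpM2l (ltW b0) xy; rewrite mulrDr.
  have : ((1 - beta (n_ j)) * x <= (1 - beta (n_ j)) * K)%R by rewrite ler_wpM2l// subr_ge0 ltW.
  have : (beta (n_ j) * (eps / 2) <= eps / 2)%R.
    by rewrite -[leRHS]mul1r ler_wpM2r// ?divr_ge0// ltW.
  move: bK; rewrite !mulrBl !mul1r; lra.
by move=> _ _ _; rewrite gt0_muley ?lte_fin// addye// leey.
Qed.

(** Truncated costs are bounded, so they pass to the limit in total variation uniformly in the
    centre; [cost0_truncation] compares them with the cost itself. *)
Lemma le_liminf_cost0 (p : BS) (Q : cquant) (i : 'I_M) (q_ : nat -> BS) (Q_ : nat -> cquant) :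
  (forall eps, (0 < eps)%R -> exists K, forall j, (K <= j)%N -> tv_close (q_ j) p eps) ->
  (forall eps, (0 < eps)%R -> exists K, forall j, (K <= j)%N ->
     p (disagree (sval (Q_ j)) (sval Q)) <= eps%:E) ->
  le_liminf (fun j => cost0 (q_ j) (cell (sval (Q_ j)) i)) (cost0 p (cell (sval Q) i)).
Proof.
move=> hq hQ K eps K0 eps0; have e2 : (0 < eps / 2)%R by rewrite divr_gt0.
have mQ := measurable_cell Q i.
have [r r0 hr] := cost0_truncation p K mQ e2.
have r1 : (0 < r + 1)%R by rewrite ltr_wpDl.
(* With this choice [(r + 1) * (d + d)] equals [eps / 2]; [r + 1] replaces [r], which may vanish. *)
pose d := (eps / 2 / (r + 1) / 2)%R.
have d0 : (0 < d)%R by rewrite !divr_gt0.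
have [K1 hK1] := hq _ d0; have [K2 hK2] := hQ _ d0.
exists (maxn K1 K2) => j; rewrite geq_max => /andP[j1 j2].
have mQj := measurable_cell (Q_ j) i.
rewrite -leeBlDr//; apply: le_ereal_inf_tmp => _ [u _ <-]; rewrite leeBlDr//.
apply: (le_trans (hr u)).
pose psi x := ((r + 1)^-1)%:E * tsq r u x.
have upsi : unit_fun psi.
  split; first by apply: measurable_funeM; exact: measurable_tsq.
  move=> x; apply/andP; split.
    by apply: mule_ge0; [rewrite lee_fin invr_ge0 ltW|exact: tsq_ge0].
  apply: (@le_trans _ _ (((r + 1)^-1)%:E * (r + 1)%:E)).
    apply: lee_wpmul2l; first by rewrite lee_fin invr_ge0 ltW.
    by apply: (le_trans (tsq_le _ _ _)); rewrite lee_fin lerDl.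
  by rewrite -EFinM mulVf// gt_eqF.
have psiE (D : set X) (q : BS) : measurable D ->
    \int[q]_(x in D) tsq r u x = (r + 1)%:E * \int[q]_(x in D) psi x.
  move=> mD; rewrite ge0_integralZl_EFin// ?invr_ge0 ?(ltW r1)//.
  - by rewrite muleA -EFinM divff ?gt_eqF// mul1e.
  - by move=> x _; exact: tsq_ge0.
  - by apply: measurable_funTS; exact: measurable_tsq.
have [_ H2] := tv_close_cell i (hK1 _ j1) (hK2 _ j2) upsi.
rewrite (psiE _ p)//.
apply: (@le_trans _ _ ((r + 1)%:E * (\int[q_ j]_(x in cell (sval (Q_ j)) i) psi x + (d + d)%:E)
    + (eps / 2)%:E)).
  by rewrite leeD2r// lee_wpmul2l// lee_fin ltW.
rewrite muleDr//; last first.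
  by apply: ge0_adde_def; rewrite inE ?lee_fin ?addr_ge0 ?(ltW d0)//;
    apply: integral_ge0 => x _; have /andP[] := upsi.2 x.
rewrite -psiE// -addeA; apply: leeD.
  by apply: ge0_le_integral_nonmeasurable => x _; [exact: tsq_ge0|exact: tsq_le_sqdist].
rewrite -EFinM -EFinD lee_fin le_eqVlt; apply/orP; left; apply/eqP.
by rewrite /d; field; rewrite gt_eqF.
Qed.

(** Near-minimisers of [hinf] and near-optimal quantizers for them are taken for each [N]. Along a
    subsequence the quantizers converge off a [p]-null set, and since all terms are nonnegative
    their lower limits add up. The probability [p0] supplies the generic direction for compactness,
    as [p] may have mass 0. *)
Lemma limit_value_optimality (p0 : probability X R) (p : BS) : hyperplane_null p0 ->
  hyperplane_null p -> limit_value p < +oo -> exists Q : cquant,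
  qcost p (sval Q) + \sum_(i < M) limit_value (updq p (sval Q) i) <= limit_value p + theta%:E * \int[p]_x s x.
Proof.
move=> hp0 hp Hfin.
have /choice[nq hnq] : forall N, exists z : nat * BS, [/\ (N <= z.1)%N,
    tv_close z.2 p (N.+1%:R^-1) & h z.1 z.2 <= limit_value p + (N.+1%:R^-1)%:E].
  by move=> N; have [n [q hq]] := limit_value_attained Hfin N; exists (n, q).
have e0 N : (0 < N.+1%:R^-1 :> R)%R by rewrite invr_gt0.
have /choice[Qn hQn] : forall N, exists Q : cquant,
    qcost (nq N).2 (sval Q) + (beta (nq N).1)%:E * \sum_(i < M) h (nq N).1 (updq (nq N).2 (sval Q) i) <=
    h (nq N).1 (nq N).2 + theta%:E * \int[(nq N).2]_x s x + (N.+1%:R^-1)%:E.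
  by move=> N; exact: h_lower.
have [phi [Q [Z [hphi mZ nullZ QZ]]]] := cquant_compact Qn hp0.
have phi_ge n : (n <= phi n)%N.
  by elim: n => [//|n IHn]; apply: leq_ltn_trans IHn _; exact: hphi.
have hQD := disagree_cvg0 mZ (nullZ p hp) QZ.
have htv eps : (0 < eps)%R -> exists K, forall j, (K <= j)%N -> tv_close (nq (phi j)).2 p eps.
  move=> eps0; have [K _ hK] := near_infty_natSinv_lt (PosNum eps0).
  exists K => j Kj; have [_ + _] := hnq (phi j); apply: tv_close_le.
  by apply: ltW; apply: hK => /=; exact: leq_trans Kj (phi_ge j).
have hn N : exists K, forall j, (K <= j)%N -> (N <= (nq (phi j)).1)%N.
  exists N => j Nj; have [+ _ _] := hnq (phi j); apply: leq_trans.
  exact: leq_trans Nj (phi_ge j).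
have int_s (q : BS) : \int[q]_x s x \is a fin_num.
  apply: (sub_int_fin q (c := 1)) => // x; by have /andP[] := us.2 x.
have Hf : limit_value p \is a fin_num by rewrite ge0_fin_numE ?limit_value_ge0.
pose L := (fine (limit_value p) + theta * fine (\int[p]_x s x))%R.
have LE : limit_value p + theta%:E * \int[p]_x s x = L%:E.
  by rewrite /L EFinD EFinM !fineK.
have L0 : (0 <= L)%R.
  rewrite addr_ge0 ?fine_ge0 ?limit_value_ge0// mulr_ge0// fine_ge0// integral_ge0// => x _.
  by have /andP[] := us.2 x.
exists Q; rewrite LE.
pose a (i : 'I_M) j := cost0 (nq (phi j)).2 (cell (sval (Qn (phi j))) i).
pose b (i : 'I_M) j := (beta (nq (phi j)).1)%:E *
  h (nq (phi j)).1 (updq (nq (phi j)).2 (sval (Qn (phi j))) i).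
apply: (le_liminf_le (a := fun j => \sum_(i < M) a i j + \sum_(i < M) b i j)
  (b := fun j => ((theta + 2) * (phi j).+1%:R^-1)%R)) => //.
- apply: le_liminf_add.
  + by apply: sume_ge0 => i _; exact: cost0_ge0.
  + by apply: sume_ge0 => i _; exact: limit_value_ge0.
  + apply: le_liminf_sum => [i|i]; first exact: cost0_ge0.
    exact: le_liminf_cost0.
  + apply: le_liminf_sum => [i|i]; first exact: limit_value_ge0.
    apply: le_liminf_limit_value => // eps eps0; have e2 : (0 < eps / 2)%R by rewrite divr_gt0.
    have [K1 hK1] := htv _ e2; have [K2 hK2] := hQD _ e2.
    exists (maxn K1 K2) => j; rewrite geq_max => /andP[j1 j2].
    rewrite (_ : eps = (eps / 2 + eps / 2)%R); last by lra.
    by apply: tv_close_updq; [exact: hK1|exact: hK2].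
- move=> j; set N := phi j.
  have [_ tvN hN] := hnq N.
  have -> : \sum_(i < M) b i j = (beta (nq N).1)%:E *
      \sum_(i < M) h (nq N).1 (updq (nq N).2 (sval (Qn N)) i).
    by rewrite ge0_sume_distrr// => i _; exact: h0.
  apply: (le_trans (hQn N)).
  apply: (@le_trans _ _ (limit_value p + (N.+1%:R^-1)%:E + theta%:E * (\int[p]_x s x + (N.+1%:R^-1)%:E)
      + (N.+1%:R^-1)%:E)).
    rewrite leeD2r//; apply: leeD => //; apply: lee_wpmul2l; first by rewrite lee_fin.
    exact: (tvN _ us).1.
  have -> : limit_value p + (N.+1%:R^-1)%:E + theta%:E * (\int[p]_x s x + (N.+1%:R^-1)%:E) +
      (N.+1%:R^-1)%:E = (L + (theta + 2) * N.+1%:R^-1)%:E.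
    have sE := fineK (int_s p); have HE := fineK Hf; rewrite /L.
    move: (fine _) (fine _) sE HE => a1 a2 <- <-.
    by rewrite -[X in _ * X]EFinD -[X in _ + X + _]EFinM -!EFinD; congr (_%:E); ring.
  exact: lexx.
- rewrite -[X in _ --> X](mulr0 (theta + 2)%R).
  apply: cvgM; first exact: cvg_cst.
  have := @cvg_harmonic R => hc; apply: (cvg_comp phi _ _ hc).
  by move=> P [N _ hN]; exists N => // n /= Nn; apply: hN => /=; exact: leq_trans Nn (phi_ge n).
Qed.

End OptimalityInequality.

(** * Normalised beliefs and homogeneity of the limit *)

Section Normalize.
Local Open Scope ereal_scope.
Context {R : realType} {dim : nat}.
Local Notation X := (dim.-tuple R).
Local Notation BS := (giry X R).

(** A belief of mass 0 becomes the Dirac mass at [point]; [mul_normalize] holds in that case as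
    well. *)
Definition normalize (p : BS) : BS := mnormalize p (\d_(point : X)).

Lemma normalize_mass (p : BS) : normalize p setT = 1.
Proof. exact: probability_setT. Qed.

Lemma mass_fin (p : BS) : p setT \is a fin_num.
Proof. exact: fin_num_measure. Qed.

Lemma normalizeE (p : BS) E : p setT != 0 -> normalize p E = (fine (p setT))^-1%:E * p E.
Proof.
move=> p0; rewrite /normalize/= /mnormalize/= (negbTE p0)/=.
by have /fin_numPlt/andP[_ /lt_eqF ->] := mass_fin p; rewrite muleC.
Qed.

Lemma mass_gt0 (p : BS) : p setT != 0 -> (0 < fine (p setT))%R.
Proof.
move=> p0; rewrite fine_gt0// lt_neqAle eq_sym p0 measure_ge0/=.
by have /fin_numPlt/andP[] := mass_fin p.
Qed.

Lemma mul_normalize (p : BS) E : measurable E -> p setT * normalize p E = p E.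
Proof.
move=> mE; have [p0|p0] := eqVneq (p setT) 0.
  rewrite p0 mul0e; apply/esym/eqP; rewrite eq_le measure_ge0 andbT -p0.
  by rewrite le_measure// ?inE.
rewrite normalizeE// -{1}(fineK (mass_fin p)) muleA -EFinM divff ?mul1e//.
by rewrite gt_eqF// mass_gt0.
Qed.

Lemma is_mix_normalize (p : BS) : is_mix (fine (p setT)) 0 p (normalize p) (normalize p).
Proof. by move=> E mE; rewrite mul0e adde0 fineK ?mass_fin// mul_normalize. Qed.

Lemma measurable_normalize : measurable_fun setT normalize.
Proof.
apply: measurable_giry_codensity => // B mB.
rewrite (_ : normalize^~ B = fun p => if giry_ev p setT == 0 then \d_(point : X) B else
    (fine (giry_ev p setT))^-1%:E * giry_ev p B); last first.
  apply/funext => p; rewrite /giry_ev; case: ifPn => [/eqP p0|p0]; last exact: normalizeE.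
  by rewrite /normalize/= /mnormalize/= p0 eqxx.
have mT := @measurable_giry_ev _ X R setT measurableT.
have mB' := @measurable_giry_ev _ X R B mB.
apply: measurable_fun_if => //.
- apply: (@measurable_fun_bool _ _ _ _ true); rewrite setTI.
  rewrite (_ : _ @^-1` _ = (giry_ev^~ setT) @^-1` [set 0]).
    by rewrite -[X in measurable X]setTI; apply: mT => //; exact: emeasurable_set1.
  by apply/seteqP; split => p /= /eqP.
- apply: emeasurable_funM; last exact: measurable_funTS.
  apply/measurable_EFinP; rewrite setTI.
  apply: (@measurable_comp _ _ _ _ _ _ [set r : R | r != 0%R]).
  + exact: open_measurable.
  + move=> /= _ [p /= p0 <-]; rewrite gt_eqF// mass_gt0//.
    by case: eqVneq p0.
  + apply: open_continuous_measurable_fun => //; apply/in_setP => x /= x0.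
    exact: inv_continuous.
  + by apply: measurableT_comp => //; exact: measurable_funTS.
Qed.

(** Weaker than equality: measures are functions on all sets and may differ on sets that are not
    measurable. *)
Definition agree (p q : BS) := forall E, measurable E -> p E = q E.

Lemma agree_int p q (h : X -> \bar R) : agree p q -> \int[p]_x h x = \int[q]_x h x.
Proof. exact: int_eq_on. Qed.

Lemma agree_tv_close (p q q' : BS) e : agree q q' -> tv_close p q e -> tv_close p q' e.
Proof. by move=> qq h psi upsi; rewrite -(agree_int _ qq); exact: h. Qed.

Lemma is_mix_inv (c : R) (p q : BS) : (0 < c)%R -> is_mix c 0 p q q -> is_mix c^-1 0 q p p.
Proof.
move=> c0 h E mE; rewrite h// !mul0e !adde0 muleA -EFinM mulVf ?mul1e//.
by rewrite gt_eqF.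
Qed.

Lemma exists_scaled (p : BS) (c : R) : (0 < c)%R -> p setT <= c%:E ->
  exists q : BS, is_mix c 0 p q q.
Proof.
move=> c0 pc; have ci0 : (0 <= c^-1)%R by rewrite invr_ge0 ltW.
pose mu : {measure set X -> \bar R} := mscale (NngNum ci0) p.
have mu1 : mu [set: X] <= 1.
  rewrite /mu/= /mscale/=; apply: (@le_trans _ _ ((c^-1)%:E * c%:E)).
    by apply: lee_wpmul2l; rewrite ?lee_fin.
  by rewrite -EFinM mulVf// gt_eqF.
pose q := HB.pack_for (subprobability X R) (Measure.sort mu)
  (Measure_isSubProbability.Build _ _ _ (Measure.sort mu) mu1).
exists q => E mE; rewrite mul0e adde0 /q/= /mscale/= muleA -EFinM divff ?mul1e//.
by rewrite gt_eqF.
Qed.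

End Normalize.

Section LimitHomogeneity.
Local Open Scope ereal_scope.
Context {R : realType} {dim : nat}.
Local Notation X := (dim.-tuple R).
Local Notation BS := (giry X R).
Variables (h : nat -> BS -> \bar R).
Hypothesis h0 : forall n p, 0 <= h n p.
Hypothesis h_scale : forall n (c : R) p q, (0 <= c)%R -> is_mix c 0 p q q -> c%:E * h n q <= h n p.

Lemma unit_int_fin (p : BS) psi : unit_fun psi -> \int[p]_x psi x \is a fin_num.
Proof.
move=> [mpsi u]; apply: (sub_int_fin p (c := 1)) => // x; by have /andP[] := u x.
Qed.

Lemma is_mix_int (c : R) (p q : BS) psi : (0 <= c)%R -> is_mix c 0 p q q -> unit_fun psi ->
  \int[p]_x psi x = c%:E * \int[q]_x psi x.
Proof.
move=> c0 mix [mpsi u]; rewrite (int_mix c0 (lexx 0%R) mix)//; last first.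
  by move=> x _; have /andP[] := u x.
by rewrite mul0e adde0.
Qed.

(** Dividing [q] by [w] could give a mass above 1, hence the divisor [c], the larger of [w] and the
    mass of [q]. It exceeds [w] by at most [e], which accounts for the second [e] in the
    tolerance. *)
Lemma tv_close_scale (w : R) (u v q : BS) (e : R) : (0 < w)%R -> v setT = 1 ->
  is_mix w 0 u v v -> tv_close q u e -> exists q', exists2 c : R, (w <= c)%R &
  is_mix c 0 q q' q' /\ tv_close q' v (2 * e / w).
Proof.
move=> w0 v1 uv qu; pose c := Num.max w (fine (q setT)).
have wc : (w <= c)%R by rewrite le_max lexx.
have c0 : (0 < c)%R by exact: lt_le_trans wc.
have qc : q setT <= c%:E by rewrite -(fineK (mass_fin q)) lee_fin le_max lexx orbT.
have [q' mix] := exists_scaled c0 qc; exists q', c => //; split => // psi upsi.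
have u1 : unit_fun (cst 1 : X -> \bar R) by split => // x; rewrite lexx lee01.
have int1 (p : BS) : \int[p]_x (cst 1 x) = p setT by rewrite integral_cst// mul1e.
have v0 : \int[v]_x psi x <= 1.
  by rewrite -v1 -int1; apply: ge0_le_integral_nonmeasurable => x _; have /andP[] := upsi.2 x.
have vp : 0 <= \int[v]_x psi x by apply: integral_ge0 => x _; have /andP[] := upsi.2 x.
have q0 : 0 <= \int[q']_x psi x by apply: integral_ge0 => x _; have /andP[] := upsi.2 x.
have q1 : \int[q']_x psi x <= 1.
  apply: (@le_trans _ _ (q' setT)); last exact: sprobability_setT.
  by rewrite -int1; apply: ge0_le_integral_nonmeasurable => x _; have /andP[] := upsi.2 x.
have [A1 A2] := qu _ u1; have [B1 B2] := qu _ upsi.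
have E1 := is_mix_int (ltW w0) uv upsi; have E2 := is_mix_int (ltW c0) mix upsi.
rewrite E1 E2 in B1 B2; rewrite !int1 in A1 A2.
rewrite uv// v1 mul0e adde0 mule1 in A1 A2.
have cE : (c <= w + e)%R.
  rewrite ge_max; apply/andP; split.
    have : 0 <= e%:E.
      have := A1; have := A2; rewrite -(fineK (mass_fin q)) -!EFinD !lee_fin; lra.
    by rewrite lee_fin lerDl.
  by have := A1; rewrite -(fineK (mass_fin q)) -EFinD lee_fin.
move: vp q0 q1 v0 B1 B2; rewrite -(fineK (unit_int_fin v upsi)) -(fineK (unit_int_fin q' upsi)).
move: (fine _) (fine _) => a b; rewrite -!EFinM -!EFinD !lee_fin => a0 b0 b1 a1 B1 B2.
have K : (2 * e / w * w = 2 * e)%R by rewrite divfK// gt_eqF.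
have bc : (b * (c - w) <= c - w)%R by rewrite ler_piMl// subr_ge0.
have bc0 : (0 <= b * (c - w))%R by rewrite mulr_ge0// subr_ge0.
by split; rewrite -(ler_pM2r w0) mulrDl K; nra.
Qed.

(** Near-minimisers for [u] are rescaled into competitors for [v], by a factor at least [w]. *)
Lemma limit_value_scale (w : R) (u v : BS) : (0 < w)%R -> v setT = 1 -> is_mix w 0 u v v ->
  w%:E * limit_value h v <= limit_value h u.
Proof.
move=> w0 v1 uv; have := limit_value_ge0 h0 u; case Hu : (limit_value h u) => [a| |]// a0; last by rewrite leey.
rewrite muleC -lee_pdivlMr//; apply/lee_addgt0Pr => eps eps0.
apply: limit_value_le => N.
have Hfin : limit_value h u < +oo by rewrite Hu ltry.
(* The first bound keeps the error [e / w] below [eps], the second brings the tolerance [2 * e / w]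
   below that of level [N]. *)
pose d := (Num.min (eps * w) (w / (2 * N.+1%:R)))%R.
have d0 : (0 < d)%R by rewrite lt_min !(mulr_gt0, divr_gt0).
have [K _ hK] := near_infty_natSinv_lt (PosNum d0).
have [n [q [Kn tv hn]]] := limit_value_attained h0 Hfin (maxn K N).
have := hK _ (leq_maxl K N) => /=; set e := (_^-1)%R in tv hn *; rewrite lt_min => /andP[e1 e2].
have [q' [c wc [mix tv']]] := tv_close_scale w0 v1 uv tv.
exists n, q'; split; first exact: leq_trans (leq_maxr _ _) Kn.
  apply: tv_close_le tv'; rewrite ler_pdivrMr//.
  move: e2; rewrite ltr_pdivlMr ?mulr_gt0// => e2.
  rewrite -(ler_pM2r (_ : 0 < N.+1%:R)%R)//.
  rewrite [leRHS]mulrAC mulVf ?mul1r ?pnatr_eq0//; lra.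
have c0 : (0 < c)%R by exact: lt_le_trans wc.
have h1 := le_trans (h_scale n (ltW c0) mix) hn.
rewrite Hu -EFinD in h1; rewrite -EFinM -EFinD.
have := h0 n q'; move: h1; case: (h n q') => [y| |]//; last first.
  by rewrite gt0_muley ?lte_fin.
rewrite -EFinM !lee_fin => h1 y0; rewrite -(ler_pM2r w0) mulrDl divfK ?gt_eqF//.
have : (y * w <= c * y)%R by rewrite mulrC ler_wpM2r.
lra.
Qed.

Lemma limit_value_agree p q : agree p q -> limit_value h p = limit_value h q.
Proof.
have le (a b : BS) : agree a b -> limit_value h a <= limit_value h b.
  move=> ab; apply: ge_ereal_sup => _ [N _ <-].
  apply: (@le_trans _ _ (hinf h N b)); last by apply: ereal_sup_ubound; exists N.
  apply: le_ereal_inf_tmp => _ [[n c] /= [Nn tv] <-]; apply: ereal_inf_lbound.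
  exists (n, c) => //=; split => //; apply: agree_tv_close tv => E mE; exact/esym/ab.
by move=> pq; apply/eqP; rewrite eq_le !le// => E mE; exact/esym/pq.
Qed.

End LimitHomogeneity.

(** * Sums over observed histories *)

Section HistorySum.
Local Open Scope ereal_scope.
Context {R : realType} {M : nat}.
Local Notation hist := (seq 'I_M).

(** Histories of length [t] are summed with the newest symbol, at the head, in the innermost sum, as
    the recursion of [node] requires. *)
Fixpoint hsum (t : nat) (phi : hist -> \bar R) : \bar R :=
  if t is t'.+1 then hsum t' (fun h => \sum_(i < M) phi (i :: h)) else phi [::].

Lemma hsum_ge0 t phi : (forall h, 0 <= phi h) -> 0 <= hsum t phi.
Proof.
by elim: t phi => [|t IH] phi h0 //=; apply: IH => h; exact: sume_ge0.
Qed.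

Lemma hsum_le t phi psi : (forall h, size h = t -> phi h <= psi h) -> hsum t phi <= hsum t psi.
Proof.
elim: t phi psi => [|t IH] phi psi le /=; first exact: le.
by apply: IH => h ht; apply: lee_sum => i _; apply: le; rewrite /= ht.
Qed.

Lemma eq_hsum t phi psi : (forall h, size h = t -> phi h = psi h) -> hsum t phi = hsum t psi.
Proof. by move=> e; apply/eqP; rewrite eq_le !hsum_le// => h /e ->. Qed.

Lemma hsumD t phi psi : hsum t (fun h => phi h + psi h) = hsum t phi + hsum t psi.
Proof.
elim: t phi psi => [//|t IH] phi psi /=; rewrite -IH; apply: eq_hsum => h _.
by rewrite big_split.
Qed.

Lemma hsumZ t (c : R) phi : (forall h, 0 <= phi h) ->
  hsum t (fun h => c%:E * phi h) = c%:E * hsum t phi.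
Proof.
elim: t phi => [//|t IH] phi h0 /=; rewrite -IH; last by move=> h; exact: sume_ge0.
by apply: eq_hsum => h _; rewrite ge0_sume_distrr.
Qed.

Lemma integral_hsum d (T : measurableType d) (mu : {measure set T -> \bar R}) t
    (phi : hist -> T -> \bar R) :
  (forall h, measurable_fun setT (phi h)) -> (forall h x, 0 <= phi h x) ->
  \int[mu]_x hsum t (fun h => phi h x) = hsum t (fun h => \int[mu]_x phi h x).
Proof.
elim: t phi => [//|t IH] phi mphi phi0 /=.
rewrite IH//; last by move=> h x; exact: sume_ge0.
  by apply: eq_hsum => h _; rewrite ge0_integral_sum.
by move=> h; exact: emeasurable_sum.
Qed.

Lemma measurable_hsum d (T : measurableType d) t (phi : hist -> T -> \bar R) :
  (forall h, measurable_fun setT (phi h)) ->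
  measurable_fun setT (fun x => hsum t (fun h => phi h x)).
Proof.
elim: t phi => [|t IH] phi mphi /=; first exact: mphi.
by apply: IH => h; exact: emeasurable_sum.
Qed.

End HistorySum.

Section BeliefTree.
Local Open Scope ereal_scope.
Context {R : realType} {dim k M : nat}.
Local Notation X := (dim.-tuple R).
Local Notation W := (k.-tuple R).
Local Notation BS := (giry X R).
Local Notation cquant := (@cquant R dim M).
Local Notation hist := (seq 'I_M).
Variables (f : X -> W -> X) (nu : probability W R).
Hypothesis mf : measurable_fun [set: (X * W)%type] (fun z => f z.1 z.2).
Local Notation updq := (updq nu mf).

(* Histories list the most recent symbol first, and beliefs are kept unnormalised: the mass of
   [node p0 G h] is the probability of observing [h]. *)
Fixpoint node (p0 : BS) (G : nat -> BS -> cquant) (h : hist) : BS :=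
  if h is i :: h' then updq (node p0 G h') (sval (G (size h') (normalize (node p0 G h')))) i else p0.

Definition node_quant p0 G (h : hist) : cquant := G (size h) (normalize (node p0 G h)).

Definition node_cost p0 G (h : hist) : \bar R :=
  node p0 G h setT * qcost (normalize (node p0 G h)) (sval (node_quant p0 G h)).

Lemma node_cost_ge0 p0 G h : 0 <= node_cost p0 G h.
Proof. by rewrite mule_ge0// qcost_ge0. Qed.

Lemma iter_exp_markov_op t (g : X -> \bar R) : iter_exp f nu t (markov_op f nu g) = iter_exp f nu t.+1 g.
Proof.
elim: t => [//|t IH]; apply/funext => x /=.
by apply: eq_integral => w _; rewrite IH.
Qed.

(** Whatever the quantizers, the unnormalised beliefs of all histories of length [t] add up to the
    unconditioned law of the state. *)
Lemma hsum_int_node (p0 : BS) G t (g : X -> \bar R) : measurable_fun setT g -> (forall x, 0 <= g x) ->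
  hsum t (fun h => \int[node p0 G h]_x g x) = \int[p0]_x iter_exp f nu t g x.
Proof.
elim: t g => [//|t IH] g mg g0 /=; rewrite -/(iter_exp f nu t.+1 g) -iter_exp_markov_op -IH.
- by apply: eq_hsum => h _; rewrite sum_updq.
- exact: measurable_markov_op.
- by move=> x; exact: markov_op_ge0.
Qed.

Lemma qcost_le_normalize (p : BS) (Q : cquant) :
  qcost p (sval Q) <= p setT * qcost (normalize p) (sval Q).
Proof.
have [p0|p0] := eqVneq (p setT) 0.
  have pnull E : measurable E -> p E = 0.
    by move=> mE; apply/eqP; rewrite eq_le measure_ge0 andbT -p0 le_measure ?inE.
  rewrite p0 mul0e qcostE; apply: sume_le0 => i _.
  apply: ereal_inf_lbound; exists point => //.
  have -> : \int[p]_(x in cell (sval Q) i) (sqdist x point)%:E =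
      \int[mzero]_(x in cell (sval Q) i) (sqdist x point)%:E by exact: int_eq_on.
  exact: integral_measure_zero.
have mpos := mass_gt0 p0.
have mix := is_mix_inv mpos (is_mix_normalize p).
have := qcost_mix Q (ltW (_ : 0 < (fine (p setT))^-1)%R) (lexx 0%R) mix.
rewrite invr_gt0 => /(_ mpos); rewrite mul0e adde0 => le.
rewrite -(fineK (mass_fin p)).
have := lee_wpmul2l (_ : 0 <= (fine (p setT))%:E) le.
rewrite lee_fin => /(_ (ltW mpos)).
by rewrite muleA -EFinM divff ?mul1e// gt_eqF.
Qed.

Section LowerBound.
Variables (beta theta : R) (s : X -> \bar R) (g : BS -> \bar R).
Hypothesis beta01 : (0 <= beta < 1)%R.
Hypothesis theta0 : (0 <= theta)%R.
Hypothesis ms : measurable_fun setT s.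
Hypothesis s0 : forall x, 0 <= s x.
Hypothesis g0 : forall p, 0 <= g p.
Hypothesis g_upper : forall (p : BS) (Q : cquant), g p + theta%:E * \int[p]_x s x <=
  qcost p (sval Q) + beta%:E * \sum_(i < M) g (updq p (sval Q) i).

Lemma tree_lower_step (p0 : BS) G t :
  hsum t (g \o node p0 G) + theta%:E * \int[p0]_x iter_exp f nu t s x <=
  hsum t (node_cost p0 G) + hsum t.+1 (g \o node p0 G).
Proof.
rewrite -(hsum_int_node p0 G)// -hsumZ; last by move=> h; exact: integral_ge0.
rewrite /= -!hsumD; apply: hsum_le => h _; apply: (le_trans (g_upper _ (node_quant p0 G h))).
apply: leeD; first exact: qcost_le_normalize.
have [b0 b1] := andP beta01.
rewrite -[leRHS]mul1e; apply: lee_wpmul2r; first exact: sume_ge0.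
by rewrite lee_fin ltW.
Qed.

Lemma tree_lower (p0 : BS) G T : theta%:E * \sum_(t < T) \int[p0]_x iter_exp f nu t s x <=
  \sum_(t < T) hsum t (node_cost p0 G) + hsum T (g \o node p0 G).
Proof.
suff : hsum 0 (g \o node p0 G) + theta%:E * \sum_(t < T) \int[p0]_x iter_exp f nu t s x <=
    \sum_(t < T) hsum t (node_cost p0 G) + hsum T (g \o node p0 G).
  by apply: le_trans; rewrite leeDr//=.
have i0 t : 0 <= \int[p0]_x iter_exp f nu t s x.
  by apply: integral_ge0 => x _; exact: iter_exp_ge0.
elim: T => [|T IH]; first by rewrite !big_ord0 mule0 adde0 add0e.
rewrite !big_ord_recr/= ge0_muleDr//; last by rewrite sume_ge0.
rewrite addeA; apply: le_trans (leeD2r _ IH) _.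
rewrite -!addeA; apply: leeD => //; exact: tree_lower_step.
Qed.

End LowerBound.

(** Using the quantizer [Q0] forever after time [T] costs at most the discounted later second
    moments, so moment bounds from time [T] on suffice. *)
Lemma hsum_disc_value_le beta (beta01 : (0 <= beta < 1)%R) (Q0 : cquant) (p0 : BS) G T (B : R) :
  (forall t, (T <= t)%N -> \int[p0]_x iter_exp f nu t sqnorm x <= B%:E) ->
  hsum T (fun h => disc_value nu mf beta (M := M) (node p0 G h)) <= (B / (1 - beta))%:E.
Proof.
move=> HB; have [b0 b1] := andP beta01.
have ms := @measurable_sqnorm R dim; have s0 := @sqnorm_ge0 R dim.
have msj j : measurable_fun setT (iter_exp f nu j sqnorm) by exact: measurable_iter_exp.
have sj0 j x : 0 <= iter_exp f nu j sqnorm x by exact: iter_exp_ge0.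
pose J n p := cost_upto nu mf beta n p (fun=> Q0).
have hJ n : hsum T (fun h => J n (node p0 G h)) <= (B / (1 - beta))%:E.
  have B0 : (0 <= B)%R by rewrite -lee_fin; apply: le_trans (HB T (leqnn _)); exact: integral_ge0.
  apply: (@le_trans _ _ (hsum T (fun h => \sum_(j < n) (beta ^+ j)%:E *
      \int[node p0 G h]_x iter_exp f nu j sqnorm x))).
    by apply: hsum_le => h _; exact: cost_upto_le_sqnorm.
  have -> : hsum T (fun h => \sum_(j < n) (beta ^+ j)%:E *
      \int[node p0 G h]_x iter_exp f nu j sqnorm x) = \sum_(j < n) (beta ^+ j)%:E *
      \int[p0]_x iter_exp f nu (T + j) sqnorm x.
    elim: n => [|n IH].
      rewrite big_ord0; under eq_hsum do rewrite big_ord0.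
      by elim: (T) => [//|T' IH'] /=; under eq_hsum do rewrite big1//.
    rewrite big_ord_recr/= -IH; under eq_hsum do rewrite big_ord_recr/=.
    rewrite hsumD hsumZ; last by move=> h; exact: integral_ge0.
    rewrite hsum_int_node//; congr (_ + _ * _); apply: eq_integral => x _.
    by elim: (T) x => [//|T' IH'] x /=; apply: eq_integral => w _; exact: IH'.
  apply: (@le_trans _ _ (\sum_(t < n) (beta ^+ t * B)%:E)).
    apply: lee_sum => t _; rewrite EFinM lee_wpmul2l// ?lee_fin ?exprn_ge0//.
    by apply: HB; rewrite leq_addr.
  rewrite sumEFin lee_fin -mulr_suml mulrC ler_wpM2l//.
  have b1' : (0 < 1 - beta)%R by rewrite subr_gt0.
  rewrite -[leRHS]mul1r ler_pdivlMr// mulrC -opprB mulNr -subrX1 opprB.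
  by rewrite gerBl exprn_ge0.
apply: (@le_trans _ _ (hsum T (fun h => cost_total nu mf beta (node p0 G h) (fun=> Q0)))).
  by apply: hsum_le => h _; apply: disc_value_le_cost.
have c : (fun n => hsum T (fun h => J n (node p0 G h))) @ \oo -->
    hsum T (fun h => cost_total nu mf beta (node p0 G h) (fun=> Q0)).
  have J0 n p : 0 <= J n p by exact: cost_upto_ge0.
  have Jc p : (fun n => J n p) @ \oo --> cost_total nu mf beta p (fun=> Q0).
    exact: cost_upto_cvg.
  have gen : forall (phi : nat -> hist -> \bar R) psi, (forall n h, 0 <= phi n h) ->
      (forall h, (fun n => phi n h) @ \oo --> psi h) ->
      (fun n => hsum T (phi n)) @ \oo --> hsum T psi.
    elim: (T) => [|T' IH'] phi psi phi0 cv /=; first exact: cv.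
    apply: IH' => [n h|h]; first exact: sume_ge0.
    by apply: cvg_nnesum => i _; [near=> n; exact: phi0|exact: cv].
  exact: gen.
rewrite -(cvg_lim (@ereal_hausdorff R) c); apply: lime_le; first by apply/cvg_ex; eexists; exact: c.
by near=> n; exact: hJ.
Unshelve. all: by end_near. Qed.

End BeliefTree.

(** * Optimal quantizers along the beliefs reachable from the regeneration law *)

Section Selection.
Local Open Scope ereal_scope.
Context {R : realType} {dim k M : nat}.
Local Notation X := (dim.-tuple R).
Local Notation W := (k.-tuple R).
Local Notation BS := (giry X R).
Local Notation cquant := (@cquant R dim M).
Local Notation hist := (seq 'I_M).
Variables (f : X -> W -> X) (nu : probability W R).
Hypothesis mf : measurable_fun [set: (X * W)%type] (fun z => f z.1 z.2).
Hypothesis A1 : assumption1 f nu.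
Local Notation updq := (updq nu mf).
Variables (H : BS -> \bar R) (theta : R) (s : X -> \bar R) (m : BS) (Q0 : cquant).
Hypothesis theta0 : (0 <= theta)%R.
Hypothesis us : unit_fun s.
Hypothesis H0 : forall p, 0 <= H p.
Hypothesis H_agree : forall p q, agree p q -> H p = H q.
Hypothesis H_scale : forall (w : R) (u v : BS), (0 < w)%R -> v setT = 1 -> is_mix w 0 u v v ->
  w%:E * H v <= H u.

Definition optimal (p : BS) (Q : cquant) : Prop :=
  qcost p (sval Q) + \sum_(i < M) H (updq p (sval Q) i) <= H p + theta%:E * \int[p]_x s x.

Hypothesis H_opt : forall p : BS, hyperplane_null p -> H p < +oo -> exists Q, optimal p Q.
Hypothesis m_null : hyperplane_null m.
Hypothesis m_mass : m setT = 1.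
Hypothesis Hm : H m < +oo.

Definition select (S : cquant -> Prop) : cquant :=
  if pselect (exists Q, S Q) is left e then sval (cid e) else Q0.

Lemma selectP S : (exists Q, S Q) -> S (select S).
Proof. by rewrite /select; case: pselect => // e _; exact: svalP (cid e). Qed.

Definition Qsel (p : BS) : cquant := select (optimal p).

Lemma agree_is_mix (p q : BS) : agree p q -> is_mix 1 0 p q q.
Proof. by move=> pq E mE; rewrite mul1e mul0e adde0; exact: pq. Qed.

Lemma agree_updq (p q : BS) (Q : cquant) i : agree p q -> agree (updq p (sval Q) i) (updq q (sval Q) i).
Proof.
move=> pq E mE; have := is_mix_updq nu mf Q i ler01 (lexx 0%R) (agree_is_mix pq).
by move=> /(_ E mE); rewrite mul1e mul0e adde0.
Qed.

Lemma agree_qcost (p q : BS) (Q : X -> 'I_M) : agree p q -> qcost p Q = qcost q Q.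
Proof.
move=> pq; rewrite !qcostE; apply: eq_bigr => i _; congr ereal_inf.
by apply/seteqP; split => _ [u _ <-]; exists u => //; [exact/esym/int_eq_on|exact: int_eq_on].
Qed.

(* [select] depends only on the predicate, so the quantizer chosen at a belief depends only on its
   values on measurable sets. *)
Lemma Qsel_agree p q : agree p q -> Qsel p = Qsel q.
Proof.
move=> pq; congr select; apply/funext => Q; rewrite /optimal.
rewrite (agree_qcost _ pq) (H_agree pq) (agree_int _ pq).
by under eq_bigr do rewrite (H_agree (agree_updq _ _ pq)).
Qed.

Local Notation N := (node nu mf m (fun=> Qsel)).

(** A policy sees the normalised belief, so the optimality inequality is applied there and then
    multiplied by the mass. [H_scale] is one-sided, which is why this is not replaced by
    [H (N h)]. *)
Definition node_val (h : hist) : \bar R := N h setT * H (normalize (N h)).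

Lemma updq_null (p : BS) (Q : cquant) i : hyperplane_null (updq p (sval Q) i).
Proof.
move=> a b aN0; set E := [set x | _].
have mE : measurable E by exact: measurable_hyperplane.
have mi : measurable_fun setT (fun y : X => (\1_E y)%:E : \bar R).
  by apply/measurable_EFinP; exact: measurable_indic.
have -> : updq p (sval Q) i E = \int[updq p (sval Q) i]_x (\1_E x)%:E.
  by rewrite integral_indic// setIT.
rewrite int_updq//; apply: integral0_eq => x _; rewrite /markov_op.
rewrite -[RHS](trans_hyperplane_null A1 x b aN0) /trans.
rewrite -[X in _ = nu X]setIT -integral_indic//.
rewrite -[X in measurable X]setTI; exact: (measurable_f1 mf x).
Qed.

Lemma normalize_null (p : BS) : p setT != 0 -> hyperplane_null p -> hyperplane_null (normalize p).
Proof. by move=> p0 hp a b ab; rewrite normalizeE// hp// mule0. Qed.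

Lemma node_null h : hyperplane_null (N h).
Proof. by case: h => [|i h] //=; exact: updq_null. Qed.

Lemma node_val_ge0 h : 0 <= node_val h.
Proof. by rewrite mule_ge0. Qed.

(** The child can be reached by updating the parent before or after normalisation; the two results
    are proportional, and [H_scale] compares their values. *)
Lemma node_val_updq h i : node_val (i :: h) <=
  N h setT * H (updq (normalize (N h)) (sval (Qsel (normalize (N h)))) i).
Proof.
rewrite /node_val; set v := normalize (N h); set Q := Qsel v; set u := N (i :: h).
have [u0|u0] := eqVneq (u setT) 0; first by rewrite u0 mul0e mule_ge0.
have umix : is_mix (fine (N h setT)) 0 u (updq v (sval Q) i) (updq v (sval Q) i).
  by apply: is_mix_updq => //; [rewrite fine_ge0|exact: is_mix_normalize].
have w0 : N h setT != 0.
  apply: contra u0 => /eqP w0; rewrite umix// w0 /= !mul0e adde0//.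
have wpos := mass_gt0 w0; have upos := mass_gt0 u0.
have := @H_scale (fine (u setT) / fine (N h setT)) (updq v (sval Q) i) (normalize u) _ (normalize_mass _).
move=> /(_ (divr_gt0 upos wpos)) le.
have {}le := le (_ : is_mix _ 0 _ _ _).
rewrite -(fineK (mass_fin (N h))).
apply: le_trans (lee_wpmul2l _ (le _)); last 2 first.
- by rewrite lee_fin ltW.
- move=> E mE; rewrite mul0e adde0 mulrC EFinM -muleA fineK ?mass_fin// mul_normalize//.
  by rewrite (is_mix_inv wpos umix)// mul0e adde0.
rewrite muleA -EFinM mulrCA divff ?mulr1 ?fineK ?mass_fin//.
by rewrite gt_eqF.
Qed.

Lemma node_val_fin h : node_val h < +oo -> N h setT != 0 -> H (normalize (N h)) < +oo.
Proof.
rewrite /node_val => + w0; rewrite -(fineK (mass_fin (N h))).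
have := H0 (normalize (N h)); case: (H _) => [a _ _|_|]; [exact: ltry| |by []].
by rewrite gt0_muley ?ltxx// lte_fin mass_gt0.
Qed.

Lemma node_step h : node_val h < +oo ->
  node_cost nu mf m (fun=> Qsel) h + \sum_(i < M) node_val (i :: h) <=
  node_val h + theta%:E * \int[N h]_x s x.
Proof.
move=> vfin.
apply: (@le_trans _ _ (node_cost nu mf m (fun=> Qsel) h + \sum_(i < M)
    N h setT * H (updq (normalize (N h)) (sval (Qsel (normalize (N h)))) i))).
  by apply: leeD => //; apply: lee_sum => i _; exact: node_val_updq.
rewrite -ge0_sume_distrr// /node_cost/= -ge0_muleDr ?qcost_ge0 ?sume_ge0//.
have i0 (p : BS) : 0 <= \int[p]_x s x by apply: integral_ge0 => x _; have /andP[] := us.2 x.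
have [w0|w0] := eqVneq (N h setT) 0.
  by rewrite w0 mul0e adde_ge0// ?node_val_ge0// mule_ge0 ?lee_fin.
have Hf := node_val_fin vfin w0.
have opt : optimal (normalize (N h)) (Qsel (normalize (N h))).
  by apply: selectP; apply: H_opt => //; apply: normalize_null => //; exact: node_null.
apply: (le_trans (lee_wpmul2l _ opt)) => //.
rewrite ge0_muleDr//; last by rewrite mule_ge0 ?lee_fin.
rewrite leeD2l// muleCA; apply: lee_wpmul2l; first by rewrite lee_fin.
rewrite [leRHS](is_mix_int _ (is_mix_normalize (N h)) us) ?fine_ge0//.
by rewrite fineK// mass_fin.
Qed.

Lemma int_unit_le1 (p : BS) : \int[p]_x s x <= 1.
Proof.
apply: (@le_trans _ _ (\int[p]_x (cst 1 x))).
  by apply: ge0_le_integral_nonmeasurable => x _; have /andP[] := us.2 x.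
by rewrite integral_cst// mul1e; exact: sprobability_setT.
Qed.

(** Optimal quantizers are available where [H] is finite. Finiteness is inherited from the root,
    since [node_step] at a node of finite value bounds the values of its children. *)
Lemma node_val_lty h : node_val h < +oo.
Proof.
elim: h => [|i h IH]; first by rewrite /node_val/= m_mass mul1e (@H_agree _ m)// => E mE;
  rewrite -(mul_normalize m)// m_mass mul1e.
have : node_val (i :: h) <= node_val h + theta%:E * \int[N h]_x s x.
  apply: le_trans (node_step IH); apply: (@le_trans _ _ (\sum_(i < M) node_val (i :: h))).
    by rewrite (bigD1 i)//= leeDl// sume_ge0// => j _; exact: node_val_ge0.
  by rewrite leeDr// node_cost_ge0.
move=> /le_lt_trans; apply; apply: lte_add_pinfty => //.
rewrite ltey_eq fin_numM// ge0_fin_numE; last first.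
  by apply: integral_ge0 => x _; have /andP[] := us.2 x.
by apply: le_lt_trans (int_unit_le1 _) _; rewrite ltry.
Qed.

(** [node_step] telescopes, and the nonnegative values at the horizon are dropped. *)
Lemma tree_upper T : \sum_(t < T) hsum t (node_cost nu mf m (fun=> Qsel)) <=
  H m + theta%:E * \sum_(t < T) \int[m]_x iter_exp f nu t s x.
Proof.
have [ms s01] := us; have s0 x : 0 <= s x by have /andP[] := s01 x.
suff : \sum_(t < T) hsum t (node_cost nu mf m (fun=> Qsel)) + hsum T node_val <=
    hsum 0 node_val + theta%:E * \sum_(t < T) \int[m]_x iter_exp f nu t s x.
  move=> le; apply: le_trans (le_trans le _).
    by rewrite leeDl// hsum_ge0// => h; exact: node_val_ge0.
  rewrite leeD2r//= /node_val/= m_mass mul1e (@H_agree _ m)// => E mE.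
  by rewrite -(mul_normalize m)// m_mass mul1e.
have i0 t : 0 <= \int[m]_x iter_exp f nu t s x.
  by apply: integral_ge0 => x _; exact: iter_exp_ge0.
elim: T => [|T IH]; first by rewrite !big_ord0 mule0 adde0 add0e.
rewrite !big_ord_recr/= ge0_muleDr ?sume_ge0// [leRHS]addeA.
apply: le_trans (leeD2r _ IH); rewrite -!addeA; apply: leeD => //.
rewrite -(hsum_int_node nu mf m (fun=> Qsel))// -hsumZ; last by move=> h; exact: integral_ge0.
rewrite -!hsumD; apply: hsum_le => h _; apply: node_step; exact: node_val_lty.
Qed.

End Selection.

(** * A measurable policy prescribed on countably many beliefs *)

Section CountablePolicy.
Local Open Scope ereal_scope.
Context {R : realType} {dim M : nat}.
Local Notation X := (dim.-tuple R).
Local Notation BS := (giry X R).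
Local Notation cquant := (@cquant R dim M).
Variables (v : nat -> BS) (q : nat -> cquant) (Qc : cquant).
Hypothesis q_agree : forall n j, agree (v n) (v j) -> q n = q j.

(* Only countably many beliefs have to be told apart, so one separating event per pair suffices and
   the sigma-algebra on states need not be countably generated. *)
Lemma separating_family : exists S : nat -> set BS,
  [/\ forall n, measurable (S n), forall n, S n (v n) & forall n j, S n (v j) -> agree (v n) (v j)].
Proof.
have /choice[A hA] : forall nj : nat * nat, exists A : set X, measurable A /\
    (v nj.1 A = v nj.2 A -> agree (v nj.1) (v nj.2)).
  move=> [n j] /=; have [e|/existsNP[A /not_implyP[mA neq]]] := pselect (agree (v n) (v j)).
    by exists set0.
  by exists A; split.
exists (fun n => \bigcap_j [set p | p (A (n, j)) = v n (A (n, j))]); split.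
- move=> n; apply: bigcap_measurable => [|j _]; first by exists 0%N.
  have mA := (hA (n, j)).1.
  have : measurable ((giry_ev^~ (A (n, j))) @^-1` [set v n (A (n, j))]).
    rewrite -[X in measurable X]setTI; apply: (measurable_giry_ev mA) => //; exact: emeasurable_set1.
  by [].
- by move=> n j _.
- by move=> n j /(_ j Logic.I) /= e; apply: (hA (n, j)).2.
Qed.

(** The separating events are made disjoint, and [Qc] is used off their union. A belief [v n] may
    fall into [F j] for another [j], but then it agrees with [v j], and [q_agree] gives the same
    quantizer. *)
Lemma countable_policy : exists G : BS -> X -> 'I_M,
  [/\ forall p, convex_quantizer (G p),
     forall i, measurable [set z : ((BS * R) * X)%type | G z.1.1 z.2 = i] &
     forall n, G (v n) = sval (q n)].
Proof.
have [S [mS vS Sv]] := separating_family.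
pose F := seqDU S.
pose G p := if pselect (exists n, F n p) is left e then sval (q (sval (cid e))) else sval Qc.
have mF n : measurable (F n).
  by apply: measurableD => //; apply: bigsetU_measurable.
have FG n p : F n p -> G p = sval (q n).
  rewrite /G; case: pselect => [e Fn|h Fn]; last by case: h; exists n.
  case: (cid e) => n' Fn' /=; congr (sval (q _)).
  have /trivIsetP := trivIset_seqDU S => /(_ n' n Logic.I Logic.I).
  by apply: contraPP => /eqP nn /(_ nn) /seteqP[+ _] => /(_ p); apply.
have nFG p : ~ (exists n, F n p) -> G p = sval Qc.
  by rewrite /G; case: pselect.
exists G; split.
- by move=> p; rewrite /G; case: pselect => [e|_]; exact: proj2_sig.
- move=> i; pose pr (z : ((BS * R) * X)%type) := z.1.1.
  have mpr : measurable_fun setT pr.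
    by apply: (@measurableT_comp _ _ _ _ _ _ fst _ fst) => //; exact: measurable_fst.
  have mp (E : set BS) (Q : cquant) : measurable E ->
      measurable [set z : ((BS * R) * X)%type | E z.1.1 /\ sval Q z.2 = i].
    move=> mE; rewrite (_ : [set z | _] = (pr @^-1` E) `&` (snd @^-1` cell (sval Q) i))//.
    apply: measurableI; rewrite -[X in measurable X]setTI; first exact: mpr.
    by apply: measurable_snd => //; exact: measurable_cell.
  rewrite (_ : [set z | _] = (\bigcup_n [set z | F n z.1.1 /\ sval (q n) z.2 = i]) `|`
      [set z | (~` \bigcup_n F n) z.1.1 /\ sval Qc z.2 = i]).
    apply: measurableU; first by apply: bigcup_measurable => n _; exact: mp.
    by apply: mp; apply: measurableC; exact: bigcup_measurable.
  apply/seteqP; split => z /=.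
    have [[n Fn]|nF] := pselect (exists n, F n z.1.1).
      by rewrite (FG _ _ Fn) => zi; left; exists n.
    by rewrite nFG// => zi; right; split => // -[n _ Fn]; apply: nF; exists n.
  case=> [[n _ [Fn zi]]|[nF zi]]; first by rewrite (FG _ _ Fn).
  by rewrite nFG// => -[n Fn]; apply: nF; exists n.
- move=> n; have [j _ Fj] : (\bigcup_j F j) (v n) by rewrite -seqDU_bigcup_eq; exists n.
  rewrite (FG _ _ Fj); congr sval; apply: q_agree; apply: Sv.
  exact: (@subset_seqDU _ S).
Qed.

End CountablePolicy.

(** * Representation of the beliefs of a realization *)

Section RestrictedImage.
Local Open Scope ereal_scope.
Context {R : realType} {dO dZ : measure_display}.
Context {O : measurableType dO} {Z : measurableType dZ}.
Variables (P : probability O R).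

Lemma restricted_image (D : set O) (a : O -> Z) : measurable D -> measurable_fun setT a ->
  exists mu : giry Z R, forall h : Z -> \bar R, measurable_fun setT h -> (forall z, 0 <= h z) ->
    \int[mu]_z h z = \int[P]_(w in D) h (a w).
Proof.
move=> mD ma.
pose g w : giry Z R := if w \in D then giry_ret (a w) else mzero.
have mg : measurable_fun setT g.
  apply: measurable_fun_if => //.
    apply: (@measurable_fun_bool _ _ _ _ true).
    rewrite setTI (_ : _ @^-1` _ = D)//.
    by apply/seteqP; split => x /=; [exact: set_mem|exact: mem_set].
  apply: measurable_funTS; apply: (@measurableT_comp _ _ _ _ _ _ (@giry_ret _ _ R) _ a) => //.
  exact: measurable_giry_ret.
exists (giry_bind (P : giry O R) mg) => h mh h0.
have := giry_int_bind (P : giry O R) mg mh h0.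
rewrite {1 2}/giry_int => ->; rewrite [RHS]integral_mkcond; apply: eq_integral => w _.
rewrite /giry_int /g /patch; case: ifP => wD; last exact: integral_measure_zero.
exact: giry_int_ret.
Qed.

Lemma ge0_integral_image_eq (D : set O) (a b : O -> Z) : measurable D ->
  measurable_fun setT a -> measurable_fun setT b ->
  (forall E, measurable E -> P (D `&` a @^-1` E) = P (D `&` b @^-1` E)) ->
  forall h : Z -> \bar R, measurable_fun setT h -> (forall z, 0 <= h z) ->
  \int[P]_(w in D) h (a w) = \int[P]_(w in D) h (b w).
Proof.
move=> mD ma mb ab h mh h0.
have [mua ha] := restricted_image mD ma; have [mub hb] := restricted_image mD mb.
rewrite -ha// -hb//; apply: int_eq_on => E mE.
have mi : measurable_fun setT (fun z => (\1_E z)%:E : \bar R).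
  by apply/measurable_EFinP; exact: measurable_indic.
have eval (mu : giry Z R) (c : O -> Z) : measurable_fun setT c -> (forall h : Z -> \bar R,
    measurable_fun setT h -> (forall z, 0 <= h z) ->
    \int[mu]_z h z = \int[P]_(w in D) h (c w)) -> mu E = P (D `&` c @^-1` E).
  move=> mc hc; transitivity (\int[mu]_z (\1_E z)%:E); first by rewrite integral_indic// setIT.
  rewrite hc//; transitivity (\int[P]_(w in D) (\1_(c @^-1` E) w)%:E) => //.
  rewrite integral_indic// 1?setIC//.
  by rewrite -[X in measurable X]setTI; exact: mc.
transitivity (mua E) => //; rewrite [LHS](eval _ _ ma ha) ab//.
exact/esym/(eval _ _ mb hb).
Qed.

End RestrictedImage.

Section Disintegration.
Local Open Scope ereal_scope.
Context {R : realType} {dO dZ dX : measure_display}.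
Context {O : measurableType dO} {Z : measurableType dZ} {X : measurableType dX}.
Variables (P : probability O R).

(** Both sides are integrals of [F] against finite measures on the product; [rect] makes them equal
    on rectangles, a generating class stable under intersection. *)
Lemma disintegration (D : set O) (zeta : O -> Z) (xi : O -> X) (kap : Z -> giry X R) :
  measurable D -> measurable_fun setT zeta -> measurable_fun setT xi ->
  measurable_fun setT kap ->
  (forall C A, measurable C -> measurable A ->
     P (D `&` zeta @^-1` C `&` xi @^-1` A) = \int[P]_(w in zeta @^-1` C) kap (zeta w) A) ->
  forall F : (Z * X)%type -> \bar R, measurable_fun setT F -> (forall z, 0 <= F z) ->
  \int[P]_(w in D) F (zeta w, xi w) = \int[P]_w \int[kap (zeta w)]_x F (zeta w, x).
Proof.
move=> mD mz mx mk rect F mF F0.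
have [mu1 int1] := restricted_image P mD (measurable_fun_pair mz mx).
pose g2 w : giry (Z * X)%type R := giry_prod (giry_ret (zeta w), kap (zeta w)).
have mg2 : measurable_fun setT g2.
  apply: (@measurableT_comp _ _ _ _ _ _ (@giry_prod _ _ Z X R)
    _ (fun w => (giry_ret (zeta w), kap (zeta w)))); first exact: measurable_giry_prod.
  apply: measurable_fun_pair; last exact: measurableT_comp.
  by apply: (@measurableT_comp _ _ _ _ _ _ (@giry_ret _ _ R)) => //; exact: measurable_giry_ret.
pose mu2 := giry_bind (P : giry O R) mg2.
have int2 h : measurable_fun setT h -> (forall z, 0 <= h z) ->
    \int[mu2]_z h z = \int[P]_w \int[kap (zeta w)]_x h (zeta w, x).
  move=> mh h0; have := giry_int_bind (P : giry O R) mg2 mh h0.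
  rewrite {1 2}/giry_int => ->; apply: eq_integral => w _; rewrite /g2 giry_int_prod1//.
  rewrite giry_int_ret//; exact: (measurable_fun_fubini_tonelli_F h).
rewrite -int1// -int2//; apply: int_eq_on => E mE.
pose G : set (set (Z * X)) := [set C `*` A | C in measurable & A in measurable].
apply: (measure_unique G (fun=> setT)) mE.
- exact: measurable_prod_measurableType.
- move=> _ _ [A1 mA1 [A2 mA2 <-]] [B1 mB1 [B2 mB2 <-]]; exists (A1 `&` B1).
    exact: measurableI.
  by exists (A2 `&` B2); [exact: measurableI|rewrite setXI].
- by move=> _; exists setT => //; exists setT => //; rewrite setXTT.
- by rewrite bigcup_const.
- move=> _ [C mC [A mA <-]].
  have mCA : measurable (C `*` A) by exact: measurableX.
  have mi : measurable_fun setT (fun z => (\1_(C `*` A) z)%:E : \bar R).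
    by apply/measurable_EFinP; exact: measurable_indic.
  transitivity (\int[mu1]_z (\1_(C `*` A) z)%:E); first by rewrite integral_indic// setIT.
  transitivity (\int[mu2]_z (\1_(C `*` A) z)%:E); last by rewrite integral_indic// setIT.
  have mZC : measurable (zeta @^-1` C) by rewrite -[X in measurable X]setTI; exact: mz.
  have mXA : measurable (xi @^-1` A) by rewrite -[X in measurable X]setTI; exact: mx.
  rewrite int1// int2//.
  transitivity (P (D `&` zeta @^-1` C `&` xi @^-1` A)).
    transitivity (\int[P]_w (\1_(D `&` zeta @^-1` C `&` xi @^-1` A) w)%:E); last first.
      by rewrite integral_indic ?setIT//; do 2 apply: measurableI => //.
    rewrite [LHS]integral_mkcond; apply: eq_integral => w _; rewrite /patch !indicE.
    case: ifPn => [|nD]; last first.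
      by rewrite memNset//= => -[[/mem_set]]; rewrite (negbTE nD).
    rewrite inE => Dw; congr (_%:R%:E); congr nat_of_bool; apply/idP/idP; rewrite !inE/=.
      by case.
    by case=> -[].
  rewrite rect// integral_mkcond; apply: eq_integral => w _; rewrite /patch.
  case: ifPn => wC.
    transitivity (\int[kap (zeta w)]_x (\1_A x)%:E); first by rewrite integral_indic// setIT.
    apply: eq_integral => x _; rewrite !indicE; congr (_%:R%:E); congr nat_of_bool.
    by move: wC; rewrite inE => wC; apply/idP/idP; rewrite !inE/=; [|case].
  rewrite integral0_eq// => x _; rewrite indicE memNset//= => -[Cz _].
  by move: wC; rewrite (mem_set (Cz : (zeta @^-1` C) w)).
- move=> _; apply: le_lt_trans (@sprobability_setT _ _ _ mu1) _; exact: ltry.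
Qed.

End Disintegration.

Section Independence.
Local Open Scope ereal_scope.
Context {R : realType} {dO dX : measure_display}.
Context {O : measurableType dO} {X : measurableType dX}.
Variables (P : probability O R) (G : set (set O)) (xi : O -> X) (nu : probability X R).
Hypotheses (GI : setI_closed G) (GT : G setT) (mG : G `<=` measurable).
Hypothesis mxi : measurable_fun setT xi.
Hypothesis indep : forall C A, G C -> measurable A -> P (C `&` xi @^-1` A) = P C * nu A.

Lemma generated_measurable : <<s G >> `<=` measurable.
Proof. by apply: smallest_sub => //; exact: sigma_algebra_measurable. Qed.

Lemma generated_indep C A : <<s G >> C -> measurable A -> P (C `&` xi @^-1` A) = P C * nu A.
Proof.
move=> GC mA; have mB : measurable (xi @^-1` A).
  by rewrite -[X in measurable X]setTI; exact: mxi.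
have nuA : nu A \is a fin_num by exact: fin_num_measure.
have nuA0 : (0 <= fine (nu A))%R by rewrite fine_ge0.
have := @g_sigma_algebra_measure_unique _ R O G mG (fun=> setT) _ _ (mrestr P mB)
  (mscale (NngNum nuA0) P) GI _ _ _ GC.
rewrite /= /mrestr /mscale/= => ->//; first by rewrite muleC fineK.
- by rewrite bigcup_const.
- by move=> B GB; rewrite [LHS]indep// muleC fineK.
- by move=> _; apply: le_lt_trans (probability_le1 P _) (ltry _) => //; rewrite setTI.
Qed.

(** The sample space itself, with the sigma-algebra generated by [G], serves as conditioning
    variable, so [F] may involve any data measurable for it. *)
Lemma independence_integral (F : (g_sigma_algebraType G * X)%type -> \bar R) :
  measurable_fun setT F -> (forall z, 0 <= F z) ->
  \int[P]_w F (w, xi w) = \int[P]_w \int[nu]_x F (w, x).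
Proof.
move=> mF F0; apply: (@disintegration R _ _ _ O (g_sigma_algebraType G) X P setT id xi
   (fun=> (nu : giry X R))) => //.
- by move=> _ B mB; rewrite setTI; exact: generated_measurable.
- move=> C A mC mA; rewrite setTI [LHS]generated_indep// integral_cst//; first by rewrite muleC.
  exact: generated_measurable.
Qed.

End Independence.

(** * Measurability of the quantization cost *)

Section CostMeasurability.
Local Open Scope ereal_scope.
Context {R : realType} {dim M : nat}.
Local Notation X := (dim.-tuple R).
Local Notation BS := (giry X R).

(** An enumeration of the rational points; codes that decode to nothing give [point]. *)
Definition rat_point (n : nat) : X :=
  if unpickle n is Some r then [tuple ratr (tnth (r : dim.-tuple rat) i) | i < dim] else point.

Lemma rat_point_dense (u : X) (eps : R) : (0 < eps)%R ->
  exists n, (sqdist u (rat_point n) <= eps)%R.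
Proof.
move=> eps0; pose d := Num.min 1%R (eps / dim.+1%:R)%R.
have d0 : (0 < d)%R by rewrite lt_min ltr01 divr_gt0.
have d1 : (d <= 1)%R by rewrite ge_min lexx.
have de : (d * dim.+1%:R <= eps)%R by rewrite -ler_pdivlMr// ge_min lexx orbT.
have /choice[q hq] : forall i : 'I_dim, exists q : rat, (`|tnth u i - ratr q| <= d)%R.
  move=> i; have ud : (tnth u i - d < tnth u i + d)%R by lra.
  have [q] := rat_in_itvoo ud.
  by rewrite in_itv/= => /andP[h1 h2]; exists q; rewrite ler_norml; lra.
exists (pickle [tuple q i | i < dim]); rewrite /rat_point pickleK /sqdist.
apply: (@le_trans _ _ (\sum_(i < dim) d)%R).
  apply: ler_sum => i _; rewrite !tnth_mktuple -real_normK ?num_real//.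
  have := hq i; set a := (`|_|)%R => ad.
  have a0 : (0 <= a)%R by exact: normr_ge0.
  nra.
rewrite sumr_const card_ord -[leLHS]mulr_natr; apply: le_trans de.
by rewrite ler_wpM2l ?(ltW d0)// ler_nat.
Qed.

(** In each coordinate the right-hand side exceeds the left by [eta] times a square. *)
Lemma sqdist_young (x u v : X) (eta : R) : (0 < eta)%R ->
  (sqdist x v <= (1 + eta) * sqdist x u + (1 + eta^-1) * sqdist u v)%R.
Proof.
move=> eta0; rewrite /sqdist !mulr_sumr -big_split/=; apply: ler_sum => i _.
move: (tnth x i) (tnth u i) (tnth v i) => a b c.
rewrite -subr_ge0.
have -> : ((1 + eta) * (a - b) ^+ 2 + (1 + eta^-1) * (b - c) ^+ 2 - (a - c) ^+ 2 =
  eta * ((a - b) - (b - c) / eta) ^+ 2)%R by field; rewrite gt_eqF.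
by rewrite mulr_ge0 ?sqr_ge0// ltW.
Qed.

(** The cost becomes a countable infimum of integrals, which makes it measurable in the belief. *)
Lemma cost0_rational (p : BS) (D : set X) : measurable D ->
  cost0 p D = ereal_inf [set \int[p]_(x in D) (sqdist x (rat_point n))%:E | n in setT].
Proof.
move=> mD; apply/eqP; rewrite eq_le; apply/andP; split.
  by apply: le_ereal_inf_tmp => _ [n _ <-]; apply: ereal_inf_lbound; exists (rat_point n).
apply: le_ereal_inf_tmp => _ [u _ <-].
have I0 : 0 <= \int[p]_(x in D) (sqdist x u)%:E.
  by apply: integral_ge0 => x _; rewrite lee_fin sqdist_ge0.
case E : (\int[p]_(x in D) (sqdist x u)%:E) I0 => [I| |]// I0; last by rewrite leey.
apply/lee_addgt0Pr => eps eps0; rewrite lee_fin in I0.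
(* Thus [eta * I <= eps / 2]; the rational centre is then chosen so close to [u] that the other half
   of [eps] covers the second term of [sqdist_young]. *)
pose eta := (eps / (2 * (I + 1)))%R.
have eta0 : (0 < eta)%R by rewrite divr_gt0// mulr_gt0// ltr_wpDl.
have c0 : (0 < 1 + eta^-1)%R by rewrite ltr_wpDr// invr_ge0 ltW.
have e2 : (0 < eps / (2 * (1 + eta^-1)))%R by rewrite divr_gt0// mulr_gt0.
have [n hn] := rat_point_dense u e2.
apply: ge_ereal_inf; exists (\int[p]_(x in D) (sqdist x (rat_point n))%:E); first by exists n.
apply: (@le_trans _ _ (\int[p]_(x in D) ((1 + eta)%:E * (sqdist x u)%:E + (eps / 2)%:E))).
  apply: ge0_le_integral_nonmeasurable => x _; first by rewrite lee_fin sqdist_ge0.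
  rewrite -EFinM -EFinD lee_fin; apply: le_trans (sqdist_young x u _ eta0) _.
  rewrite lerD2l; apply: le_trans (ler_wpM2l (ltW c0) hn) _.
  rewrite le_eqVlt; apply/orP; left; apply/eqP; field.
  by rewrite (gt_eqF eta0)/= gt_eqF//; lra.
have ms : measurable_fun D (fun x => (sqdist x u)%:E : \bar R).
  by apply: measurable_funTS; exact: measurable_sqdist.
have e10 : (0 <= 1 + eta)%R by rewrite addr_ge0// ltW.
rewrite ge0_integralD//; last 3 first.
- by move=> x _; rewrite mule_ge0// lee_fin sqdist_ge0.
- exact: measurable_funeM.
- by move=> x _; rewrite lee_fin divr_ge0// ltW.
rewrite ge0_integralZl_EFin//; last by move=> x _; rewrite lee_fin sqdist_ge0.
rewrite E integral_cst// -EFinM.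
apply: (@le_trans _ _ (((1 + eta) * I)%:E + (eps / 2)%:E * 1)).
  rewrite leeD2l// lee_wpmul2l// ?lee_fin ?divr_ge0 ?(ltW eps0)//.
  apply: le_trans (@sprobability_setT _ _ _ p); by rewrite le_measure// ?inE.
rewrite mule1 -!EFinD lee_fin mulrDl mul1r -addrA lerD2l.
have : (eta * I <= eps / 2)%R.
  rewrite /eta mulrAC ler_pdivrMr ?mulr_gt0 ?ltr_wpDl//.
  have : (0 <= eps * I)%R by rewrite mulr_ge0// ltW.
  lra.
lra.
Qed.

Lemma measurable_qcost dZ (Z : measurableType dZ) (kap : Z -> BS) (Q : Z -> X -> 'I_M) :
  measurable_fun setT kap -> (forall i, measurable [set z : (Z * X)%type | Q z.1 z.2 = i]) ->
  measurable_fun setT (fun z => qcost (kap z) (Q z)).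
Proof.
move=> mk mQ; apply: emeasurable_sum => i.
have msec z : measurable (cell (Q z) i).
  rewrite (_ : cell _ _ = xsection [set z : (Z * X)%type | Q z.1 z.2 = i] z).
    exact: measurable_xsection.
  by apply/seteqP; split => x; rewrite /xsection/= inE.
pose F n z := \int[kap z]_x ((sqdist x (rat_point n))%:E * (\1_(cell (Q z) i) x)%:E).
rewrite (_ : (fun z => _) = fun z => einfs (F^~ z) 0%N); last first.
  apply/funext => z; rewrite -/(cost0 (kap z) (cell (Q z) i)) cost0_rational//.
  rewrite /einfs; congr ereal_inf; apply/seteqP; split => _ [n _ <-]; exists n => //.
    rewrite /F [RHS]integral_mkcond; apply: eq_integral => x _; rewrite /patch indicE.
    by case: (x \in _); rewrite ?mule1 ?mule0.
  rewrite /F [LHS]integral_mkcond; apply: eq_integral => x _; rewrite /patch indicE.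
  by case: (x \in _); rewrite ?mule1 ?mule0.
apply: measurable_fun_einfs => n.
pose h (z : (Z * X)%type) := (sqdist z.2 (rat_point n))%:E *
  (\1_[set z : (Z * X)%type | Q z.1 z.2 = i] z)%:E : \bar R.
have mh : measurable_fun setT h.
  apply: emeasurable_funM; last by apply/measurable_EFinP; exact: measurable_indic.
  apply: (@measurableT_comp _ _ _ _ _ _ (fun x => (sqdist x (rat_point n))%:E : \bar R) _ snd).
    exact: measurable_sqdist.
  exact: measurable_snd.
have h0 z : 0 <= h z by rewrite mule_ge0// lee_fin sqdist_ge0.
apply: eq_measurable_fun (measurable_int_param mk mh h0) => z _.
apply: eq_integral => x _; rewrite /h/= !indicE; congr (_ * _%:R%:E); congr nat_of_bool.
Qed.

End CostMeasurability.

(** * Almost sure equality, event by event *)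

Section AlmostSureTransfer.
Local Open Scope ereal_scope.
Context {R : realType} {dO : measure_display} {O : measurableType dO}.
Variables (P : probability O R) (D : set O).

(** The events to which [a] and [b] almost surely belong together form a sigma-algebra. The null set
    may depend on the event; no equality of [a] and [b] off a single null set is claimed. *)
Lemma ae_mem_generated (T : Type) (G : set (set T)) (a b : O -> T) :
  (forall E, G E -> {ae P, forall o, D o -> (E (a o) <-> E (b o))}) ->
  forall E, <<s G >> E -> {ae P, forall o, D o -> (E (a o) <-> E (b o))}.
Proof.
move=> HG; apply: smallest_sub => //; split.
- exact: aeW.
- move=> E hE; apply: filterS hE => o h Do; have := h Do => -[h1 h2].
  by split=> -[_ nE]; split=> // e; apply: nE; [exact: h2|exact: h1].
- move=> E hE; have : {ae P, forall o n, D o -> (E n (a o) <-> E n (b o))}.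
    by apply: ae_foralln => n; exact: hE.
  apply: filterS => o h Do.
  by split=> -[n _ En]; exists n => //; apply/(h n Do).
Qed.

Lemma ae_mem_pair d1 d2 (T1 : measurableType d1) (T2 : measurableType d2)
    (a b : O -> T1) (c : O -> T2) :
  (forall E, measurable E -> {ae P, forall o, D o -> (E (a o) <-> E (b o))}) ->
  forall E : set (T1 * T2), measurable E ->
    {ae P, forall o, D o -> (E (a o, c o) <-> E (b o, c o))}.
Proof.
move=> h E; rewrite measurable_prod_measurableType => mE.
apply: (ae_mem_generated (a := fun o => (a o, c o)) (b := fun o => (b o, c o))) mE.
move=> _ [A mA [B mB <-]]; have := h A mA; apply: filterS => o ab /ab[h1 h2] /=.
by split=> -[]; split => //; [exact: h1|exact: h2].
Qed.

Lemma ae_mem_giry dX (X : measurableType dX) (a b : O -> giry X R) :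
  (forall E, measurable E -> {ae P, forall o, D o -> a o E = b o E}) ->
  forall S, measurable S -> {ae P, forall o, D o -> (S (a o) <-> S (b o))}.
Proof.
move=> h S mS.
apply: (ae_mem_generated (G := \bigcup_(A in measurable) preimg_giry_ev A)) mS.
move=> _ [A mA [B mB <-]]; have := h A mA; apply: filterS => o ab /ab /= e.
by rewrite /giry_ev e.
Qed.

Lemma ae_measure_eq (E F : set O) : measurable E -> measurable F -> E `<=` D -> F `<=` D ->
  {ae P, forall o, D o -> (E o <-> F o)} -> P E = P F.
Proof.
move=> mE mF ED FD [N [mN N0 hN]].
have le (E' F' : set O) : measurable E' -> measurable F' ->
    (forall o, ~ N o -> E' o -> F' o) -> P E' <= P F'.
  move=> mE' mF' h; apply: (@le_trans _ _ (P (F' `|` N))).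
    apply: le_measure; rewrite ?inE//; first exact: measurableU.
    by move=> o Eo; have [No|nN] := pselect (N o); [right|left; exact: h].
  by rewrite -[leRHS]adde0 -N0; exact: measureU2.
have ok o : ~ N o -> D o -> (E o <-> F o).
  by move=> nN; apply: contrapT => c; apply: nN; exact: hN.
apply/eqP; rewrite eq_le; apply/andP; split; apply: le => // o nN h.
  by apply/(ok o nN) => //; exact: ED.
by apply/(ok o nN) => //; exact: FD.
Qed.

End AlmostSureTransfer.

(** * Cylinder events of the driving variables *)

Section Cylinders.
Local Open Scope ereal_scope.
Context {R : realType} {dim k M : nat}.
Local Notation X := (dim.-tuple R).
Local Notation W := (k.-tuple R).
Local Notation BS := (giry X R).
Variables (f : X -> W -> X) (nu : probability W R).
Hypothesis mf : measurable_fun [set: (X * W)%type] (fun z => f z.1 z.2).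
Variables (mu0 : probability X R) (g : policy (R := R) (dim := dim) (M := M)).
Variables (dO : measure_display) (O : measurableType dO) (P : probability O R).
Variables (x : nat -> O -> X) (w : nat -> O -> W) (r : nat -> O -> R) (pi : nat -> O -> BS).
Hypothesis HR : realization f nu mu0 g P x w r pi.

Let mx0 : measurable_fun setT (x 0%N). Proof. by case: HR. Qed.
Let mw t : measurable_fun setT (w t). Proof. by case: HR => _ []. Qed.
Let mr t : measurable_fun setT (r t). Proof. by case: HR => _ [] _ []. Qed.
Let xS t o : x t.+1 o = f (x t o) (w t o). Proof. by case: HR => _ [_ [_ []]]. Qed.

Definition cyl (A : set X) (B : nat -> set W) (C : nat -> set R) : set O :=
  x 0%N @^-1` A `&` \bigcap_i (w i @^-1` B i) `&` \bigcap_i (r i @^-1` C i).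

(** The initial state and the noises before [t] are constrained together with the randomization at
    all times, later ones included. Only finitely many coordinates are constrained, so the joint law
    gives the probability, and the class is closed under intersection. *)
Definition past (t : nat) : set (set O) := [set E | exists A B C n,
  [/\ measurable A, forall i, measurable (B i) /\ measurable (C i),
      forall i, (t <= i)%N -> B i = setT, forall i, (n <= i)%N -> C i = setT & E = cyl A B C]].

Definition noise : set (set O) := [set E | exists C n,
  [/\ forall i, measurable (C i), forall i, (n <= i)%N -> C i = setT &
      E = cyl setT (fun=> setT) C]].

Lemma cyl_prob A B C n : measurable A -> (forall i, measurable (B i) /\ measurable (C i)) ->
  (forall i, (n <= i)%N -> B i = setT) -> (forall i, (n <= i)%N -> C i = setT) ->
  P (cyl A B C) = mu0 A * \prod_(i < n) nu (B i) *
    \prod_(i < n) (@lebesgue_measure R) (C i `&` `[0%R, 1%R]).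
Proof.
move=> mA mBC Bn Cn; case: HR => _ [_ [_ [_ [joint _]]]].
rewrite -joint//; last 2 first.
- by move=> i; case: (mBC i).
- by move=> i; case: (mBC i).
congr (P _); rewrite /cyl; congr (_ `&` _ `&` _); apply/seteqP; split => o h i /= _.
- exact: h.
- by have [ni|ni] := leqP n i; [rewrite Bn|exact: h].
- exact: h.
- by have [ni|ni] := leqP n i; [rewrite Cn|exact: h].
Qed.

Lemma cylI A B C A' B' C' : cyl A B C `&` cyl A' B' C' =
  cyl (A `&` A') (fun i => B i `&` B' i) (fun i => C i `&` C' i).
Proof.
apply/seteqP; split => o.
  move=> [[[h1 h2] h3] [[h1' h2'] h3']]; split => [|i _]; last first.
    by split; [exact: h3|exact: h3'].
  by split => // i _; split; [exact: h2|exact: h2'].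
move=> [[[h1 h1'] h2] h3]; split; (split; first split) => // i _.
- by case: (h2 i Logic.I).
- by case: (h3 i Logic.I).
- by case: (h2 i Logic.I).
- by case: (h3 i Logic.I).
Qed.

Lemma cylT : cyl setT (fun=> setT) (fun=> setT) = setT.
Proof. by apply/seteqP; split. Qed.

Lemma measurable_cyl A B C : measurable A -> (forall i, measurable (B i) /\ measurable (C i)) ->
  measurable (cyl A B C).
Proof.
move=> mA mBC; apply: measurableI; first apply: measurableI.
- by rewrite -[X in measurable X]setTI; exact: mx0.
- apply: bigcap_measurable => [|i _]; first by exists 0%N.
  by rewrite -[X in measurable X]setTI; apply: mw => //; case: (mBC i).
- apply: bigcap_measurable => [|i _]; first by exists 0%N.
  by rewrite -[X in measurable X]setTI; apply: mr => //; case: (mBC i).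
Qed.

Lemma past_setI t : setI_closed (past t).
Proof.
move=> _ _ [A [B [C [n [mA mBC Bt Cn ->]]]]] [A' [B' [C' [n' [mA' mBC' Bt' Cn' ->]]]]].
rewrite cylI.
exists (A `&` A'), (fun i => B i `&` B' i), (fun i => C i `&` C' i), (maxn n n'); split => //.
- exact: measurableI.
- by move=> i; have [? ?] := mBC i; have [? ?] := mBC' i; split; exact: measurableI.
- by move=> i ti; rewrite Bt// Bt'// setIT.
- by move=> i; rewrite geq_max => /andP[? ?]; rewrite Cn// Cn'// setIT.
Qed.

Lemma noise_setI : setI_closed noise.
Proof.
move=> _ _ [C [n [mC Cn ->]]] [C' [n' [mC' Cn' ->]]].
exists (fun i => C i `&` C' i), (maxn n n'); split.
- by move=> i; exact: measurableI.
- by move=> i; rewrite geq_max => /andP[? ?]; rewrite Cn// Cn'// setIT.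
- by rewrite cylI setIT; congr cyl; apply/funext => i; rewrite setIT.
Qed.

Lemma past_setT t : past t setT.
Proof. by exists setT, (fun=> setT), (fun=> setT), 0%N; split => //; rewrite cylT. Qed.

Lemma noise_setT : noise setT.
Proof. by exists (fun=> setT), 0%N; split => //; rewrite cylT. Qed.

Lemma past_measurable t : past t `<=` measurable.
Proof. by move=> _ [A [B [C [n [mA mBC _ _ ->]]]]]; exact: measurable_cyl. Qed.

Lemma noise_measurable : noise `<=` measurable.
Proof. by move=> _ [C [n [mC _ ->]]]; exact: measurable_cyl. Qed.

Lemma noise_past t : noise `<=` past t.
Proof.
move=> _ [C [n [mC Cn ->]]]; exists setT, (fun=> setT), C, n; split => //.
Qed.

Lemma past_leq s t : (s <= t)%N -> past s `<=` past t.
Proof.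
move=> st _ [A [B [C [n [mA mBC Bs Cn ->]]]]]; exists A, B, C, n; split => // i ti.
by apply: Bs; exact: leq_trans ti.
Qed.

Let leb01 : (@lebesgue_measure R) (setT `&` `[0%R, 1%R]) = 1.
Proof. by rewrite setTI lebesgue_measure_itv/= lte_fin ltr01 oppr0 adde0. Qed.

Lemma initial_indep C A : noise C -> measurable A -> P (C `&` x 0%N @^-1` A) = P C * mu0 A.
Proof.
move=> [c [n [mc cn ->]]] mA.
rewrite (_ : _ `&` _ = cyl A (fun=> setT) c); last first.
  by apply/seteqP; split => o; [case=> -[[]]|case=> -[]].
rewrite !(cyl_prob (n := n))//; try by move=> i; split.
have -> : \prod_(i < n) nu setT = 1 by rewrite big1// => i _; exact: probability_setT.
by rewrite [X in _ = X * _ * _ * _]probability_setT !mule1 mul1e muleC.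
Qed.

Lemma next_indep t C A : past t C -> measurable A -> P (C `&` w t @^-1` A) = P C * nu A.
Proof.
move=> [a [b [c [n [ma mbc bt cn ->]]]]] mA.
pose b' i := if i == t then A else b i.
have mb' i : measurable (b' i) /\ measurable (c i).
  by have [? ?] := mbc i; rewrite /b'; case: ifP.
pose N := (maxn n t).+1.
have cN i : (N <= i)%N -> c i = setT.
  by move=> Ni; apply: cn; apply: leq_trans Ni; apply: leqW; exact: leq_maxl.
have bN i : (N <= i)%N -> b i = setT.
  by move=> Ni; apply: bt; apply: leq_trans Ni; apply: leqW; exact: leq_maxr.
have tN : (t < N)%N by rewrite ltnS leq_maxr.
have b'N i : (N <= i)%N -> b' i = setT.
  by move=> Ni; rewrite /b' bN//; case: eqP => // it; move: Ni; rewrite it leqNgt tN.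
rewrite (_ : _ `&` _ = cyl a b' c); last first.
  apply/seteqP; split => o.
    move=> [[[h1 h2] h3] h4]; split => //; split => // i _.
    by rewrite /b'; case: eqP => [->//|_]; exact: h2.
  move=> [[h1 h2] h3]; split; last by have := h2 t Logic.I; rewrite /b' eqxx.
  split => //; split => // i _; have := h2 i Logic.I; rewrite /b'; case: eqP => // -> _.
  by rewrite bt.
rewrite !(cyl_prob (n := N))// (bigD1 (Ordinal tN))//= [in RHS](bigD1 (Ordinal tN))//=.
rewrite {1}/b' eqxx bt// [X in _ = _ * (X * _) * _ * _]probability_setT mul1e.
rewrite [X in _ * (_ * X) * _ = _](eq_bigr (fun i : 'I_N => nu (b i))); last first.
  move=> i it; rewrite /b'; case: eqP => // e; move: it.
  by rewrite -(inj_eq val_inj)/= e eqxx.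
by rewrite -!muleA; congr (_ * _); rewrite [LHS]muleC -muleA.
Qed.

Lemma noise_r t (B : set R) : measurable B -> noise (r t @^-1` B).
Proof.
move=> mB; exists (fun i => if i == t then B else setT), t.+1; split.
- by move=> i; case: ifP.
- by move=> i ti; case: eqP => // e; move: ti; rewrite e ltnn.
- apply/seteqP; split => o /=; last by case=> _ /(_ t Logic.I); rewrite /= eqxx.
  by move=> h; split => // i _ /=; case: eqP => // ->.
Qed.

Lemma past_w s t (B : set W) : (s < t)%N -> measurable B -> past t (w s @^-1` B).
Proof.
move=> st mB; exists setT, (fun i => if i == s then B else setT), (fun=> setT), 0%N; split => //.
- by move=> i; split => //; case: ifP.
- by move=> i ti; case: eqP => // e; move: ti; rewrite e leqNgt st.
- apply/seteqP; split => o /=; last by case=> [[_ /(_ s Logic.I)]]; rewrite /= eqxx.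
  by move=> h; split => //; split => // i _ /=; case: eqP => // ->.
Qed.

Lemma past_x0 t (A : set X) : measurable A -> past t (x 0%N @^-1` A).
Proof.
move=> mA; exists A, (fun=> setT), (fun=> setT), 0%N; split => //.
by apply/seteqP; split => o /=; [|case=> -[]].
Qed.

Lemma past_fun_r t s : measurable_fun setT (r s : g_sigma_algebraType (past t) -> R).
Proof.
move=> _ B mB; rewrite setTI; apply: sub_gen_smallest; apply: noise_past; exact: noise_r.
Qed.

Lemma noise_fun_r s : measurable_fun setT (r s : g_sigma_algebraType noise -> R).
Proof. by move=> _ B mB; rewrite setTI; apply: sub_gen_smallest; exact: noise_r. Qed.

Lemma past_fun_x t s : (s <= t)%N ->
  measurable_fun setT (x s : g_sigma_algebraType (past t) -> X).
Proof.
elim: s => [|s IH] st.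
  by move=> _ B mB; rewrite setTI; apply: sub_gen_smallest; exact: past_x0.
rewrite (_ : x s.+1 = fun o => f (x s o) (w s o)); last by apply/funext => o; exact: xS.
apply: (@measurableT_comp _ _ _ _ _ _ (fun z => f z.1 z.2) _
  (fun o : g_sigma_algebraType (past t) => (x s o, w s o))) => //.
apply: measurable_fun_pair; first by apply: IH; exact: ltnW.
by move=> _ B mB; rewrite setTI; apply: sub_gen_smallest; exact: past_w.
Qed.

End Cylinders.

Section MeasurableTree.
Local Open Scope ereal_scope.
Context {R : realType} {dim k M : nat}.
Local Notation X := (dim.-tuple R).
Local Notation W := (k.-tuple R).
Local Notation BS := (giry X R).
Local Notation cquant := (@cquant R dim M).
Local Notation hist := (seq 'I_M).
Variables (f : X -> W -> X) (nu : probability W R).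
Hypothesis mf : measurable_fun [set: (X * W)%type] (fun z => f z.1 z.2).
Variables (mu0 : BS) (g : policy (R := R) (dim := dim) (M := M)).
Hypothesis adm : admissible g.

(** A realised sequence [rho] of randomizations turns the policy into deterministic quantizers. *)
Definition frozen (rho : nat -> R) (t : nat) (p : BS) : cquant :=
  exist _ (g t p (rho t)) (adm.1 t p (rho t)).

Lemma measurable_indicE d (T : measurableType d) (E : set T) : measurable E ->
  measurable_fun setT (fun y => (\1_E y)%:E : \bar R).
Proof. by move=> mE; apply/measurable_EFinP; exact: measurable_indic. Qed.

Lemma integral_restrict_indic d (T : measurableType d) (mu : {measure set T -> \bar R})
    (D : set T) (h : T -> \bar R) :
  \int[mu]_(y in D) h y = \int[mu]_y ((\1_D y)%:E * h y).
Proof.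
rewrite integral_mkcond; apply: eq_integral => y _; rewrite /patch indicE.
by case: (_ \in _); rewrite ?mul1e ?mul0e.
Qed.

Lemma measurable_quantized dZ (Z : measurableType dZ) t (i : 'I_M) (kap : Z -> BS) (rho : Z -> R)
    (zeta : Z -> X) : measurable_fun setT kap -> measurable_fun setT rho ->
  measurable_fun setT zeta -> measurable [set z | g t (kap z) (rho z) (zeta z) = i].
Proof.
move=> mk mr mz; have mE := adm.2 t i.
have mp : measurable_fun setT (fun z => ((kap z, rho z), zeta z)).
  by apply: measurable_fun_pair => //; exact: measurable_fun_pair.
by have := mp measurableT _ mE; rewrite setTI.
Qed.

Lemma updqE (p : BS) (Q : cquant) i E : measurable E ->
  updq nu mf p (sval Q) i E = \int[p]_(x in cell (sval Q) i) markov_op f nu (fun y => (\1_E y)%:E) x.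
Proof.
move=> mE; rewrite -int_updq//; first by rewrite integral_indic// setIT.
exact: measurable_indicE.
Qed.

(** Only the randomizations before time [size h] enter, which makes the belief measurable for the
    information available at that time. *)
Lemma measurable_node dZ (Z : measurableType dZ) (rho : nat -> Z -> R) (h : hist) :
  (forall s, (s < size h)%N -> measurable_fun setT (rho s)) ->
  measurable_fun setT (fun z => node nu mf mu0 (frozen (rho^~ z)) h).
Proof.
elim: h => [|i h IH] mrho /=; first exact: measurable_cst.
have mn : measurable_fun setT (fun z => node nu mf mu0 (frozen (rho^~ z)) h).
  by apply: IH => s sh; apply: mrho => /=; exact: ltnW.
have mnn : measurable_fun setT (fun z => normalize (node nu mf mu0 (frozen (rho^~ z)) h)).
  by apply: (measurableT_comp _ mn); exact: measurable_normalize.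
apply: measurable_giry_codensity => // B mB.
pose E : set (Z * X) := [set z | g (size h) (normalize (node nu mf mu0 (frozen (rho^~ z.1)) h))
  (rho (size h) z.1) z.2 = i].
have mE : measurable E.
  apply: (@measurable_quantized _ (Z * X)%type (size h) i
    (fun z => normalize (node nu mf mu0 (frozen (rho^~ z.1)) h)) (fun z => rho (size h) z.1) snd) => //.
  - exact: (measurableT_comp mnn).
  - by apply: (measurableT_comp (mrho _ _)) => //=.
have mP : measurable_fun setT (markov_op f nu (fun y : X => (\1_B y)%:E)).
  by apply: measurable_markov_op => //; exact: measurable_indicE.
pose F (z : (Z * X)%type) := (\1_E z)%:E * markov_op f nu (fun y : X => (\1_B y)%:E) z.2.
have P0 y : 0 <= markov_op f nu (fun y : X => (\1_B y)%:E) y by exact: markov_op_ge0.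
have mF : measurable_fun setT F.
  apply: emeasurable_funM; first exact: measurable_indicE.
  by apply: (measurableT_comp mP); exact: measurable_snd.
have F0 z : 0 <= F z by rewrite mule_ge0.
apply: eq_measurable_fun (measurable_int_param mn mF F0) => z _ /=.
set N := node _ _ _ _ h; pose Q := frozen (rho^~ z) (size h) (normalize N).
apply/esym; transitivity (updq nu mf N (sval Q) i B) => //.
rewrite updqE// integral_restrict_indic; apply: eq_integral => y _; rewrite /F /=.
congr (_ * _); rewrite !indicE; congr (_%:R%:E); congr nat_of_bool.
Qed.

End MeasurableTree.

Lemma integral_lt_null {R : realType} d (T : measurableType d) (P : probability T R) (G : set T)
    (a b : T -> \bar R) : measurable G -> measurable_fun setT a -> measurable_fun setT b ->
  (forall x, 0 <= a x <= 1)%E -> (forall x, 0 <= b x <= 1)%E ->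
  (forall x, G x -> (a x < b x)%E) ->
  (\int[P]_(x in G) a x = \int[P]_(x in G) b x)%E -> P G = 0%E.
Proof.
move=> mG ma mb a01 b01 lt ab.
have af x : a x \is a fin_num.
  by have /andP[h1 h2] := a01 x; rewrite ge0_fin_numE//; apply: le_lt_trans h2 _; exact: ltry.
have d0 x : G x -> (0 <= b x - a x)%E by move=> Gx; rewrite sube_ge0 ?af// ltW// lt.
have md : measurable_fun G (fun x => b x - a x)%E.
  by apply: emeasurable_funB; exact: measurable_funTS.
have I : (\int[P]_(x in G) (b x - a x) = 0)%E.
  have E : (\int[P]_(x in G) b x = \int[P]_(x in G) a x + \int[P]_(x in G) (b x - a x))%E.
    rewrite -ge0_integralD//.
    - by apply: eq_integral => x _; rewrite addeC subeK.
    - by move=> x _; have /andP[] := a01 x.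
    - exact: measurable_funTS.
  have fin : (\int[P]_(x in G) a x)%E \is a fin_num.
    rewrite ge0_fin_numE; last by apply: integral_ge0 => x _; have /andP[] := a01 x.
    apply: (@le_lt_trans _ _ (\int[P]_(x in G) (cst 1 x))%E).
      by apply: ge0_le_integral_nonmeasurable => x _; have /andP[] := a01 x.
    rewrite integral_cst// mul1e; apply: le_lt_trans (probability_le1 P mG) _; exact: ltry.
  move: E fin; rewrite -ab; set J := (\int[P]_(x in G) (b x - a x))%E.
  have J0 : (0 <= J)%E by apply: integral_ge0.
  case: (\int[P]_(x in G) a x)%E => // c; case: J J0 => //= u u0 [e] _.
  by congr (_%:E); lra.
have abs0 : (\int[P]_(x in G) `|b x - a x| = 0)%E.
  by rewrite -[RHS]I; apply: eq_integral => x /set_mem Gx; rewrite gee0_abs// d0.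
have [N [mN N0 hN]] := (ae_eq_integral_abs P mG md).1 abs0.
apply/eqP; rewrite eq_le measure_ge0 andbT -N0; apply: le_measure; rewrite ?inE// => x Gx.
apply: hN => /= /(_ Gx) e; have := lt x Gx; rewrite -(subeK (b x) (af x)) e add0e.
by rewrite ltxx.
Qed.

(** * Beliefs as functions of the symbols and the randomization *)

Section Representation.
Local Open Scope ereal_scope.
Context {R : realType} {dim k M : nat}.
Local Notation X := (dim.-tuple R).
Local Notation W := (k.-tuple R).
Local Notation BS := (giry X R).
Local Notation cquant := (@cquant R dim M).
Local Notation hist := (seq 'I_M).
Variables (f : X -> W -> X) (nu : probability W R).
Hypothesis mf : measurable_fun [set: (X * W)%type] (fun z => f z.1 z.2).
Variables (mu0 : probability X R) (g : policy (R := R) (dim := dim) (M := M)).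
Hypothesis adm : admissible g.
Variables (dO : measure_display) (O : measurableType dO) (P : probability O R).
Variables (x : nat -> O -> X) (w : nat -> O -> W) (r : nat -> O -> R) (pi : nat -> O -> BS).
Hypothesis HR : realization f nu mu0 g P x w r pi.

Let mx0 : measurable_fun setT (x 0%N). Proof. by case: HR. Qed.
Let mw t : measurable_fun setT (w t). Proof. by case: HR => _ []. Qed.
Let xS t o : x t.+1 o = f (x t o) (w t o). Proof. by case: HR => _ [_ [_ []]]. Qed.
Let pi_info t B : measurable B -> info g x r pi t (pi t @^-1` B).
Proof. by move=> mB; case: HR => _ [_ [_ [_ [_ [_ []]]]]] h _; exact: h. Qed.
Let cond t A G : measurable A -> info g x r pi t G ->
  P (G `&` x t @^-1` A) = \int[P]_(o in G) pi t o A.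
Proof. by move=> mA iG; case: HR => _ [_ [_ [_ [_ [_ [_ h]]]]]]; exact: h. Qed.

Local Notation past := (past x w r).
Local Notation noise := (noise x w r).
Local Notation info := (info g x r pi).
Local Notation qsym := (qsym g x r pi).
Local Notation nd := (fun o h => node nu mf (mu0 : BS) (frozen adm (r^~ o)) h).

Let past_meas t : <<s past t>> `<=` measurable.
Proof. by apply: generated_measurable => //; exact: (past_measurable HR). Qed.

Let noise_meas : <<s noise>> `<=` measurable.
Proof. by apply: generated_measurable => //; exact: (noise_measurable HR). Qed.

Let noise_sub_past t : <<s noise>> `<=` <<s past t>>.
Proof.
apply: sub_smallest2r; first exact: smallest_sigma_algebra.
exact: noise_past.
Qed.

Lemma past_qsym s t i : info s `<=` <<s past t>> -> (s <= t)%N ->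
  <<s past t>> [set o | qsym s o = i].
Proof.
move=> is_ st.
have := @measurable_quantized R dim M g adm _ (g_sigma_algebraType (past t)) s i (pi s) (r s) (x s).
apply.
- by move=> _ B mB; rewrite setTI; apply: is_; exact: pi_info.
- exact: past_fun_r.
- exact: (past_fun_x mf HR).
Qed.

(** Symbols depend on beliefs, which in turn depend on earlier information, hence the strong
    induction. *)
Lemma info_past t : info t `<=` <<s past t>>.
Proof.
elim/ltn_ind: t => t IH; apply: smallest_sub; first exact: smallest_sigma_algebra.
move=> E [s st [[i ->]|[B mB ->]]].
  apply: past_qsym; last exact: ltnW.
  apply: subset_trans (IH s st) _; apply: sub_smallest2r; first exact: smallest_sigma_algebra.
  by apply: past_leq; exact: ltnW.
by apply: sub_gen_smallest; apply: noise_past; exact: noise_r.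
Qed.

Let info_meas t E : info t E -> measurable E.
Proof. by move=> /info_past; exact: past_meas. Qed.

Fixpoint observed (h : hist) : set O :=
  if h is i :: h' then observed h' `&` [set o | qsym (size h') o = i] else setT.

Let infoI t A B : info t A -> info t B -> info t (A `&` B).
Proof. exact: (@measurableI _ (g_sigma_algebraType _)). Qed.

Lemma observed_info h t : (size h <= t)%N -> info t (observed h).
Proof.
elim: h => [|i h IH] /= ht; first exact: (@measurableT _ (g_sigma_algebraType _)).
apply: infoI; first by apply: IH; exact: ltnW.
by apply: sub_gen_smallest; exists (size h) => //; left; exists i.
Qed.

Lemma observed_past h t : (size h <= t)%N -> <<s past t>> (observed h).
Proof. by move=> ht; apply: info_past; exact: observed_info. Qed.

Lemma measurable_observed h : measurable (observed h).
Proof. by apply: (@past_meas (size h)); exact: observed_past. Qed.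

Let measurable_x t : measurable_fun setT (x t).
Proof.
move=> _ B mB; rewrite setTI; apply: (@past_meas t).
by have := past_fun_x mf HR (leqnn t) measurableT mB; rewrite setTI.
Qed.

Lemma observed_sym h s : (s < size h)%N -> exists i, forall o, observed h o -> qsym s o = i.
Proof.
elim: h => [//|i h IH] /=; rewrite ltnS leq_eqVlt => /orP[/eqP ->|sh].
  by exists i => o [].
by have [j hj] := IH sh; exists j => o [/hj].
Qed.

(* Given the observed symbols, the information at time [t] reduces to that carried by the
   randomization. *)
Lemma info_trace h G : info (size h) G ->
  exists2 C, <<s noise>> C & G `&` observed h = C `&` observed h.
Proof.
suff: info (size h) `<=`
    [set G | exists2 C, <<s noise>> C & G `&` observed h = C `&` observed h] by exact.
apply: smallest_sub; first split.
- by exists set0 => //; exact: sigma_algebra0.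
- move=> A [C mC e]; exists (setT `\` C); first exact: sigma_algebraCD.
  apply/seteqP; split => o [[_ n] ob]; split => //; split => // c; apply: n.
    by have [] : (A `&` observed h) o by rewrite e.
  by have [] : (C `&` observed h) o by rewrite -e.
- move=> F hF; have /choice[C hC] : forall n, exists C,
      <<s noise>> C /\ F n `&` observed h = C `&` observed h.
    by move=> n; have [C ? ?] := hF n; exists C.
  exists (\bigcup_n C n); first by apply: sigma_algebra_bigcup => n; case: (hC n).
  by rewrite !setI_bigcupl; apply: eq_bigcupr => n _; case: (hC n).
- move=> E [s st [[i ->]|[B mB ->]]]; last first.
    by exists (r s @^-1` B) => //; apply: sub_gen_smallest; exact: noise_r.
  have [j hj] := observed_sym st; have [->|ij] := eqVneq i j.
    exists setT; first by apply: sub_gen_smallest; exact: noise_setT.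
    by apply/seteqP; split => o [_ ob]; split => //; exact: hj.
  exists set0; first exact: sigma_algebra0.
  rewrite set0I; apply/seteqP; split => // o [/= qi ob].
  by move: ij; rewrite -qi hj// eqxx.
Qed.

(* Given the randomization, [node] is the joint law of the event [observed h] and the current state. *)
Definition represented (h : hist) := forall C A, <<s noise>> C -> measurable A ->
  P (observed h `&` C `&` x (size h) @^-1` A) = \int[P]_(o in C) nd o h A.

Lemma noise_node h : measurable_fun setT (fun o : g_sigma_algebraType noise => nd o h).
Proof.
apply: (@measurable_node R dim k M f nu mf mu0 g adm _ (g_sigma_algebraType noise) r).
by move=> s _; exact: noise_fun_r.
Qed.

Lemma past_node h t : measurable_fun setT (fun o : g_sigma_algebraType (past t) => nd o h).
Proof.
apply: (@measurable_node R dim k M f nu mf mu0 g adm _ (g_sigma_algebraType (past t)) r).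
by move=> s _; exact: past_fun_r.
Qed.

Lemma info_node h : measurable_fun setT (fun o : g_sigma_algebraType
  [set E | exists2 s, (s < size h)%N & ((exists i : 'I_M, E = [set o | qsym s o = i]) \/
          (exists2 B : set R, measurable B & E = r s @^-1` B))] => nd o h).
Proof.
apply: (@measurable_node R dim k M f nu mf mu0 g adm _ (g_sigma_algebraType _) r).
move=> s sh _ B mB; rewrite setTI; apply: sub_gen_smallest; exists s => //.
by right; exists B.
Qed.

Section Step.
Variable h : hist.
Hypothesis rep : represented h.
Local Notation t := (size h).
Local Notation bel := (fun o => normalize (nd o h)).

Lemma observed_integral (F : (g_sigma_algebraType noise * X)%type -> \bar R) :
  measurable_fun setT F -> (forall z, 0 <= F z) ->
  \int[P]_(o in observed h) F (o, x t o) = \int[P]_o \int[nd o h]_y F (o, y).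
Proof.
move=> mF F0; apply: (@disintegration R _ _ _ O (g_sigma_algebraType noise) X P (observed h) id
  (x t) (fun o => nd o h)) => //.
- exact: measurable_observed.
- by move=> _ B mB; rewrite setTI; exact: noise_meas.
- exact: noise_node.
Qed.

Let noise_bel : measurable_fun setT (bel : g_sigma_algebraType noise -> BS).
Proof. by apply: (measurableT_comp measurable_normalize); exact: noise_node. Qed.

(** [G] is the trace on [observed h] of a noise event. Both sides are then the probability of [G]
    together with [x t] in [A]: one by the conditioning property of [pi], the other by [rep] and
    disintegration. *)
Lemma belief_integral A G : measurable A -> info t G -> G `<=` observed h ->
  \int[P]_(o in G) pi t o A = \int[P]_(o in G) bel o A.
Proof.
move=> mA iG Gob; have [C mC e] := info_trace iG.
have eG : G = observed h `&` C by rewrite setIC -e; apply/esym/setIidPl.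
rewrite -cond// [in LHS]eG rep//.
have mbA : measurable_fun setT (fun o : g_sigma_algebraType noise => bel o A).
  exact: (measurableT_comp (@measurable_giry_ev _ X R A mA) noise_bel).
pose F (z : (g_sigma_algebraType noise * X)%type) := (\1_C z.1)%:E * bel z.1 A.
have mF : measurable_fun setT F.
  apply: emeasurable_funM; last exact: (measurableT_comp mbA).
  apply: (@measurableT_comp _ _ _ _ _ _ (fun o : g_sigma_algebraType noise => (\1_C o)%:E : \bar R)
    _ fst) => //.
  exact: measurable_indicE.
have F0 z : 0 <= F z by rewrite mule_ge0.
transitivity (\int[P]_(o in observed h) F (o, x t o)); last first.
  rewrite [LHS]integral_restrict_indic [RHS]integral_restrict_indic eG.
  apply: eq_integral => o _; rewrite /F /= muleA -EFinM; congr (_%:E * _).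
  by rewrite !indicE in_setI -natrM mulnb.
rewrite observed_integral// integral_restrict_indic; apply: eq_integral => o _.
rewrite /F /= integral_cst// -muleA; congr (_ * _).
by rewrite [RHS]muleC mul_normalize.
Qed.

(** The two events where one side is strictly smaller belong to the information, so
    [belief_integral] applies on them and makes them null. *)
Lemma belief_ae A : measurable A -> {ae P, forall o, observed h o -> pi t o A = bel o A}.
Proof.
move=> mA; pose IT := g_sigma_algebraType
  [set E | exists2 s, (s < size h)%N & ((exists i : 'I_M, E = [set o | qsym s o = i]) \/
          (exists2 B : set R, measurable B & E = r s @^-1` B))].
have mev := @measurable_giry_ev _ X R A mA.
have ma : measurable_fun setT (fun o : IT => pi t o A).
  have mpi : measurable_fun setT (pi t : IT -> BS).
    by move=> _ B mB; rewrite setTI; exact: pi_info.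
  exact: (measurableT_comp mev mpi).
have mb : measurable_fun setT (fun o : IT => bel o A).
  have mbel : measurable_fun setT (bel : IT -> BS).
    by apply: (measurableT_comp measurable_normalize); exact: info_node.
  exact: (measurableT_comp mev mbel).
have down (a : O -> \bar R) : measurable_fun setT (a : IT -> \bar R) -> measurable_fun setT a.
  move=> ma' _ B mB; apply: (info_meas (t := t)); exact: (ma' measurableT B mB).
have u01 (p : BS) : 0 <= p A <= 1.
  rewrite measure_ge0/=; apply: le_trans (@sprobability_setT _ _ _ p).
  by apply: le_measure; rewrite ?inE.
have obm : @measurable _ IT (observed h) by exact: observed_info.
pose G1 := observed h `&` [set o | pi t o A < bel o A].
pose G2 := observed h `&` [set o | bel o A < pi t o A].
have iG1 : info t G1.
  apply: infoI; first exact: observed_info.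
  by have := measurable_lte measurableT ma mb; rewrite setTI.
have iG2 : info t G2.
  apply: infoI; first exact: observed_info.
  by have := measurable_lte measurableT mb ma; rewrite setTI.
have n1 : P G1 = 0.
  apply: (@integral_lt_null _ _ _ P G1 (fun o => pi t o A) (fun o => bel o A)) => //.
  - exact: (info_meas (t := t)).
  - exact: down.
  - exact: down.
  - by move=> o [].
  - by apply: belief_integral => // o [].
have n2 : P G2 = 0.
  apply: (@integral_lt_null _ _ _ P G2 (fun o => bel o A) (fun o => pi t o A)) => //.
  - exact: (info_meas (t := t)).
  - exact: down.
  - exact: down.
  - by move=> o [].
  - by apply/esym/belief_integral => // o [].
exists (G1 `|` G2); split.
- by apply: measurableU; [exact: info_meas iG1|exact: info_meas iG2].
- by rewrite measureU0//; [exact: info_meas iG1|exact: info_meas iG2].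
- move=> o /=; rewrite not_implyE => -[ob neq].
  have [lt|gt|//] := ltgtP (pi t o A) (bel o A); first by left.
  by right.
Qed.

Lemma belief_ae_mem (S : set (BS * R)) : measurable S ->
  {ae P, forall o, observed h o -> (S (pi t o, r t o) <-> S (bel o, r t o))}.
Proof.
move=> mS; apply: ae_mem_pair => // E mE; apply: ae_mem_giry => // A mA; exact: belief_ae.
Qed.

Lemma belief_ae_mem3 (S : set ((BS * R) * X)) : measurable S ->
  {ae P, forall o, observed h o -> (S (pi t o, r t o, x t o) <-> S (bel o, r t o, x t o))}.
Proof.
move=> mS.
apply: (@ae_mem_pair _ _ _ P (observed h) _ _ _ _ (fun o => (pi t o, r t o))
  (fun o => (bel o, r t o)) (x t)) => // E mE; exact: belief_ae_mem.
Qed.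

Let past_bel : measurable_fun setT (bel : g_sigma_algebraType (past t) -> BS).
Proof. by apply: (measurableT_comp measurable_normalize); exact: past_node. Qed.

Let noise_r_fun : measurable_fun setT (r t : g_sigma_algebraType noise -> R).
Proof. exact: noise_fun_r. Qed.

(** The realised belief is replaced by [bel] up to a null set. Then [w t], independent of the past,
    is integrated out, and the current state is integrated with the help of [rep]. *)
Lemma represented_cons i : represented (i :: h).
Proof.
move=> C A mC mA.
pose E : set ((BS * R) * X) := [set z | g t z.1.1 z.1.2 z.2 = i].
have mE : measurable E by exact: adm.2.
pose PA := markov_op f nu (fun y : X => (\1_A y)%:E).
have mPA : measurable_fun setT PA by apply: measurable_markov_op => //; exact: measurable_indicE.
have PA0 y : 0 <= PA y by exact: markov_op_ge0.
(* Up to a null set the event [observed (i :: h)], but expressed through [bel]. *)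
pose S := observed h `&` [set o | E (bel o, r t o, x t o)].
have pS : <<s past t>> (S `&` C).
  apply: (@measurableI _ (g_sigma_algebraType (past t))); last exact: noise_sub_past.
  apply: (@measurableI _ (g_sigma_algebraType (past t))); first exact: observed_past.
  apply: (@measurable_quantized R dim M g adm _ (g_sigma_algebraType (past t)) t i bel (r t) (x t)).
  - exact: past_bel.
  - exact: past_fun_r.
  - exact: (past_fun_x mf HR).
have mSC := past_meas pS.
have mxA : measurable (x t.+1 @^-1` A).
  by rewrite -[X in measurable X]setTI; exact: measurable_x.
transitivity (P (S `&` C `&` x t.+1 @^-1` A)).
  apply: (ae_measure_eq (D := observed h)).
  - by apply: measurableI => //; apply: measurableI; [exact: measurable_observed|exact: noise_meas].
  - exact: measurableI.
  - by move=> o [[[]]].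
  - by move=> o [[[]]].
  - apply: filterS (belief_ae_mem3 mE) => o e ob; have [e1 e2] := e ob.
    by split=> -[[[ob' q] c] xa]; split => //; split => //; split => //; [exact: e1|exact: e2].
transitivity (\int[P]_o ((\1_(S `&` C) o)%:E * (\1_A (f (x t o) (w t o)))%:E)).
  transitivity (\int[P]_o (\1_(S `&` C `&` x t.+1 @^-1` A) o)%:E).
    by rewrite integral_indic// ?setIT//; exact: measurableI.
  apply: eq_integral => o _; rewrite !indicE in_setI -EFinM -natrM mulnb.
  congr (_%:R%:E); congr nat_of_bool; congr (_ && _); rewrite -xS.
  by apply/idP/idP; rewrite !inE.
pose F1 (z : (g_sigma_algebraType (past t) * W)%type) :=
  (\1_(S `&` C) z.1)%:E * (\1_A (f (x t z.1) z.2))%:E : \bar R.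
have mF1 : measurable_fun setT F1.
  apply: emeasurable_funM.
    apply: (@measurableT_comp _ _ _ _ _ _
      (fun o : g_sigma_algebraType (past t) => (\1_(S `&` C) o)%:E : \bar R) _ fst) => //.
    exact: measurable_indicE.
  apply: (@measurableT_comp _ _ _ _ _ _ (fun y : X => (\1_A y)%:E : \bar R) _
    (fun z : (g_sigma_algebraType (past t) * W)%type => f (x t z.1) z.2)).
    exact: measurable_indicE.
  apply: (@measurableT_comp _ _ _ _ _ _ (fun z => f z.1 z.2) _
    (fun z : (g_sigma_algebraType (past t) * W)%type => (x t z.1, z.2))) => //.
  apply: measurable_fun_pair => //.
  have mxt := past_fun_x mf HR (leqnn t).
  by apply: (measurableT_comp mxt); exact: measurable_fst.
have F10 z : 0 <= F1 z by rewrite mule_ge0.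
have := independence_integral (past_setI (x := x) (w := w) (r := r) (t := t))
  (past_setT x w r t) (past_measurable HR (t := t)) (mw t)
  (fun C A => next_indep HR (t := t) (C := C) (A := A)) mF1 F10.
rewrite /F1 /= => ->.
transitivity (\int[P]_o ((\1_(S `&` C) o)%:E * PA (x t o))).
  apply: eq_integral => o _; rewrite ge0_integralZl//.
  apply: (@measurableT_comp _ _ _ _ _ _ (fun y : X => (\1_A y)%:E : \bar R) _ (f (x t o))).
    exact: measurable_indicE.
  exact: (measurable_f1 mf).
pose F (z : (g_sigma_algebraType noise * X)%type) :=
  (\1_C z.1)%:E * ((\1_E (bel z.1, r t z.1, z.2))%:E * PA z.2) : \bar R.
have mF : measurable_fun setT F.
  apply: emeasurable_funM.
    apply: (@measurableT_comp _ _ _ _ _ _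
      (fun o : g_sigma_algebraType noise => (\1_C o)%:E : \bar R) _ fst) => //.
    exact: measurable_indicE.
  apply: emeasurable_funM; last exact: (measurableT_comp mPA).
  apply: (@measurableT_comp _ _ _ _ _ _ (fun z : (BS * R) * X => (\1_E z)%:E : \bar R) _
    (fun z : (g_sigma_algebraType noise * X)%type => (bel z.1, r t z.1, z.2))).
    exact: measurable_indicE.
  apply: measurable_fun_pair => //; apply: measurable_fun_pair.
    by apply: (measurableT_comp noise_bel); exact: measurable_fst.
  by apply: (measurableT_comp noise_r_fun); exact: measurable_fst.
have F0 z : 0 <= F z by rewrite !mule_ge0.
transitivity (\int[P]_(o in observed h) F (o, x t o)).
  rewrite [RHS]integral_restrict_indic; apply: eq_integral => o _; rewrite /F /= !muleA.
  congr (_ * _); rewrite -!EFinM !indicE in_setI -!natrM !mulnb; congr (_%:R%:E).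
  have -> : (o \in S) = (o \in observed h) && ((bel o, r t o, x t o) \in E).
    by rewrite in_setI; congr (_ && _); apply/idP/idP; rewrite !inE.
  by rewrite andbAC.
rewrite observed_integral// [RHS]integral_restrict_indic; apply: eq_integral => o _.
rewrite /F /= ge0_integralZl//; first congr (_ * _).
- pose Q := frozen adm (r^~ o) t (bel o).
  transitivity (updq nu mf (nd o h) (sval Q) i A) => //.
  rewrite updqE// [RHS]integral_restrict_indic; apply: eq_integral => y _; congr (_ * _).
- apply: emeasurable_funM => //.
  apply: (@measurableT_comp _ _ _ _ _ _ (fun z : (BS * R) * X => (\1_E z)%:E : \bar R) _
    (fun y : X => (bel o, r t o, y))).
    exact: measurable_indicE.
  exact: measurable_fun_pair.
- by move=> y _; rewrite mule_ge0.
Qed.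

(** The cost depends on the belief and the current randomization only. Once the belief is replaced
    by [bel], integrating over the state just produces the mass factor of [node_cost]. *)
Lemma observed_cost :
  \int[P]_(o in observed h) qcost (pi t o) (quant g r pi t o) =
  \int[P]_o node_cost nu mf mu0 (frozen adm (r^~ o)) h.
Proof.
pose psi (z : (BS * R)%type) := qcost z.1 (g t z.1 z.2).
have mpsi : measurable_fun setT psi by apply: measurable_qcost => // i; exact: adm.2.
have psi0 z : 0 <= psi z by exact: qcost_ge0.
have mpi : measurable_fun setT (pi t).
  by move=> _ B mB; rewrite setTI; apply: (info_meas (t := t)); exact: pi_info.
have mrt : measurable_fun setT (r t) by case: HR => _ [_ []].
have mbel : measurable_fun setT bel.
  move=> _ B mB; rewrite setTI; apply: noise_meas.
  by have := noise_bel measurableT mB; rewrite setTI.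
have mob := measurable_observed h.
transitivity (\int[P]_(o in observed h) psi (bel o, r t o)).
  apply: (ge0_integral_image_eq (a := fun o => (pi t o, r t o)) (b := fun o => (bel o, r t o))
    _ _ _ _ (h := psi)) => //; try exact: measurable_fun_pair.
  move=> E mE.
  have pre (c : O -> BS * R) : measurable_fun setT c -> measurable (observed h `&` c @^-1` E).
    by move=> mc; apply: measurableI => //; rewrite -[X in measurable X]setTI; exact: mc.
  apply: (ae_measure_eq (D := observed h)).
  - by apply: pre; exact: measurable_fun_pair.
  - by apply: pre; exact: measurable_fun_pair.
  - by move=> o [].
  - by move=> o [].
  - apply: filterS (belief_ae_mem mE) => o e ob; have [e1 e2] := e ob.
    by split=> -[ob' q]; split => //; [exact: e1|exact: e2].
pose pr (z : (g_sigma_algebraType noise * X)%type) := (bel z.1, r t z.1).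
have mpr : measurable_fun setT pr.
  apply: measurable_fun_pair.
    by apply: (measurableT_comp noise_bel); exact: measurable_fst.
  by apply: (measurableT_comp noise_r_fun); exact: measurable_fst.
pose F := psi \o pr.
have mF : measurable_fun setT F := measurableT_comp mpsi mpr.
rewrite (observed_integral mF)//; last by move=> z; exact: psi0.
apply: eq_integral => o _.
transitivity (\int[nd o h]_y (cst (psi (bel o, r t o)) y)) => //.
by rewrite integral_cst; [rewrite muleC|exact: measurableT].
Qed.

End Step.

Lemma represented_all h : represented h.
Proof.
elim: h => [|i h IH]; last exact: represented_cons.
move=> C A mC mA /=; rewrite setTI.
rewrite [LHS](generated_indep (noise_setI (x := x) (w := w) (r := r)) (noise_setT x w r)
  (noise_measurable HR) mx0 (fun C A => initial_indep HR (C := C) (A := A)) mC mA).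
rewrite [RHS]integral_cst; last exact: noise_meas.
exact: muleC.
Qed.

Lemma observed_partition t (F : O -> \bar R) : measurable_fun setT F -> (forall o, 0 <= F o) ->
  \int[P]_o F o = hsum t (fun h => \int[P]_(o in observed h) F o).
Proof.
move=> mF F0; elim: t => [//|t ->] /=; apply: eq_hsum => h _.
have mq i : measurable ([set o | qsym (size h) o = i]).
  by apply: (@past_meas (size h)); apply: past_qsym => //; exact: info_past.
rewrite -(@ge0_integral_bigsetU _ _ _ P _ (fun i => observed h `&` [set o | qsym (size h) o = i])
  F (index_enum 'I_M) _)//=.
- congr (integral _ _ _); apply/seteqP; split => o.
    by move=> ob; rewrite -bigcup_seq/=; exists (qsym (size h) o) => //=; rewrite mem_index_enum.
  by rewrite -bigcup_seq/= => -[i _ []].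
- by move=> i; apply: measurableI => //; exact: measurable_observed.
- exact: index_enum_uniq.
- by move=> i j _ _ [y [[_ hi] [_ hj]]]; rewrite -hi -hj.
- exact: measurable_funTS.
Qed.

Lemma measurable_policy_cost t :
  measurable_fun setT (fun z : (BS * R)%type => qcost z.1 (g t z.1 z.2)).
Proof. by apply: measurable_qcost => // i; exact: adm.2. Qed.

Let measurable_r t : measurable_fun setT (r t). Proof. by case: HR => _ [_ []]. Qed.

Lemma measurable_stage_cost t :
  measurable_fun setT (fun o => qcost (pi t o) (quant g r pi t o)).
Proof.
have mpi : measurable_fun setT (pi t).
  by move=> _ B mB; rewrite setTI; apply: (info_meas (t := t)); exact: pi_info.
have mp : measurable_fun setT (fun o => (pi t o, r t o)) by exact: measurable_fun_pair.
exact: (measurableT_comp (measurable_policy_cost t) mp).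
Qed.

Lemma measurable_node_cost h :
  measurable_fun setT (fun o => node_cost nu mf mu0 (frozen adm (r^~ o)) h).
Proof.
have mn : measurable_fun setT (fun o : O => nd o h).
  apply: (@measurable_node R dim k M f nu mf mu0 g adm _ O r).
  by move=> s _; exact: measurable_r.
have mb : measurable_fun setT (fun o : O => normalize (nd o h)).
  exact: (measurableT_comp measurable_normalize mn).
have mp : measurable_fun setT (fun o => (normalize (nd o h), r (size h) o)).
  exact: measurable_fun_pair.
apply: emeasurable_funM.
  exact: (measurableT_comp (@measurable_giry_ev _ X R setT measurableT) mn).
exact: (measurableT_comp (measurable_policy_cost (size h)) mp).
Qed.

Lemma expected_cost t : \int[P]_o qcost (pi t o) (quant g r pi t o) =
  \int[P]_o hsum t (node_cost nu mf mu0 (frozen adm (r^~ o))).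
Proof.
rewrite (observed_partition t); last 2 first.
- exact: measurable_stage_cost.
- by move=> o; exact: qcost_ge0.
rewrite (integral_hsum P t (phi := fun h o => node_cost nu mf mu0 (frozen adm (r^~ o)) h)).
- by apply: eq_hsum => h <-; apply: observed_cost; exact: represented_all.
- by move=> h; exact: measurable_node_cost.
- by move=> h o; exact: node_cost_ge0.
Qed.

Lemma avg_costE T : avg_cost g P r pi T = (T%:R^-1)%:E *
  \int[P]_o \sum_(t < T) hsum t (node_cost nu mf mu0 (frozen adm (r^~ o))).
Proof.
have mh t : measurable_fun setT (fun o => hsum t (node_cost nu mf mu0 (frozen adm (r^~ o)))).
  apply: (measurable_hsum t (phi := fun h o => node_cost nu mf mu0 (frozen adm (r^~ o)) h)).
  by move=> h; exact: measurable_node_cost.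
have T0 : (0 <= T%:R^-1 :> R)%R by rewrite invr_ge0.
rewrite /avg_cost ge0_integralZl_EFin//; last 2 first.
- by move=> o _; apply: sume_ge0 => t _; exact: qcost_ge0.
- by apply: emeasurable_sum => t; exact: measurable_stage_cost.
congr (_ * _); rewrite ge0_integral_sum//; last 2 first.
- by move=> t; exact: measurable_stage_cost.
- by move=> t o _; exact: qcost_ge0.
rewrite ge0_integral_sum//; last first.
  by move=> t o _; apply: hsum_ge0 => h; exact: node_cost_ge0.
by apply: eq_bigr => t _; exact: expected_cost.
Qed.

(** Given the randomization the policy is one of the deterministic choices [G], so a bound valid for
    all of them can be integrated. The error [B] stands on the larger side to avoid subtracting
    infinite values. *)
Lemma avg_cost_ge T (K B : \bar R) : 0 <= K -> 0 <= B ->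
  (forall G : nat -> BS -> cquant, K <= \sum_(t < T) hsum t (node_cost nu mf mu0 G) + B) ->
  (T%:R^-1)%:E * K <= avg_cost g P r pi T + (T%:R^-1)%:E * B.
Proof.
move=> K0 B0 hK; rewrite avg_costE.
have T0 : 0 <= (T%:R^-1)%:E :> \bar R by rewrite lee_fin invr_ge0.
have S0 o : 0 <= \sum_(t < T) hsum t (node_cost nu mf mu0 (frozen adm (r^~ o))).
  by apply: sume_ge0 => t _; apply: hsum_ge0 => h; exact: node_cost_ge0.
rewrite -ge0_muleDr//; last by apply: integral_ge0 => o _.
apply: lee_wpmul2l => //.
have cstE c : \int[P]_o (cst c o) = c by rewrite integral_cst// [X in _ * X]probability_setT mule1.
rewrite -[leLHS]cstE -[X in _ <= _ + X]cstE -ge0_integralD//.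
  by apply: ge0_le_integral_nonmeasurable => o _; [exact: K0|exact: hK].
apply: emeasurable_sum => t.
apply: (measurable_hsum t (phi := fun h o => node_cost nu mf mu0 (frozen adm (r^~ o)) h)).
by move=> h; exact: measurable_node_cost.
Qed.

Lemma avg_cost_le T (K : \bar R) :
  (forall o, \sum_(t < T) hsum t (node_cost nu mf mu0 (frozen adm (r^~ o))) <= K) ->
  avg_cost g P r pi T <= (T%:R^-1)%:E * K.
Proof.
move=> hK; rewrite avg_costE; apply: lee_wpmul2l; first by rewrite lee_fin invr_ge0.
have cstE c : \int[P]_o (cst c o) = c by rewrite integral_cst// [X in _ * X]probability_setT mule1.
rewrite -[leRHS]cstE; apply: ge0_le_integral_nonmeasurable => o _; last exact: hK.
by apply: sume_ge0 => t _; apply: hsum_ge0 => h; exact: node_cost_ge0.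
Qed.

End Representation.

(** * Average costs *)

Section LimitInferior.
Local Open Scope ereal_scope.
Context {R : realType}.

Lemma limn_einf_ge (u : nat -> \bar R) (l : R) :
  (forall eps, (0 < eps)%R -> \forall n \near \oo, (l - eps)%:E <= u n) -> l%:E <= limn_einf u.
Proof.
move=> hl; apply/lee_addgt0Pr => eps eps0; have [N _ hN] := hl eps eps0.
rewrite limn_einf_lim (cvg_lim (@ereal_hausdorff R) (@cvg_einfs_sup R u)).
rewrite -leeBlDr// -EFinB; apply: (@le_trans _ _ (einfs u N)).
  by apply: le_ereal_inf_tmp => _ [n /= Nn <-]; exact: hN.
by apply: ereal_sup_ubound; exists N.
Qed.

Lemma ereal_squeeze (u : nat -> \bar R) (l : R) :
  (forall eps, (0 < eps)%R -> \forall n \near \oo, (l - eps)%:E <= u n) ->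
  (forall eps, (0 < eps)%R -> \forall n \near \oo, u n <= (l + eps)%:E) ->
  u @ \oo --> l%:E.
Proof.
move=> lo up; apply/fine_cvgP; split.
  have [N1 _ h1] := lo 1%R ltr01; have [N2 _ h2] := up 1%R ltr01.
  exists (maxn N1 N2) => // n /=; rewrite geq_max => /andP[n1 n2].
  have := h1 n n1; have := h2 n n2 => /=; by case: (u n).
apply/cvgrPdist_le => eps eps0.
have [N1 _ h1] := lo eps eps0; have [N2 _ h2] := up eps eps0.
exists (maxn N1 N2) => // n /=; rewrite geq_max => /andP[n1 n2].
have := h1 n n1; have := h2 n n2 => /=; case: (u n) => //= y; rewrite !lee_fin ler_norml; lra.
Qed.

Lemma near_div_le (B eps : R) : (0 <= B)%R -> (0 < eps)%R ->
  \forall T \near \oo, (T%:R^-1 * B <= eps)%R.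
Proof.
move=> B0 eps0; exists (Num.truncn (B / eps)).+1 => // T /= hT.
have : (B / eps < T%:R)%R.
  by apply: lt_le_trans (truncnS_gt _) _; rewrite ler_nat.
move=> lt; have T0 : (0 < T%:R :> R)%R.
  by apply: le_lt_trans lt; rewrite divr_ge0// ltW.
by rewrite mulrC ler_pdivrMr// mulrC -ler_pdivrMr// ltW.
Qed.

End LimitInferior.

(** * Second moments *)

Section Moments.
Local Open Scope ereal_scope.
Context {R : realType} {dim k : nat}.
Local Notation X := (dim.-tuple R).
Local Notation W := (k.-tuple R).
Variables (f : X -> W -> X) (nu : probability W R) (eps : R).
Hypothesis mf : measurable_fun [set: (X * W)%type] (fun z => f z.1 z.2).
Hypothesis eps0 : (0 < eps)%R.

Definition pownorm (y : X) : \bar R := (powR (enorm y) (2 + eps))%:E.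

Lemma pownorm_ge0 y : 0 <= pownorm y.
Proof. by rewrite lee_fin powR_ge0. Qed.

Lemma measurable_pownorm : measurable_fun setT pownorm.
Proof.
apply/measurable_EFinP; rewrite (_ : (fun y => _) = fun y : X =>
    powR (powR (\sum_(i < dim) tnth y i ^+ 2)%R 2^-1) (2 + eps)); last first.
  by apply/funext => y; rewrite powR12_sqrt// sumr_ge0// => i _; exact: sqr_ge0.
apply: (measurableT_comp (measurable_powR _)); apply: (measurableT_comp (measurable_powR _)).
by apply: measurable_sum => i; apply: measurable_funX; exact: measurable_tnth.
Qed.

Lemma sqnorm_le_pownorm (y : X) : sqnorm y <= 1 + pownorm y.
Proof.
rewrite /sqnorm /pownorm -EFinD lee_fin; set a := enorm y.
have a0 : (0 <= a)%R by exact: sqrtr_ge0.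
have [a1|a1] := leP a 1%R.
  by apply: (@le_trans _ _ 1%R); [rewrite exprn_ile1|rewrite lerDl powR_ge0].
rewrite -(powR_mulrn 2 a0); apply: (@le_trans _ _ (powR a (2 + eps))); last by rewrite lerDr.
by apply: ler_powR; [exact: ltW|rewrite lerDl ltW].
Qed.

Lemma iter_exp_sqnorm_le t x : iter_exp f nu t sqnorm x <= 1 + iter_exp f nu t pownorm x.
Proof.
elim: t x => [|t IH] x; first exact: sqnorm_le_pownorm.
rewrite /=; apply: (@le_trans _ _ (\int[nu]_w (cst 1 w + iter_exp f nu t pownorm (f x w)))).
  apply: ge0_le_integral_nonmeasurable => w _; last exact: IH.
  by apply: iter_exp_ge0; exact: sqnorm_ge0.
rewrite ge0_integralD//.
- by rewrite integral_cst// [X in _ * X]probability_setT mule1.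
- by move=> w _; apply: iter_exp_ge0; exact: pownorm_ge0.
- apply: (measurable_comp_f mf); apply: measurable_iter_exp => //; first exact: measurable_pownorm.
  exact: pownorm_ge0.
Qed.

(** The higher moments converge to a finite limit, hence are bounded from some time [T0] on, and
    they dominate the second moments. *)
Lemma initial_moments (x0 : X) (l : \bar R) : l < +oo ->
  (fun t => iter_exp f nu t pownorm x0) @ \oo --> l ->
  exists B T0, forall t, (T0 <= t)%N -> \int[\d_x0]_x iter_exp f nu t sqnorm x <= B%:E.
Proof.
move=> lfin cv.
have l0 : 0 <= l.
  rewrite -(cvg_lim (@ereal_hausdorff R) cv); apply: lime_ge; first by apply/cvg_ex; exists l.
  by near=> t; apply: iter_exp_ge0; exact: pownorm_ge0.
have lf : l \is a fin_num by rewrite ge0_fin_numE.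
rewrite -(fineK lf) in cv; move/fine_cvgP : cv => [[N1 _ h1] /cvgrPdist_le cv].
have [N2 _ h2] := cv 1%R ltr01.
exists (1 + (fine l + 1))%R, (maxn N1 N2) => t; rewrite geq_max => /andP[t1 t2].
rewrite integral_dirac//; last first.
  by apply: measurable_iter_exp => //; [exact: measurable_sqnorm|exact: sqnorm_ge0].
rewrite diracT mul1e; apply: le_trans (iter_exp_sqnorm_le _ _) _.
rewrite -(fineK (h1 t t1)) -EFinD lee_fin lerD2l.
by have := h2 t t2; rewrite /= ler_norml; lra.
Unshelve. all: by end_near. Qed.

Variables (pst m : probability X R) (A : set X) (delta : R).
Hypothesis mA : measurable A.
Hypothesis inv : Defs.invariant f nu pst.
Hypothesis delta01 : (0 < delta <= 1)%R.
Hypothesis minor : forall x E, A x -> measurable E -> delta%:E * m E <= trans f nu x E.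
Hypothesis pstA : 0 < pst A.
Hypothesis pst_fin : \int[pst]_x pownorm x < +oo.

Lemma invariant_sqnorm : \int[pst]_x sqnorm x <= (1 + fine (\int[pst]_x pownorm x))%:E.
Proof.
have i0 : 0 <= \int[pst]_x pownorm x by apply: integral_ge0 => x _; exact: pownorm_ge0.
rewrite EFinD fineK; last by rewrite ge0_fin_numE.
apply: (@le_trans _ _ (\int[pst]_x (cst 1 x + pownorm x))).
  by apply: ge0_le_integral_nonmeasurable => x _; [exact: sqnorm_ge0|exact: sqnorm_le_pownorm].
rewrite ge0_integralD//.
- by rewrite integral_cst// [X in _ * X]probability_setT mule1.
- by move=> x _; exact: pownorm_ge0.
- exact: measurable_pownorm.
Qed.

(** In one step of the stationary chain the mass of [A] deposits a multiple of [m]. Second moments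
    from [m] are thereby bounded by those from [pst], uniformly in time. *)
Lemma minor_invariant E : measurable E -> (delta * fine (pst A))%:E * m E <= pst E.
Proof.
move=> mE; have [d0 _] := andP delta01.
have pAf : pst A \is a fin_num by exact: fin_num_measure.
rewrite -(inv mE) EFinM fineK// muleAC.
apply: (@le_trans _ _ (\int[pst]_(x in A) (cst (delta%:E * m E) x))).
  by rewrite integral_cst.
apply: (@le_trans _ _ (\int[pst]_(x in A) trans f nu x E)).
  apply: ge0_le_integral_nonmeasurable => x Ax; last exact: minor.
  by rewrite mule_ge0// lee_fin ltW.
rewrite integral_mkcond; apply: ge0_le_integral_nonmeasurable => x _; rewrite /patch.
  by case: ifP.
by case: ifP => //; rewrite measure_ge0.
Qed.

Lemma minor_moments t : \int[m]_x iter_exp f nu t sqnorm x <=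
  ((1 + fine (\int[pst]_x pownorm x)) / (delta * fine (pst A)))%:E.
Proof.
have [d0 _] := andP delta01.
have pAf : pst A \is a fin_num by exact: fin_num_measure.
have c0 : (0 < delta * fine (pst A))%R.
  by rewrite mulr_gt0// fine_gt0// pstA/= ltey_eq pAf.
set c := (delta * fine (pst A))%R in c0 *.
have ms : measurable_fun setT (iter_exp f nu t sqnorm).
  by apply: measurable_iter_exp => //; [exact: measurable_sqnorm|exact: sqnorm_ge0].
have s0 x : 0 <= iter_exp f nu t sqnorm x by apply: iter_exp_ge0; exact: sqnorm_ge0.
rewrite EFinM lee_pdivlMr// muleC.
have := @ge0_integral_mscale _ _ R m setT measurableT (NngNum (ltW c0)) _ ms (fun x _ => s0 x).
move=> /= <-; apply: le_trans invariant_sqnorm.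
rewrite -(invariant_iter_exp mf t inv (@measurable_sqnorm R dim) (@sqnorm_ge0 R dim)).
by apply: ge0_le_integral_measure => // E mE; exact: minor_invariant.
Qed.

End Moments.

(** * Lower and upper bounds for the average cost *)

Section AverageCost.
Local Open Scope ereal_scope.
Context {R : realType} {dim k M : nat}.
Local Notation X := (dim.-tuple R).
Local Notation W := (k.-tuple R).
Local Notation BS := (giry X R).
Local Notation cquant := (@cquant R dim M).
Variables (f : X -> W -> X) (nu : probability W R).
Hypothesis mf : measurable_fun [set: (X * W)%type] (fun z => f z.1 z.2).
Variables (A : set X) (delta : R) (m : probability X R).
Hypothesis mA : measurable A.
Hypothesis delta01 : (0 < delta <= 1)%R.
Hypothesis minor : forall x E, A x -> measurable E -> delta%:E * m E <= trans f nu x E.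
Variables (Bm : R) (Q0 : cquant).
Hypothesis HBm : forall t, \int[m]_x iter_exp f nu t sqnorm x <= Bm%:E.
Variable e : R.
Hypothesis e0 : (0 < e)%R.
Hypothesis ecvg : series (fun n => fine (\int[m]_x survival f nu A delta m n x)) @ \oo --> e.
Hypothesis hit : forall x, (fun n => hit_prob f nu n A x) @ \oo --> 1.
Local Notation theta := (@theta R dim k M f nu mf A delta m).
Local Notation s := (smin A delta).

Section Lower.
Variables (mu0 : probability X R) (g : policy (R := R) (dim := dim) (M := M)).
Hypothesis adm : admissible g.
Variables (dO : measure_display) (O : measurableType dO) (P : probability O R).
Variables (x : nat -> O -> X) (w : nat -> O -> W) (r : nat -> O -> R) (pi : nat -> O -> BS).
Hypothesis HR : realization f nu mu0 g P x w r pi.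
Variables (B : R) (T0 : nat).
Hypothesis HB : forall t, (T0 <= t)%N -> \int[mu0]_x iter_exp f nu t sqnorm x <= B%:E.

(** [tree_lower] divided by [T] at fixed [beta]: regenerations occur with frequency at least [e^-1]
    in the limit, and the residual, at most [B / (1 - beta)], disappears. *)
Lemma avg_cost_discounted_ge (beta eps : R) : (0 < beta < 1)%R -> (0 < eps)%R ->
  \forall T \near \oo, (theta beta * e^-1 - eps)%:E <= avg_cost g P r pi T.
Proof.
move=> beta01 eps0; have [b0 b1] := andP beta01.
have beta01' : (0 <= beta < 1)%R by rewrite (ltW b0).
set th := theta beta; have th0 : (0 <= th)%R by exact: theta_ge0.
have B0 : (0 <= B)%R.
  rewrite -lee_fin; apply: le_trans (HB (leqnn T0)); apply: integral_ge0 => y _.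
  by apply: iter_exp_ge0; exact: sqnorm_ge0.
have Bd0 : (0 <= B / (1 - beta))%R by rewrite divr_ge0// subr_ge0 ltW.
(* Chosen so that [th * eps1 <= eps / 2], also when [th] vanishes. *)
pose eps1 := (eps / (2 * (th + 1)))%R.
have th1 : (0 < th + 1)%R by rewrite ltr_wpDl.
have eps10 : (0 < eps1)%R by rewrite divr_gt0// mulr_gt0.
have the : (th * eps1 <= eps / 2)%R.
  rewrite /eps1 mulrA ler_pdivrMr ?mulr_gt0//.
  rewrite (_ : eps / 2 * (2 * (th + 1)) = eps * (th + 1))%R; last by field.
  by rewrite mulrC ler_wpM2l ?(ltW eps0)// lerDl.
have e2 : (0 < eps / 2)%R by rewrite divr_gt0.
have [N1 _ h1] := frequency_lower mf mA delta01 minor e0 ecvg hit mu0 eps10.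
have [N2 _ h2] := near_div_le Bd0 e2.
have s0 : forall y, 0 <= s y by exact: smin_ge0.
exists (maxn T0.+1 (maxn N1 N2)) => // T /=; rewrite !geq_max => /and3P[TT0 T1 T2].
have Tp : (0 < T%:R :> R)%R by rewrite ltr0n; apply: leq_ltn_trans TT0.
have F0 : 0 <= \sum_(t < T) \int[mu0]_x iter_exp f nu t s x.
  by apply: sume_ge0 => t _; apply: integral_ge0 => y _; exact: iter_exp_ge0.
have := avg_cost_ge adm HR (mf := mf) (T := T)
  (K := th%:E * \sum_(t < T) \int[mu0]_x iter_exp f nu t s x) (B := (B / (1 - beta))%:E).
move=> /(_ (mule_ge0 _ F0)); rewrite !lee_fin => /(_ th0 Bd0) ge.
have {}ge := ge _.
have K : (T%:R^-1)%:E * (th%:E * \sum_(t < T) \int[mu0]_x iter_exp f nu t s x) <=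
    avg_cost g P r pi T + (T%:R^-1)%:E * (B / (1 - beta))%:E.
  apply: ge => G; apply: le_trans (tree_lower beta01' _ s0
    (rel_value_ge0 mf mA delta01 minor beta01 HBm Q0)
    (rel_value_upper mf mA delta01 minor beta01 HBm Q0) mu0 G T) _; first exact: measurable_smin.
  apply: leeD => //; apply: (@le_trans _ _ (hsum T (fun h => disc_value nu mf beta (node nu mf mu0 G h)))).
    by apply: hsum_le => h _; exact: rel_value_le.
  apply: hsum_disc_value_le => // t Tt; apply: HB; apply: leq_trans Tt; exact: ltnW.
have F : (T%:R^-1)%:E * (th%:E * (T%:R * (e^-1 - eps1))%:E) <=
    (T%:R^-1)%:E * (th%:E * \sum_(t < T) \int[mu0]_x iter_exp f nu t s x).
  apply: lee_wpmul2l; first by rewrite lee_fin invr_ge0 ltW.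
  by apply: lee_wpmul2l; [rewrite lee_fin|exact: h1].
have := le_trans F K; have := h2 T T2 => /= hB.
rewrite -!EFinM => /le_trans/(_ (leeD2l _ _)) => /(_ (eps / 2)%:E); rewrite lee_fin => /(_ hB).
rewrite -leeBlDr//; apply: le_trans; rewrite -EFinB lee_fin.
rewrite mulrCA mulKf ?gt_eqF// mulrBr; lra.
Qed.

End Lower.

Hypothesis A1 : assumption1 f nu.
Hypothesis m_null : hyperplane_null m.
Variable Cth : R.
Hypothesis theta_bounded : forall beta, (0 < beta < 1)%R -> (theta beta <= Cth)%R.

(** The shift by 2 keeps the discount factors at least one half, which bounds the relative value
    [theta / beta] of [m]. *)
Definition dfactor (n : nat) : R := (1 - n.+2%:R^-1)%R.

Lemma dfactor01 n : (0 < dfactor n < 1)%R.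
Proof.
rewrite /dfactor subr_gt0 gtrBl invr_gt0 ltr0n andbT.
by rewrite invf_lt1 ?ltr0n// ltr1n.
Qed.

Lemma dfactor_half n : (2^-1 <= dfactor n)%R.
Proof.
rewrite /dfactor lerBrDr -lerBrDl (_ : 1 - 2^-1 = 2^-1 :> R)%R; last by field.
by rewrite lef_pV2 ?posrE ?ltr0n// ler_nat.
Qed.

Lemma dfactor_cvg : dfactor @ \oo --> (1%R : R).
Proof.
rewrite -[X in _ --> X](subr0 1%R); apply: cvgB; first exact: cvg_cst.
have := @cvg_harmonic R; rewrite -(cvg_shiftS (fun n => n.+1%:R^-1 : R)%R); exact.
Qed.

Let th n := theta (dfactor n).

Definition theta_sup : R := sup (range th).

Let has_sup_th : has_sup (range th).
Proof.
split; first by exists (th 0%N), 0%N.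
by exists Cth => _ [n _ <-]; apply: theta_bounded; exact: dfactor01.
Qed.

Lemma theta_le_sup n : (th n <= theta_sup)%R.
Proof. by apply: sup_ubound; [case: has_sup_th|exists n]. Qed.

Lemma theta_sup_ge0 : (0 <= theta_sup)%R.
Proof. by apply: le_trans (theta_le_sup 0); apply: theta_ge0 => //; exact: dfactor01. Qed.

Lemma theta_sup_adherent eta : (0 < eta)%R -> exists n, (theta_sup - eta < th n)%R.
Proof. by move=> eta0; have [_ [n _ <-] lt] := sup_adherent eta0 has_sup_th; exists n. Qed.

(** Every discount factor gives a lower bound of its own; one with [theta] close to the supremum is
    fixed before the horizon grows. *)
Lemma avg_cost_sup_ge (mu0 : probability X R) (g : policy (R := R) (dim := dim) (M := M))
    dO (O : measurableType dO) (P : probability O R) x w r pi (B : R) (T0 : nat) (eps : R) :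
  admissible g -> realization f nu mu0 g P x w r pi ->
  (forall t, (T0 <= t)%N -> \int[mu0]_y iter_exp f nu t sqnorm y <= B%:E) -> (0 < eps)%R ->
  \forall T \near \oo, (theta_sup / e - eps)%:E <= avg_cost g P r pi T.
Proof.
move=> adm HR HB eps0; have e2 : (0 < eps / 2)%R by rewrite divr_gt0.
have [n lt] := theta_sup_adherent (mulr_gt0 e2 e0).
have [N _ hN] := avg_cost_discounted_ge adm HR HB (dfactor01 n) e2.
exists N => // T /hN; apply: le_trans; rewrite lee_fin.
have : ((theta_sup - eps / 2 * e) / e <= th n / e)%R by rewrite ler_wpM2r ?invr_ge0 ?ltW.
by rewrite mulrBl mulfK ?gt_eqF// /th; lra.
Qed.

Let h n : BS -> \bar R := rel_value nu mf A delta m (dfactor n) (M := M).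

Let us : unit_fun s.
Proof. by split => [|y]; [exact: measurable_smin|rewrite smin_ge0// smin_le1]. Qed.

Let h0 n p : 0 <= h n p.
Proof. exact: (rel_value_ge0 mf mA delta01 minor (dfactor01 n) HBm Q0). Qed.

Let h_scale n (c : R) (p q : BS) : (0 <= c)%R -> is_mix c 0 p q q -> c%:E * h n q <= h n p.
Proof. exact: (rel_value_scale mf mA delta01 minor (dfactor01 n) HBm Q0). Qed.

(** Replacing each [theta] by the supremum only enlarges the right-hand side, and yields one
    constant for all discount factors. *)
Let h_lower n (p : BS) (eps : R) : (0 < eps)%R -> exists Q : cquant,
  qcost p (sval Q) + (dfactor n)%:E * \sum_(i < M) h n (updq nu mf p (sval Q) i) <=
    h n p + theta_sup%:E * \int[p]_x s x + eps%:E.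
Proof.
move=> eps0; have [Q hQ] := rel_value_lower mf mA delta01 minor (dfactor01 n) HBm Q0 p eps0.
exists Q; apply: (le_trans hQ); rewrite leeD2r// leeD2l// lee_wpmul2r//.
  by apply: integral_ge0 => y _; exact: smin_ge0.
by rewrite lee_fin; exact: theta_le_sup.
Qed.

Let Hv := limit_value h.

(** The constant belief [m] competes in the lower limit, with relative values [theta / beta] at most
    [theta_sup * 2]. *)
Let Hv_m : Hv m < +oo.
Proof.
apply: (@le_lt_trans _ _ (theta_sup * 2)%:E); last exact: ltry.
apply: limit_value_le => N; exists N, (m : BS); split => //.
  by apply: tv_close_refl; rewrite invr_ge0.
rewrite /h (rel_value_m mf mA delta01 (dfactor01 N) HBm Q0) lee_fin.
have [d0 _] := andP (dfactor01 N).
rewrite ler_pdivrMr//; apply: le_trans (theta_le_sup N) _.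
rewrite -mulrA ler_peMr ?theta_sup_ge0//.
have := dfactor_half N; lra.
Qed.

Let Qopt := Qsel nu mf Hv theta_sup s Q0.

Let H_opt (p : BS) : hyperplane_null p -> Hv p < +oo -> exists Q : cquant, optimal nu mf Hv theta_sup s p Q.
Proof.
exact: (limit_value_optimality (mf := mf) dfactor01 dfactor_cvg theta_sup_ge0 us h0 h_lower m_null).
Qed.

Local Notation N := (node nu mf (m : BS) (fun=> Qopt)).

(** Histories are countable and enumerated by [unpickle]; the resulting policy depends neither on
    time nor on the randomization. *)
Lemma optimal_policy : exists g : policy (R := R) (dim := dim) (M := M),
  [/\ admissible g, stationary g & forall h t u, g t (normalize (N h)) u = sval (Qopt (normalize (N h)))].
Proof.
pose v n := normalize (N (odflt [::] (unpickle n))).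
have [G [Gc Gm GE]] := countable_policy (v := v) (q := fun n => Qopt (v n)) Q0
  (fun n j => @Qsel_agree R dim k M f nu mf (limit_value h) theta_sup s Q0 (@limit_value_agree _ _ h) (v n) (v j)).
exists (fun _ p _ => G p); split => //.
by move=> l t u; have := GE (pickle l); rewrite /v pickleK.
Qed.

Section Upper.
Variables (g : policy (R := R) (dim := dim) (M := M)).
Hypothesis adm : admissible g.
Hypothesis gE : forall h t u, g t (normalize (N h)) u = sval (Qopt (normalize (N h))).

Lemma frozen_node rho l : node nu mf (m : BS) (frozen adm rho) l = N l.
Proof. by elim: l => [//|i l IH] /=; rewrite IH gE. Qed.

Lemma frozen_node_cost rho l :
  node_cost nu mf (m : BS) (frozen adm rho) l = node_cost nu mf (m : BS) (fun=> Qopt) l.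
Proof. by rewrite /node_cost /node_quant frozen_node /= gE. Qed.

Variables (dO : measure_display) (O : measurableType dO) (P : probability O R).
Variables (x : nat -> O -> X) (w : nat -> O -> W) (r : nat -> O -> R) (pi : nat -> O -> BS).
Hypothesis HR : realization f nu m g P x w r pi.

(** [tree_upper] divided by [T]: the finite value at [m] disappears and [frequency_upper] handles
    the regenerations. *)
Lemma avg_cost_sup_le eps : (0 < eps)%R ->
  \forall T \near \oo, avg_cost g P r pi T <= (theta_sup / e + eps)%:E.
Proof.
move=> eps0; have ts0 := theta_sup_ge0; have e2 : (0 < eps / 2)%R by rewrite divr_gt0.
have Hm0 : 0 <= Hv m by exact: limit_value_ge0.
have Hmf : Hv m \is a fin_num by rewrite ge0_fin_numE.
have th1 : (0 < theta_sup + 1)%R by rewrite ltr_wpDl.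
pose eps1 := (eps / (2 * (theta_sup + 1)))%R.
have eps10 : (0 < eps1)%R by rewrite divr_gt0// mulr_gt0.
have the : (theta_sup * eps1 <= eps / 2)%R.
  rewrite /eps1 mulrA ler_pdivrMr ?mulr_gt0//.
  rewrite (_ : eps / 2 * (2 * (theta_sup + 1)) = eps * (theta_sup + 1))%R; last by field.
  by rewrite mulrC ler_wpM2l ?(ltW eps0)// lerDl.
have [N1 _ h1] := frequency_upper mf mA delta01 minor e0 ecvg eps10.
have [N2 _ h2] := near_div_le (fine_ge0 Hm0) e2.
exists (maxn 1 (maxn N1 N2)) => // T /=; rewrite !geq_max => /and3P[T0 T1 T2].
have Tp : (0 < T%:R :> R)%R by rewrite ltr0n.
apply: (le_trans (avg_cost_le (adm := adm) HR
  (K := (fine (Hv m) + theta_sup * (T%:R * (e^-1 + eps1)))%:E) _)).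
  move=> o; apply: (@le_trans _ _ (\sum_(t < T) hsum t (node_cost nu mf (m : BS) (fun=> Qopt)))).
    by apply: lee_sum => t _; apply: hsum_le => l _; rewrite frozen_node_cost.
  apply: le_trans (tree_upper A1 Q0 ts0 us (limit_value_ge0 h0) (@limit_value_agree _ _ h) (limit_value_scale h0 h_scale) H_opt
    m_null (probability_setT m) Hv_m T) _.
  rewrite EFinD fineK// leeD2l// EFinM lee_wpmul2l//; exact: h1.
rewrite -EFinM lee_fin; have := h2 T T2 => /= hB.
rewrite mulrDr [X in (_ + X)%R]mulrCA mulKf ?gt_eqF// mulrDr; lra.
Qed.

End Upper.

End AverageCost.

Lemma cst_convex_quantizer {R : realType} {dim M : nat} (i : 'I_M) :
  @convex_quantizer R dim M (fun=> i).
Proof.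
move=> j; have [<-|ij] := eqVneq i j.
  by rewrite (_ : _ @^-1` _ = setT)//; apply/seteqP; split.
rewrite (_ : _ @^-1` _ = set0).
  by split=> // a b l [].
by apply/seteqP; split => // x /= e; move: ij; rewrite e eqxx.
Qed.

Unset Implicit Arguments.

Theorem theorem9 (R : realType) (dim k M : nat)
    (f : dim.-tuple R -> k.-tuple R -> dim.-tuple R) (nu : probability (k.-tuple R) R) :
  (0 < M)%N ->
  assumption1 f nu -> assumption3 f nu -> assumption5 f nu ->
  exists (gstar : policy (R := R) (dim := dim) (M := M))
         (pi0star : probability (dim.-tuple R) R) (L : R),
    admissible gstar /\ stationary gstar /\ initial_ok pi0star /\
    (* the limit exists (and equals L) for Pi* started from pi0* *)
    (forall (dO : measure_display) (O : measurableType dO) (P : probability O R)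
            (x : nat -> O -> dim.-tuple R) (w : nat -> O -> k.-tuple R)
            (r : nat -> O -> R) (pi : nat -> O -> giry (dim.-tuple R) R),
       realization f nu pi0star gstar P x w r pi ->
       avg_cost gstar P r pi @ \oo --> L%:E) /\
    (* and it is below the liminf of every Pi started from delta_{x0} *)
    (forall (x0 : dim.-tuple R) (g : policy (R := R) (dim := dim) (M := M)),
       admissible g ->
       forall (dO : measure_display) (O : measurableType dO) (P : probability O R)
              (x : nat -> O -> dim.-tuple R) (w : nat -> O -> k.-tuple R)
              (r : nat -> O -> R) (pi : nat -> O -> giry (dim.-tuple R) R),
         realization f nu (\d_x0) g P x w r pi ->
         (L%:E <= limn_einf (avg_cost g P r pi))%E).
Proof.
move=> M0 A1 _ [[psi [_ [psi0 hit]]] [pst [inv [_ [eps [eps0 [pfin mom]]]]]]].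
(* Positive [psi]-measure makes [A] recurrent, positive [pst]-measure makes the mean regeneration
   time finite. *)
have [A [delta [m [mA d01 dens minor [m_null [psiA pstA]]]]]] := minorization A1 pst psi0.
have hitA := hit A mA psiA; have mf := A1.1.
(* A single cell filling the space; [M0] provides its label. *)
pose Q0 : @cquant R dim M := exist _ _ (cst_convex_quantizer (Ordinal M0)).
have HBm := minor_moments mf eps0 mA inv d01 minor pstA pfin.
have [e e0 ecvg] := regeneration_time mf mA d01 minor inv pstA.
have pstAf : pst A \is a fin_num by exact: fin_num_measure.
have [d0 _] := andP d01.
have c0 : 0 < delta * fine (pst A).
  by rewrite mulr_gt0// fine_gt0// pstA/= ltey_eq pstAf.
pose Cth := (1 + fine (\int[pst]_x pownorm eps x)) / (delta * fine (pst A)).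
have theta_bounded beta : 0 < beta < 1 -> @theta R dim k M f nu mf A delta m beta <= Cth.
  move=> b01; rewrite /Cth ler_pdivlMr//.
  apply: (theta_le mf mA d01 minor b01 HBm Q0 inv pstA).
  exact: invariant_sqnorm.
have [g [adm stat gE]] := optimal_policy nu mf A delta m Q0.
exists g, m, (@theta_sup R dim k M f nu mf A delta m / e); split => //; split => //; split; last split.
- left; have [rho hrho] := dens; exists rho; split => //.
  by apply: le_lt_trans (HBm 0%N) _; exact: ltry.
- move=> dO O P x w r pi HR; apply: ereal_squeeze => et et0.
    (* From [m] the second moments are bounded at all times, hence [T0 = 0]. *)
    apply: (avg_cost_sup_ge mA d01 minor Q0 HBm e0 ecvg hitA theta_bounded adm HR (T0 := 0%N)) => //.
  exact: (avg_cost_sup_le mA d01 minor HBm e0 ecvg A1 m_null theta_bounded adm gE HR).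
- move=> x0 g' adm' dO O P x w r pi HR; apply: limn_einf_ge => et et0.
  have [B [T0 hB]] := initial_moments mf eps0 pfin (mom x0).
  exact: (avg_cost_sup_ge (mu0 := \d_x0) mA d01 minor Q0 HBm e0 ecvg hitA theta_bounded adm' HR hB).
Qed.
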